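(* Let $H\in(0,1)\setminus\{1/2\}$, let $B^H$ be a fractional Brownian motion with Hurst index $H$, and let $u:\mathbb{R}_+\to\mathbb{R}$ be measurable with $u(0)\ge 0$ and $P(B^H(t)\le u(t),\ t\in\mathbb{R}_+)\in(0,1)$. Let $f:\mathbb{R}_+\to\mathbb{R}$ be differentiable with derivative $f'\in L_2(\mathbb{R}_+)$. Assume: (i) $K_{0+}^{H,*}f'\in L_2(\mathbb{R}_+)$, i.e. $f\in\mathcal{H}$. (ii) Let $h(t)=\int_0^t (K_{0+}^{H,*}f')(s)\,ds$. The smallest concave nondecreasing majorant $\widetilde h$ of $h$ has right-hand derivative $\widetilde h'\in L_2(\mathbb{R}_+)$; moreover the function $K(t):=(K_{\infty-}^{H,*}\widetilde h')(t)$ is nonincreasing, $K\in L_2^H(\mathbb{R}_+)$ if $H>\frac12$ and $K\in\widetilde L_2^H(\mathbb{R}_+)$ if $H<\frac12$, and $K(t)=o(t^{-H})$ as $t\to\infty$. (iii) $\widetilde h'(t)=(K_{0+}^{H,*}\hat f')(t)$, $t\in\mathbb{R}_+$, for some $\hat f'\in L_2(\mathbb{R}_+)$. Put $\widehat f(t)=\int_0^t\hat f'(s)\,ds=\int_0^t (K_{0+}^H\widetilde h')(s)\,ds$. If $H<1/2$, assume additionally that $\widehat f\ge f$. Then $$\inf_{g\in\mathcal{H},\ g\ge f}\|g\|_{\mathcal{H}}=\|\widehat f\|_{\mathcal{H}}=\|\widetilde h\|.$$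
   Context: $\mathbb{R}_+=[0,\infty)$. $B^H$ is a (continuous) centered Gaussian process with covariance $R_H(s,t)=\frac12(t^{2H}+s^{2H}-|t-s|^{2H})$, $s,t\ge0$. Fractional calculus: for $\alpha>0$, $(I_{0+}^\alpha f)(t)=\frac1{\Gamma(\alpha)}\int_0^t(t-u)^{\alpha-1}f(u)\,du$ and $(I_{\infty-}^\alpha f)(t)=\frac1{\Gamma(\alpha)}\int_t^\infty(u-t)^{\alpha-1}f(u)\,du$. For $0<\alpha<1$ and $f$ of the form $f=I_{0+}^\alpha\varphi$ (resp. $f=I_{\infty-}^\alpha\varphi$) with $\varphi\in L_p$ for some $p\ge1$ (on each $[0,T]$ for the left-sided operator, on $\mathbb{R}_+$ for the right-sided one), $I_{0+}^{-\alpha}f$ (resp. $I_{\infty-}^{-\alpha}f$) is this (a.e. unique) $\varphi$, which equals the Riemann-Liouville derivative $\frac1{\Gamma(1-\alpha)}\frac{d}{dt}\int_0^t(t-u)^{-\alpha}f(u)\,du$ (resp. $-\frac1{\Gamma(1-\alpha)}\frac{d}{dt}\int_t^\infty(u-t)^{-\alpha}f(u)\,du$). With $C_1=\left(\frac{2H\Gamma(H+1/2)\Gamma(3/2-H)}{\Gamma(2-2H)}\right)^{1/2}$ define $(K_{0+}^Hf)(t)=C_1t^{H-1/2}(I_{0+}^{H-1/2}u^{1/2-H}f(u))(t)$, $(K_{0+}^{H,*}f)(t)=C_1^{-1}t^{H-1/2}(I_{0+}^{1/2-H}u^{1/2-H}f(u))(t)$, $(K_{\infty-}^Hf)(t)=C_1t^{1/2-H}(I_{\infty-}^{H-1/2}u^{H-1/2}f(u))(t)$,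 $(K_{\infty-}^{H,*}f)(t)=C_1^{-1}t^{1/2-H}(I_{\infty-}^{1/2-H}u^{H-1/2}f(u))(t)$. For $t>s$ let $K_H(t,s)=(K_{\infty-}^H1_{[0,t]})(s)=\frac{C_1}{\Gamma(H+1/2)}\Big(\big(\tfrac ts\big)^{H-1/2}(t-s)^{H-1/2}-(H-\tfrac12)s^{1/2-H}\int_s^t(u-s)^{H-1/2}u^{H-3/2}\,du\Big)$. The reproducing kernel Hilbert space $\mathcal{H}$ of $B^H$ on $\mathbb{R}_+$ is the set of functions $f(t)=\int_0^tK_H(t,s)\phi(s)\,ds$ with $\phi\in L_2(\mathbb{R}_+)$, with norm $\|f\|_{\mathcal{H}}=\|\phi\|_{L_2(\mathbb{R}_+)}$; equivalently, when $f(t)=\int_0^tf'(s)\,ds$, $f'=K_{0+}^H\phi$, $\phi=K_{0+}^{H,*}f'$ and $\|f\|_{\mathcal{H}}=\|K_{0+}^{H,*}f'\|_{L_2(\mathbb{R}_+)}$. $L_2^H(\mathbb{R}_+)=\{f: K_{\infty-}^H|f|\in L_2(\mathbb{R}_+)\}$. For $H\in(0,1/2)$, $\widetilde L_2^H(\mathbb{R}_+)$ is the set of $f\in L_2^H(\mathbb{R}_+)$ with $\int_0^Tt^{1-2H}\big(\int_T^\infty u^{H-1/2}f(u)(u-t)^{H-3/2}\,du\big)^2dt\to0$ as $T\to\infty$. For a function $g(t)=\int_0^tg'(s)\,ds$, $\|g\|:=\|g'\|_{L_2(\mathbb{R}_+)}$. Inequalities such as $g\ge f$ are pointwise on $\mathbb{R}_+$.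 *)

(* Defs.v *)
From HB Require Import structures.
From mathcomp Require Import all_boot all_order all_algebra.
From mathcomp Require Import all_classical all_reals all_analysis.

Set Implicit Arguments.
Unset Strict Implicit.
Unset Printing Implicit Defensive.

Import Order.TTheory GRing.Theory Num.Theory.
Import numFieldNormedType.Exports.

Local Open Scope classical_set_scope.
Local Open Scope ring_scope.

(* A function on the half-line [0, +oo) is represented by a total function on
   R whose values at negative arguments are never used. *)

Section half_line.
Context {R : realType}.
Notation mu := (@lebesgue_measure R).
Implicit Types (D : set R) (f g h m phi : R -> R) (t x p : R).

Definition Rplus : set R := `[0, +oo[.

Definition Lp_norm D p f : \bar R := 'N[mu]_p%:E [EFin \o (f \_ D)].

Definition in_Lp D p f : Prop :=
  measurable_fun D f /\ (Lp_norm D p f < +oo)%E.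

Definition L2_norm f : \bar R := Lp_norm Rplus 2 f.

Definition in_L2 f : Prop := in_Lp Rplus 2 f.

Definition primitive f t : R := \int[mu]_(s in `[0, t]) f s.

(* One-sided at t = 0. *)
Definition derivative_on_Rplus f (f' : R -> R) : Prop :=
  forall t, 0 <= t ->
    (s - t)^-1 * (f s - f t) @[s --> within Rplus t^'] --> f' t.

(* The right derivative at 0 of a concave function may be infinite, hence the
   restriction to t > 0. *)
Definition right_derivative f (f' : R -> R) : Prop :=
  forall t, 0 < t -> e^-1 * (f (t + e) - f t) @[e --> 0^'+] --> f' t.

Definition concave_nondecreasing_majorant (h m : R -> R) : Prop :=
  [/\ convex_function Rplus (fun t => - m t),
      {in Rplus &, {homo m : s t / s <= t}} &
      forall t, 0 <= t -> h t <= m t].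

Definition least_concave_nondecreasing_majorant (h m : R -> R) : Prop :=
  concave_nondecreasing_majorant h m /\
  forall m', concave_nondecreasing_majorant h m' ->
    forall t, 0 <= t -> m t <= m' t.

Definition Gamma x : R := \int[mu]_(t in `]0, +oo[) (t `^ (x - 1) * expR (- t)).

(* Fractional integrals and derivatives are functions defined almost everywhere,
   so every operator A below is a relation: "A f g" means that A f exists and
   that g is one of its versions. *)

Definition frac_int_left (alpha : R) f g : Prop :=
  {ae mu, forall t, 0 < t ->
    mu.-integrable `]0, t[ (EFin \o (fun u => (t - u) `^ (alpha - 1) * f u)) /\
    g t = (Gamma alpha)^-1 *
          \int[mu]_(u in `]0, t[) ((t - u) `^ (alpha - 1) * f u)}.

Definition frac_int_right (alpha : R) f g : Prop :=
  {ae mu, forall t, 0 < t ->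
    mu.-integrable `]t, +oo[
      (EFin \o (fun u => (u - t) `^ (alpha - 1) * f u)) /\
    g t = (Gamma alpha)^-1 *
          \int[mu]_(u in `]t, +oo[) ((u - t) `^ (alpha - 1) * f u)}.

Definition frac_der_left (alpha : R) f g : Prop :=
  (exists2 p, 1 <= p & forall T, 0 < T -> in_Lp `[0, T] p g) /\
  frac_int_left alpha g f.

Definition frac_der_right (alpha : R) f g : Prop :=
  (exists2 p, 1 <= p & in_Lp Rplus p g) /\ frac_int_right alpha g f.

(* Signed order: integrals for beta > 0, derivatives for beta < 0.  The order
   beta = 0 does not occur. *)
Definition I_left (beta : R) f g : Prop :=
  if 0 < beta then frac_int_left beta f g else frac_der_left (- beta) f g.

Definition I_right (beta : R) f g : Prop :=
  if 0 < beta then frac_int_right beta f g else frac_der_right (- beta) f g.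

Definition C1 (H : R) : R :=
  Num.sqrt (2 * H * Gamma (H + 2^-1) * Gamma (3 / 2 - H) / Gamma (2 - 2 * H)).

(* K_{0+}^{H,*} *)
Definition Kleft_star (H : R) f g : Prop :=
  exists2 k, I_left (2^-1 - H) (fun u => u `^ (2^-1 - H) * f u) k &
    {ae mu, forall t, 0 < t -> g t = (C1 H)^-1 * t `^ (H - 2^-1) * k t}.

(* K_{oo-}^H *)
Definition Kright (H : R) f g : Prop :=
  exists2 k, I_right (H - 2^-1) (fun u => u `^ (H - 2^-1) * f u) k &
    {ae mu, forall t, 0 < t -> g t = C1 H * t `^ (2^-1 - H) * k t}.

(* K_{oo-}^{H,*} *)
Definition Kright_star (H : R) f g : Prop :=
  exists2 k, I_right (2^-1 - H) (fun u => u `^ (H - 2^-1) * f u) k &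
    {ae mu, forall t, 0 < t -> g t = (C1 H)^-1 * t `^ (2^-1 - H) * k t}.

Definition in_L2H (H : R) f : Prop :=
  measurable_fun Rplus f /\
  exists2 g, Kright H (fun t => `|f t|) g & in_L2 g.

(* The inner integral is extended-real valued: if it diverges, its square is
   +oo and the condition fails. *)
Definition in_L2H_tilde (H : R) f : Prop :=
  in_L2H H f /\
  (\int[mu]_(t in `[0%R, T])
     ((t `^ (1 - 2 * H))%:E *
      (\int[mu]_(u in `]T, +oo[)
         (u `^ (H - 2^-1) * f u * (u - t) `^ (H - 3 / 2))%:E) ^+ 2)
   @[T --> +oo%R] --> 0)%E.

Definition KH (H t s : R) : R :=
  C1 H / Gamma (H + 2^-1) *
  ((t / s) `^ (H - 2^-1) * (t - s) `^ (H - 2^-1)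
   - (H - 2^-1) * s `^ (2^-1 - H) *
     \int[mu]_(u in `]s, t[) ((u - s) `^ (H - 2^-1) * u `^ (H - 3 / 2))).

Definition rkhs_repr (H : R) f phi : Prop :=
  in_L2 phi /\
  forall t, 0 <= t -> f t = \int[mu]_(s in `]0, t[) (KH H t s * phi s).

Definition rkhs (H : R) : set (R -> R) :=
  [set f | exists phi, rkhs_repr H f phi].

(* The function phi representing an element of the space is unique up to a null
   set, so the choice made by xget is immaterial.  Outside the space the value
   is the norm of the zero function. *)
Definition rkhs_norm (H : R) f : \bar R :=
  L2_norm (xget (cst 0) [set phi | rkhs_repr H f phi]).

End half_line.

Section fractional_Brownian_motion.
Context {R : realType} {d : measure_display} {T : measurableType d}.
Variable P : probability T R.

(* The variance sigma ^+ 2 may vanish; normal_prob 0 0 is not the Dirac mass. *)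
Definition centered_gaussian (X : T -> R) : Prop :=
  measurable_fun setT X /\
  exists2 sigma : R, 0 <= sigma &
    forall A : set R, measurable A ->
      P (X @^-1` A) = (if sigma == 0 then \d_(0 : R) A else normal_prob 0 sigma A).

Definition centered_gaussian_process (B : R -> T -> R) : Prop :=
  forall (n : nat) (t c : 'I_n -> R), (forall i, 0 <= t i) ->
    centered_gaussian (fun w => \sum_(i < n) c i * B (t i) w).

Definition fractional_Brownian_motion (H : R) (B : R -> T -> R) : Prop :=
  [/\ centered_gaussian_process B,
      forall s t : R, 0 <= s -> 0 <= t ->
        covariance P (B s) (B t) =
        (2^-1 * (t `^ (2 * H) + s `^ (2 * H) - `|t - s| `^ (2 * H)))%:E &
      forall w, {within Rplus, continuous (fun t => B t w)}].

(* P (B_t <= u(t) for all t >= 0).  The event is an uncountable intersection, so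
   its probability is written with the outer measure induced by P, which agrees
   with P on measurable sets and with the completion of P on its domain. *)
Definition prob_below (B : R -> T -> R) (u : R -> R) : \bar R :=
  mu_ext P [set w | forall t : R, 0 <= t -> B t w <= u t].

End fractional_Brownian_motion.

(* Main.v *)
(** The map [phi |-> (t |-> \int_0^t K_H(t, s) phi(s) ds)] is an isometry of L_2
    onto the reproducing kernel space, so [g >= f] means that the difference [chi] of
    the functions representing [g] and [f] satisfies [\int K_H(t, s) chi(s) ds >= 0]
    for all [t]. Let [sigma y] be the supremum of the set where the nonincreasing
    function [K] exceeds [y]. The layer-cake formula for [K] turns the relation between
    [ht'] and [K] into [ht' = \int_0^oo K_H(sigma y, .) dy] (for [H < 1/2], after
    truncating [ht']), and therefore [<chi, ht'> >= 0]. The layer-cake formula for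
    [ht'] itself, whose levels end at points where [ht] touches [h], gives
    [<ht' - phi, ht'> = 0]. If [psi] represents [g], adding up yields
    [<psi - ht', ht'> >= 0], hence [|psi| >= |ht'|], with equality for [fhat]. For
    [H > 1/2], [K_H(t, .)] is nonincreasing, and its own layer-cake formula together
    with [ht >= h] shows that [fhat >= f]. *)

Require Import Defs.
From HB Require Import structures.
From mathcomp Require Import all_boot all_order all_algebra.
From mathcomp Require Import all_classical all_reals all_analysis.
From mathcomp Require Import measurable_realfun ring lra.

Set Implicit Arguments.
Unset Strict Implicit.
Unset Printing Implicit Defensive.

Import Order.TTheory GRing.Theory Num.Theory.
Import numFieldNormedType.Exports.

Local Open Scope classical_set_scope.
Local Open Scope ring_scope.

(** The layers of [K] become kernels because the weighted Abel operator that sends [ht'] to [K] also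
    sends K_H(t, .) to the indicator of (0, t). For H > 1/2 that operator is a fractional
    derivative, so [ht'] is already an Abel integral of [K] and exchanging integrals suffices. For H
    < 1/2 it is an integral operator that has to be inverted, and uniqueness in Abel's equation
    needs enough integrability to subtract two solutions. This asymmetry is why the facts about the
    kernel are proved separately in the two ranges. The norm of the space is defined through a
    chosen representing function, so it can be computed only once a function orthogonal to all
    K_H(t, .) is known to vanish. For H > 1/2 this is injectivity of Abel transforms; for H < 1/2
    truncated powers are exhibited as superpositions of kernels. The derivatives of [f] and [ht] are
    given pointwise and need not be continuous. Their primitives are recovered by a fundamental
    theorem for right derivatives, which compares the derivative with a lower semicontinuous
    majorant. *)

Section truncated_power.
Context {R : realType}.
Notation mu := (@lebesgue_measure R).

(* The truncated power x_+^p absorbs the indicator functions of integration domains. *)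
Definition pw (p x : R) : R := if 0 < x then x `^ p else 0.

Lemma pw_ge0 p x : 0 <= pw p x.
Proof. by rewrite /pw; case: ifP => // _; exact: powR_ge0. Qed.

Lemma pw_gt0 p x : 0 < x -> 0 < pw p x.
Proof. by move=> x0; rewrite /pw x0 powR_gt0. Qed.

Lemma pwE p x : 0 < x -> pw p x = x `^ p.
Proof. by rewrite /pw => ->. Qed.

Lemma pw_le0 p x : x <= 0 -> pw p x = 0.
Proof. by rewrite /pw ltNge => ->. Qed.

Lemma pwM p q x : pw p x * pw q x = pw (p + q) x.
Proof.
rewrite /pw; case: ifPn => [x0|_]; last by rewrite mulr0.
by rewrite -powRD// (gt_eqF x0)// implybT.
Qed.

Lemma pw_scale p c x : 0 < c -> pw p (c * x) = c `^ p * pw p x.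
Proof.
move=> c0; rewrite /pw pmulr_rgt0//; case: ifPn => [x0|_]; last by rewrite mulr0.
by rewrite powRM// ltW.
Qed.

Lemma measurable_fun_comp_pw d (T : measurableType d) (g : T -> R) p :
  measurable_fun [set: T] g -> measurable_fun [set: T] (fun x => pw p (g x)).
Proof.
move=> mg; apply: measurable_fun_ifT => //=.
- exact: measurable_fun_ltr.
- exact: (measurableT_comp (measurable_powR _)).
Qed.

Lemma measurable_fun_natr_lt d (T : measurableType d) (f g : T -> R) :
  measurable_fun [set: T] f -> measurable_fun [set: T] g ->
  measurable_fun [set: T] (fun x => (f x < g x)%R%:R : R).
Proof.
move=> mf mg; rewrite (_ : (fun x => _) = fun x => if f x < g x then 1 else 0).
  by apply: measurable_fun_ifT => //; exact: measurable_fun_ltr.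
by apply/funext => x; case: ifP.
Qed.

Lemma measurable_fun_norm d (T : measurableType d) (g : T -> R) :
  measurable_fun [set: T] g -> measurable_fun [set: T] (fun x => `|g x|).
Proof. by move=> mg; exact: measurableT_comp. Qed.

Lemma measurable_fun_opp d (T : measurableType d) (g : T -> R) :
  measurable_fun [set: T] g -> measurable_fun [set: T] (fun x => - g x).
Proof. by move=> mg; exact: measurableT_comp. Qed.

End truncated_power.

Ltac meas1 := match goal with
  | H : measurable_fun _ ?f |- measurable_fun _ ?f => exact H
  | |- measurable_fun _ (fun x => ?c) => exact: measurable_cst
  | |- measurable_fun _ (fun x => x) => exact: measurable_id
  | |- measurable_fun _ (fun x => x.1) => exact: measurable_fst
  | |- measurable_fun _ (fun x => x.2) => exact: measurable_snd
  | |- measurable_fun _ (fun x => pw _ _) => apply: measurable_fun_comp_pw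
  | |- measurable_fun _ (pw _) => apply: (measurable_fun_comp_pw (g := id))
  | |- measurable_fun _ id => exact: measurable_id
  | |- measurable_fun _ (fun x => _%:R) => apply: measurable_fun_natr_lt
  | |- measurable_fun _ (fun x => _ * _) => apply: measurable_funM
  | |- measurable_fun _ (fun x => _ - _) => apply: measurable_funB
  | |- measurable_fun _ (fun x => _ + _) => apply: measurable_funD
  | |- measurable_fun _ (fun x => - _) => apply: measurable_fun_opp
  | |- measurable_fun _ (fun x => `|_|) => apply: measurable_fun_norm
  | |- measurable_fun _ (fun x => _ ^+ _) => apply: measurable_funX
  | |- measurable_fun _ (fun x => (_)%:E) => apply/measurable_EFinP
  | H : measurable_fun [set: _] ?f |- measurable_fun _ (fun x => ?f _) =>
      apply: (measurableT_comp H)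
  end.

Ltac meas := repeat meas1.

(** * Affine changes of variable for Lebesgue measure *)

Section change_of_variable.
Context {R : realType}.
Notation mu := (@lebesgue_measure R).
Local Open Scope ereal_scope.

(** A measure that gives half-open intervals their length is Lebesgue measure, so testing the scaled
    pushforward on []a, b]] is enough. *)
Lemma ge0_integral_pushforwardT (phi : R -> measurableTypeR R)
    (f : R -> \bar R) (c : {nonneg R}) :
  measurable_fun [set: R] phi ->
  (forall a b, (a < b)%R -> c%:num%:E * mu (phi @^-1` `]a, b]) = (b - a)%:E) ->
  measurable_fun [set: R] f -> (forall x, 0 <= f x) ->
  c%:num%:E * \int[mu]_x f (phi x) = \int[mu]_x f x.
Proof.
move=> mphi phiE mf f0.
have <- : \int[pushforward mu phi]_x f x = \int[mu]_x f (phi x).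
  by rewrite ge0_integral_pushforward//= preimage_setT.
rewrite -ge0_integral_mscale//.
apply: eq_measure_integral => A mA _.
apply/esym/lebesgue_measure_unique => //= _ [[a b]] _ <-/=.
rewrite lebesgue_measure_itv/= lte_fin; case: ifPn => ab; last first.
  by rewrite set_itv_ge ?measure0// bnd_simp.
by rewrite -EFinB -phiE.
Qed.

Lemma ge0_integral_shift (f : R -> \bar R) (d : R) :
  measurable_fun [set: R] f -> (forall x, 0 <= f x) ->
  \int[mu]_x f (x + d)%R = \int[mu]_x f x.
Proof.
move=> mf f0.
rewrite -(@ge0_integral_pushforwardT (fun x => x + d)%R f (NngNum (@ler01 R)))//.
- by rewrite mul1e.
- exact: measurable_funD.
- move=> a b ab; rewrite mul1e.
  rewrite (_ : _ @^-1` _ = `]a - d, b - d]%classic)%R.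
    by rewrite lebesgue_measure_itv/= lte_fin ltrD2r ab -EFinB; congr (_%:E); ring.
  by apply/seteqP; split => x /=; rewrite !in_itv/= ltrBlDr lerBrDr.
Qed.

Lemma ge0_integral_scale (f : R -> \bar R) (c : R) : (0 < c)%R ->
  measurable_fun [set: R] f -> (forall x, 0 <= f x) ->
  c%:E * \int[mu]_x f (c * x)%R = \int[mu]_x f x.
Proof.
move=> c0 mf f0.
apply: (@ge0_integral_pushforwardT (fun x => c * x)%R f (NngNum (ltW c0))) => //=.
- exact: measurable_funM.
- move=> a b ab.
  rewrite (_ : _ @^-1` _ = `]c^-1 * a, c^-1 * b]%classic)%R.
    rewrite lebesgue_measure_itv/= lte_fin ltr_pM2l ?invr_gt0// ab -EFinB -EFinM.
    by congr (_%:E); field; rewrite gt_eqF.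
  by apply/seteqP; split => x /=; rewrite !in_itv/= ltr_pdivrMl// ler_pdivlMl.
Qed.

Lemma ge0_integral_reflect (f : R -> \bar R) (d : R) :
  measurable_fun [set: R] f -> (forall x, 0 <= f x) ->
  \int[mu]_x f (d - x)%R = \int[mu]_x f x.
Proof.
move=> mf f0.
rewrite -(@ge0_integral_shift (fun x => f (d - x)%R) d)//; last first.
  by apply: (measurableT_comp mf); exact: measurable_funB.
under eq_integral do rewrite opprD addrCA subrr addr0.
transitivity (\int[pushforward mu (-%R : R -> measurableTypeR R)]_x f x).
  by rewrite ge0_integral_pushforward//= preimage_setT.
by apply: eq_measure_integral => A mA _; exact: lebesgue_measureN.
Qed.

End change_of_variable.

Section almost_everywhere.
Context {R : realType}.
Notation mu := (@lebesgue_measure R).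

Lemma aeW (P Q : R -> Prop) : {ae mu, forall x, P x} ->
  (forall x, P x -> Q x) -> {ae mu, forall x, Q x}.
Proof.
move=> aP PQ; have := PQ.
by move=> /(@filterS _ _ (ae_filter_ringOfSetsType mu)); apply.
Qed.

Lemma aeI (P Q : R -> Prop) : {ae mu, forall x, P x} ->
  {ae mu, forall x, Q x} -> {ae mu, forall x, P x /\ Q x}.
Proof. by move=> aP aQ; exact: (@filterI _ _ (ae_filter_ringOfSetsType mu)). Qed.

Lemma aeT (P : R -> Prop) : (forall x, P x) -> {ae mu, forall x, P x}.
Proof. by move=> aP; apply: (@filterE _ _ (ae_filter_ringOfSetsType mu)). Qed.

Lemma ae_eqI (f g : R -> \bar R) :
  {ae mu, forall x, f x = g x} -> ae_eq mu setT f g.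
Proof. by move=> fg; apply: aeW fg _ => x. Qed.

Lemma ae_neq (c : R) : {ae mu, forall x : R, x != c}.
Proof.
exists [set c]; split => //; first exact: lebesgue_measure_set1.
by move=> x /= /negP; rewrite negbK => /eqP.
Qed.

End almost_everywhere.

(** * Real-valued integrals and iterated integrals *)

Section real_integrable.
Context {R : realType}.
Notation mu := (@lebesgue_measure R).
Variable (D : set R) (mD : measurable D).
Implicit Types f g : R -> R.
Local Notation "'int f" := (mu.-integrable D (EFin \o f)) (at level 10).

Lemma RintegrableD f g : 'int f -> 'int g -> 'int (fun x => f x + g x).
Proof.
move=> intf intg; by refine (eq_integrable _ _ _ _ (integrableD _ intf intg)); try exact: mD.
Qed.

Lemma RintegrableB f g : 'int f -> 'int g -> 'int (fun x => f x - g x).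
Proof.
move=> intf intg; by refine (eq_integrable _ _ _ _ (integrableB _ intf intg)); try exact: mD.
Qed.

Lemma RintegrableZ c f : 'int f -> 'int (fun x => c * f x).
Proof.
move=> intf; by refine (eq_integrable _ _ _ _ (integrableZl _ c intf)); try exact: mD.
Qed.

Lemma RintegrableN f : 'int f -> 'int (fun x => - f x).
Proof.
move=> intf; by refine (eq_integrable _ _ _ _ (integrableN intf)); first exact: mD.
Qed.

Lemma le_Rintegrable f g : measurable_fun D g ->
  (forall x, D x -> `|g x| <= f x) -> 'int f -> 'int g.
Proof.
move=> mg gf; apply: le_integrable => //; first exact/measurable_EFinP.
by move=> x Dx /=; rewrite lee_fin (le_trans (gf x Dx))// ler_norm.
Qed.

Lemma Rintegrable_measurable f : 'int f -> measurable_fun D f.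
Proof. by move=> /measurable_int/measurable_EFinP. Qed.

End real_integrable.

Section real_fubini.
Context {R : realType}.
Notation mu := (@lebesgue_measure R).

(** An integrable function is finite almost everywhere, so [fine] alters it on a null set only. This
    transfers Fubini's theorem to iterated real integrals, whose inner integral is a [fine]. *)
Lemma integrable_fine (G : R -> \bar R) : mu.-integrable setT G ->
  mu.-integrable setT (EFin \o (fine \o G)) /\
  \int[mu]_x fine (G x) = fine (\int[mu]_x G x)%E.
Proof.
move=> iG; have mG := measurable_int _ iG.
have mf : measurable_fun setT (EFin \o (fine \o G)).
  by apply/measurable_EFinP; exact: (measurableT_comp (fine_measurable measurableT)).
have GE : ae_eq mu setT G (EFin \o (fine \o G)).
  apply: filterS (integrable_ae measurableT iG) => x /= h _.
  by rewrite fineK// h.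
split; last by congr fine; apply: ae_eq_integral => //; exact: ae_eq_sym.
have /integrableP [_ h] := iG.
apply/integrableP; split => //.
rewrite (le_lt_trans _ h)// [leLHS](@ae_eq_integral _ _ _ mu setT (abse \o G))//.
- exact: measurableT_comp.
- exact: measurableT_comp.
- by apply: filterS GE => x /= GxE _; rewrite [in RHS]GxE.
Qed.

Lemma ae_eq_Rintegral (f g : R -> R) :
  measurable_fun setT f -> measurable_fun setT g ->
  {ae mu, forall x, f x = g x} -> \int[mu]_x f x = \int[mu]_x g x.
Proof.
move=> mf mg fg; congr fine; apply: ae_eq_integral => //.
- exact/measurable_EFinP.
- exact/measurable_EFinP.
- by apply: ae_eqI; apply: aeW fg _ => x /= ->.
Qed.

Lemma tonelli (F : R -> R -> R) :
  measurable_fun [set: R * R] (fun z => F z.1 z.2) -> (forall x y, 0 <= F x y) ->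
  (\int[mu]_x \int[mu]_y (F x y)%:E = \int[mu]_y \int[mu]_x (F x y)%:E)%E.
Proof.
move=> mF F0; apply: (@fubini_tonelli _ _ _ _ _ mu mu (fun z => (F z.1 z.2)%:E)) => //.
- exact/measurable_EFinP.
- by move=> x; rewrite lee_fin.
Qed.

Lemma etonelli (F : R -> R -> \bar R) :
  measurable_fun [set: R * R] (fun z => F z.1 z.2) -> (forall x y, 0 <= F x y)%E ->
  (\int[mu]_x \int[mu]_y (F x y) = \int[mu]_y \int[mu]_x (F x y))%E.
Proof.
by move=> mF F0; apply: (@fubini_tonelli _ _ _ _ _ mu mu (fun z => (F z.1 z.2))).
Qed.

Section swap.
Variable F : R -> R -> R.
Hypothesis mF : measurable_fun [set: R * R] (fun z => F z.1 z.2).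
Hypothesis iF : (\int[mu]_x \int[mu]_y `|F x y|%:E < +oo)%E.

Let f (z : R * R) : \bar R := (F z.1 z.2)%:E.

Let mf : measurable_fun [set: R * R] f. Proof. exact/measurable_EFinP. Qed.

Let intf : (mu \x mu)%E.-integrable setT f.
Proof. exact/integrable12ltyP. Qed.

Lemma integrable_Rfubini_F :
  mu.-integrable setT (EFin \o (fun x => \int[mu]_y F x y)).
Proof. by have [] := integrable_fine (integrable_fubini_F intf). Qed.

Lemma measurable_Rswap : measurable_fun [set: R * R] (fun z => F z.2 z.1).
Proof. by apply: (measurableT_comp mF (g := fun z => (z.2, z.1))); exact: measurable_swap. Qed.

Lemma finite_Rswap : (\int[mu]_y \int[mu]_x `|F x y|%:E < +oo)%E.
Proof.
rewrite -(@tonelli (fun x y => `|F x y|))//.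
exact: measurable_fun_norm.
Qed.

End swap.

Lemma Rfubini (F : R -> R -> R) :
  measurable_fun [set: R * R] (fun z => F z.1 z.2) ->
  (\int[mu]_x \int[mu]_y `|F x y|%:E < +oo)%E ->
  \int[mu]_x \int[mu]_y F x y = \int[mu]_y \int[mu]_x F x y.
Proof.
move=> mF iF.
have mf : measurable_fun [set: R * R] (fun z => (F z.1 z.2)%:E).
  exact/measurable_EFinP.
have iF' := finite_Rswap mF iF.
have mg : measurable_fun [set: R * R] (fun z => (F z.2 z.1)%:E).
  by apply/measurable_EFinP; exact: measurable_Rswap.
have intf : (mu \x mu)%E.-integrable setT (fun z => (F z.1 z.2)%:E).
  exact/integrable12ltyP.
have intg : (mu \x mu)%E.-integrable setT (fun z => (F z.2 z.1)%:E).
  exact/integrable12ltyP.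
have [_ ->] := integrable_fine (integrable_fubini_F intf).
have [_ ->] := integrable_fine (integrable_fubini_F intg).
by congr fine; exact: Fubini intf.
Qed.

End real_fubini.

(** * Fundamental theorem of calculus for right derivatives *)

Section fundamental_theorem.
Context {R : realType}.
Notation mu := (@lebesgue_measure R).

Lemma within_continuousP (F : R -> R) (a b x e : R) :
  {within `[a, b], continuous F} -> a <= x <= b -> 0 < e ->
  exists2 d, 0 < d & forall y, a <= y <= b -> `|y - x| < d -> `|F y - F x| < e.
Proof.
move=> /subspace_continuousP cF xab e0.
have /cvgrPdist_lt/(_ _ e0) : F @ within `[a, b] (nbhs x) --> F x.
  by apply: cF; rewrite /= in_itv.
move=> /nbhs_ballP[d/= d0 hd]; exists d => // y yab yx.
rewrite distrC; apply: hd; last by rewrite in_itv.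
by rewrite /ball/= distrC.
Qed.

(** By continuity the supremum of the points where [Phi] is nonnegative is such a point, and unless
    it is [b] a step leads beyond it. Steps are given at interior points only; at [a] the first step
    comes from continuity, which is why [Phi a] is strictly positive. *)
Lemma right_climb (Phi : R -> R) (a b : R) : a < b ->
  {within `[a, b], continuous Phi} -> 0 < Phi a ->
  (forall x, a < x < b -> exists2 y, x < y <= b & Phi x <= Phi y) ->
  0 <= Phi b.
Proof.
move=> ab cPhi Pa step.
pose S := [set x | a <= x <= b /\ 0 <= Phi x].
have Sa : S a by split; [rewrite lexx ltW|exact: ltW].
have hS : has_sup S by split; [exists a|exists b => x [/andP[]]].
have Sab : a <= sup S <= b.
  by rewrite ub_le_sup//=; [apply: ge_sup; [exists a|move=> x [/andP[]]]|case: hS].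
have SS : 0 <= Phi (sup S).
  rewrite leNgt; apply/negP => h.
  have h' : 0 < - Phi (sup S) by rewrite oppr_gt0.
  have [d d0 hd] := within_continuousP cPhi Sab h'.
  have [y [yab y0] yd] := sup_adherent d0 hS.
  have ys : y <= sup S by apply: ub_le_sup => //; case: hS.
  have := hd y yab; rewrite ler0_norm ?subr_le0// opprB ltrBlDl -ltrBlDr => /(_ yd).
  by rewrite ltr_norml => /andP[_ hy]; lra.
have [/eqP <-//|sb] := boolP (sup S == b).
have {}sb : sup S < b by rewrite lt_neqAle sb; case/andP : Sab.
suff [y ysb y0] : exists2 y, sup S < y <= b & 0 <= Phi y.
  have : y <= sup S.
    apply: ub_le_sup; first by case: hS.
    case/andP: ysb => sy yb; split => //; rewrite yb andbT.
    by rewrite (le_trans _ (ltW sy))//; case/andP : Sab.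
  by rewrite leNgt; case/andP: ysb => ->.
have [sa|/eqP sa] := eqVneq (sup S) a; last first.
  have [|y yb Py] := step (sup S).
    by rewrite sb andbT lt_neqAle eq_sym (introN eqP sa)/=; case/andP: Sab.
  by exists y => //; exact: le_trans Py.
have aab : a <= a <= b by rewrite lexx ltW.
have [d d0 hd] := within_continuousP cPhi aab Pa.
exists (a + Num.min (d / 2) (b - a)).
  rewrite sa ltrDl lt_min divr_gt0//= subr_gt0 ab/=.
  by rewrite -lerBrDl ge_min lexx orbT.
have m0 : 0 <= Num.min (d / 2) (b - a).
  by rewrite le_min subr_ge0 (ltW ab) divr_ge0// ltW.
have := hd (a + Num.min (d / 2) (b - a)).
rewrite lerDl m0/= -lerBrDl ge_min lexx orbT => /(_ isT).
rewrite addrAC subrr add0r ger0_norm//.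
have -> : Num.min (d / 2) (b - a) < d by rewrite gt_min ltr_pdivrMr// ltr_pMr// ltr1n.
by move=> /(_ isT); rewrite ltr_norml => /andP[hy _]; lra.
Qed.

End fundamental_theorem.

Section lower_semicontinuous_majorant.
Context {R : realType}.
Notation mu := (@lebesgue_measure R).
Variables (f : R -> R) (a b e : R).
Hypotheses (mf : measurable_fun setT f) (f0 : forall x, 0 <= f x) (e0 : 0 < e)
  (ab : a < b).

Let E (k : nat) : set R := `[a, b] `&` [set x | k%:R * e < f x].

Let mE k : measurable (E k).
Proof.
apply: measurableI => //; rewrite -[X in measurable X]setTI.
rewrite (_ : [set x | _] = f @^-1` `]k%:R * e, +oo[); first exact: mf.
by apply/seteqP; split => x; rewrite /= in_itv/= andbT.
Qed.

Let muE k : (mu (E k) < +oo)%E.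
Proof.
apply: (@le_lt_trans _ _ (mu `[a, b])).
  apply: le_measure.
  - by rewrite inE; exact: mE.
  - by rewrite inE; exact: measurable_itv.
  - exact: subIsetl.
by rewrite lebesgue_measure_itv/= lte_fin ab -EFinB ltry.
Qed.

Let mindic (A : set R) : measurable A -> measurable_fun `[a, b] (\1_A : R -> R).
Proof. by move=> mA; apply: measurable_funTS; exact: measurable_indic. Qed.

Let mindicE (A : set R) : measurable A ->
  measurable_fun `[a, b] (fun x => (\1_A x : R)%:E).
Proof.
move=> mA; apply/measurable_EFinP; apply: measurable_funTS.
exact: measurable_indic.
Qed.

(** The sum counts the multiples of [e] below [v], so it overshoots [v] by at most [e]. The bound
    [n%:R * e] is carried along for the induction: it yields the other bound at each level that is
    still below [v]. *)
Let sumE_le (n : nat) (v : R) : 0 <= v ->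
  \sum_(0 <= k < n) (e * (k%:R * e < v)%R%:R) <= Num.min (n%:R * e) (v + e).
Proof.
move=> v0; elim: n => [|n IH].
  by rewrite big_nil mul0r le_min lexx addr_ge0// ltW.
rewrite big_nat_recr//=; move: IH; rewrite !le_min => /andP[IH1 IH2].
case: (ltP (n%:R * e) v) => h; rewrite ?mulr1 ?mulr0 ?addr0.
  by rewrite -(natr1 n) mulrDl mul1r !lerD2r IH1/= (le_trans IH1)// ltW.
by rewrite IH2 andbT (le_trans IH1)// ler_pM2r// ler_nat.
Qed.

(* A weak form of the Vitali-Caratheodory theorem. *)
Lemma lsc_majorant : exists g : R -> \bar R,
  [/\ measurable_fun setT g, forall x, (0 <= g x)%E,
      (\int[mu]_(x in `[a, b]) g x <=
       \int[mu]_(x in `[a, b]) (f x)%:E + (e * (b - a) + e)%:E)%E &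
      forall x, a <= x <= b -> \forall y \near x, ((f x)%:E <= g y)%E].
Proof.
(* Each level set is enlarged to an open set; after weighting by [e] the excess measures sum to at
   most [e]. *)
have U_ k : exists U : set R,
    [/\ open U, E k `<=` U & (mu (U `\` E k) < (2^-1 / (2 ^ k.+1)%:R)%:E)%E].
  have [|U HU] := @lebesgue_regularity_outer R (E k) (2^-1 / (2 ^ k.+1)%:R) (mE k) (muE k).
    by rewrite divr_gt0// ltr0n expn_gt0.
  by exists U.
have [U HU] := choice U_.
have mU k : measurable (U k) by apply: open_measurable; case: (HU k).
(* [g] counts, with weight [e], the open sets containing a point, and is therefore lower
   semicontinuous. *)
pose g x := (\sum_(0 <= k <oo) (e * \1_(U k) x)%:E)%E.
have g0 (k : nat) x : (0 <= (e * \1_(U k) x)%:E)%E.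
  by rewrite lee_fin mulr_ge0// ltW.
have mUe k : measurable_fun setT (fun x => (e * \1_(U k) x)%:E).
  by apply/measurable_EFinP; apply: measurable_funM => //; exact: measurable_indic.
exists g; split.
- by apply: ge0_emeasurable_sum.
- by move=> x; apply: nneseries_ge0.
- rewrite integral_nneseries//; last first.
    by move=> k; apply: measurable_funS (mUe k).
  apply: (@le_trans _ _ (\sum_(0 <= k <oo) (e%:E * mu (E k) + (e / (2 ^ k.+1)%:R)%:E))%E).
    apply: lee_nneseries => [k _ _|k _]; first exact: integral_ge0.
    under eq_integral do rewrite EFinM.
    rewrite ge0_integralZl_EFin//; last 2 first.
      exact: mindicE.
      by rewrite ltW.
    rewrite integral_indic//; last exact: mU.
    rewrite EFinM -muleDr//; last first.
      by rewrite ge0_adde_def// inE ?measure_ge0// lee_fin.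
    rewrite lee_pmul2l//.
    apply: (@le_trans _ _ (mu (E k `|` (U k `\` E k)))).
      apply: le_measure; rewrite ?inE//.
      - by apply: measurableI; [exact: mU|exact: measurable_itv].
      - by apply: measurableU; [exact: mE|apply: measurableD; [exact: mU|exact: mE]].
      - by move=> x [Ux _]; have [|] := pselect (E k x); [left|right].
    rewrite (le_trans (measureU2 _ _ _))//; first exact: mE.
      by apply: measurableD; [exact: mU|exact: mE].
    rewrite leeD2l// ltW//; have [_ _ h] := HU k; apply: (lt_le_trans h).
    by rewrite lee_fin ler_piMl// ?invf_le1// ?ler1n// invr_ge0.
  apply: (le_trans (epsilon_trick _ _ _)).
  - by move=> k; rewrite mule_ge0// lee_fin ltW.
  - exact: ltW.
  rewrite EFinD addeA leeD2r//.
  rewrite (@eq_eseriesr _ _ (fun k => \int[mu]_(x in `[a, b]) (e * \1_(E k) x)%:E)%E); last first.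
    move=> k _; under [RHS]eq_integral do rewrite EFinM.
    rewrite ge0_integralZl_EFin//; last 2 first.
      exact: mindicE.
      by rewrite ltW.
    rewrite integral_indic//; last exact: mE.
    by rewrite setIC setIA setIid.
  rewrite -integral_nneseries//; last 2 first.
    move=> k; apply/measurable_EFinP; apply: measurable_funM => //.
    refine (mindic (mE k)).
    by move=> k x _; rewrite lee_fin mulr_ge0// ltW.
  have -> : (e * (b - a))%:E = (\int[mu]_(x in `[a, b]) e%:E)%E.
    by rewrite integral_cst//= lebesgue_measure_itv/= lte_fin ab EFinM.
  rewrite -ge0_integralD//; last 2 first.
    by apply/measurable_EFinP; apply: measurable_funTS.
    by move=> x _; rewrite lee_fin ltW.
  apply: ge0_le_integral => //.
  + by move=> x _; apply: nneseries_ge0 => k _ _; rewrite lee_fin mulr_ge0// ltW.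
  + apply: ge0_emeasurable_sum => k; first by move=> x _ _; rewrite lee_fin mulr_ge0// ltW.
    move=> _; apply/measurable_EFinP; apply: measurable_funM => //.
    refine (mindic (mE k)).
  + apply: emeasurable_funD => //.
    by apply/measurable_EFinP; apply: measurable_funTS.
  + move=> x xab; apply: lime_le.
      by apply: is_cvg_nneseries => k _ _; rewrite lee_fin mulr_ge0// ltW.
    apply: nearW => n; rewrite -EFinD sumEFin lee_fin.
    have /= := sumE_le n (f0 x); rewrite le_min => /andP[_]; apply: le_trans.
    apply: ler_sum => k _; rewrite ler_wpM2l ?(ltW e0)// indicE.
    have [/set_mem[_ /= ->]//|_] := boolP (x \in E k).
    by case: (_ < _).
  + by move=> x _; rewrite lee_fin.
- move=> x xab.
  (* For the least [n] with [f x <= n%:R * e], the point [x] lies in [U k] for every [k < n]; on a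
     common neighbourhood the first [n] terms of [g] already reach [n%:R * e]. *)
  have exn : exists n : nat, f x <= n%:R * e.
    exists (Num.trunc (f x / e)).+1; rewrite -ler_pdivrMr// ltW//.
    by rewrite truncnS_gt.
  have [n fn nmin] := ex_minnP exn.
  have near_sum m : (m <= n)%N ->
      nbhs x [set y | m%:R * e <= \sum_(0 <= k < m) e * \1_(U k) y].
    elim: m => [_|m IH mn].
      by apply: filterS filterT => y _ /=; rewrite big_nil mul0r.
    have Ux : U m x.
      have [_ EU _] := HU m; apply: EU; split; first by rewrite /= in_itv.
      by rewrite /= ltNge; apply/negP => /nmin; rewrite leqNgt mn.
    have oU : nbhs x (U m).
      by apply: open_nbhs_nbhs; split => //; case: (HU m).
    apply: filterS2 (IH (ltnW mn)) oU => y /= Hy Uy.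
    rewrite big_nat_recr//= -(natr1 m) mulrDl mul1r lerD//.
    by rewrite indicE mem_set ?mulr1.
  apply: filterS (near_sum n (leqnn n)) => y /= Hy.
  apply: (@le_trans _ _ (\sum_(0 <= k < n) (e * \1_(U k) y)%:E)%E); last first.
    by apply: nneseries_lim_ge.
  by rewrite sumEFin lee_fin (le_trans fn).
Qed.

End lower_semicontinuous_majorant.

Section fundamental_theorem_right_derivative.
Context {R : realType}.
Notation mu := (@lebesgue_measure R).
Implicit Types (F f : R -> R) (a b : R).

Definition right_slope_le a b F f := forall x, a < x < b -> forall e, 0 < e ->
  exists2 d, 0 < d & forall y, x < y < x + d -> F y - F x <= (f x + e) * (y - x).

(** Let [g] be the lower semicontinuous majorant of [f]. Just to the right of [x] one has
    [g >= f x], so the integral of [g] gains at least [f x] times the step, while [F] gains at most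
    [f x + e] times the step. This local comparison is made global by [right_climb]. *)
Lemma ge0_ftc_le F f a b : a < b -> measurable_fun setT f ->
  (forall x, 0 <= f x) -> mu.-integrable `[a, b] (EFin \o f) ->
  {within `[a, b], continuous F} -> right_slope_le a b F f ->
  F b - F a <= \int[mu]_(x in `[a, b]) f x.
Proof.
move=> ab mf f0 intf cF slopeF.
(* The error [e * (b - a) + e] occurs twice: once in the integral of [g] and once in [Phi]. *)
suff H e : 0 < e -> F b - F a <= \int[mu]_(x in `[a, b]) f x + e * (2 * (b - a) + 2).
  apply/ler_addgt0Pr => e e0.
  have k0 : 0 < 2 * (b - a) + 2 by rewrite addr_gt0// mulr_gt0// subr_gt0.
  rewrite (le_trans (H (e / (2 * (b - a) + 2)) _)) ?divr_gt0//.
  by rewrite divfK// gt_eqF.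
move=> e0.
have [g [mg g0 intg fg]] := lsc_majorant mf f0 e0 ab.
have fin_f : (\int[mu]_(x in `[a, b]) (f x)%:E)%E \is a fin_num.
  exact: integrable_fin_num intf.
have ig : mu.-integrable `[a, b] g.
  apply/integrableP; split; first exact: measurable_funTS.
  under eq_integral do rewrite gee0_abs//.
  by rewrite (le_lt_trans intg)// -(fineK fin_f) -EFinD ltry.
pose gr := fine \o g.
have mgr : measurable_fun setT gr.
  exact: (measurableT_comp (fine_measurable measurableT)).
have gE : ae_eq mu `[a, b]%classic g (EFin \o gr).
  have := integrable_ae _ ig; move=> /(_ (measurable_itv _)) iae.
  by apply: (aeW iae) => x /= gx xab; rewrite /gr/= fineK// gx.
have gE' (A : set R) : measurable A -> A `<=` `[a, b] ->
    (\int[mu]_(x in A) g x = \int[mu]_(x in A) (gr x)%:E)%E.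
  move=> mA Aab; apply: ae_eq_integral => //.
  - exact: measurable_funTS.
  - by apply/measurable_EFinP; exact: measurable_funTS.
  - exact: ae_eq_subset gE.
have igr : mu.-integrable `[a, b] (EFin \o gr).
  apply/integrableP; split; first by apply/measurable_EFinP; exact: measurable_funTS.
  case/integrableP: ig => _; apply: le_lt_trans.
  under eq_integral do rewrite /= ger0_norm ?fine_ge0//.
  by rewrite -gE'//; under [leRHS]eq_integral do rewrite gee0_abs//.
(* The term [e * (x - a)] pays for the error [e] in the slopes of [F], and the constant [e] makes
   [Phi a] positive. *)
pose Phi x := \int[mu]_(t in `[a, x]) gr t + e * (x - a) + e - (F x - F a).
have : 0 <= Phi b.
  apply: (@right_climb _ Phi a b) => //.
  - have cid : {within `[a, b], continuous (fun x : R => x)}.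
    by apply: continuous_subspaceT => x; exact: cvg_id.
    move=> z; apply: cvgB; last by apply: cvgB; [exact: cF|exact: cvg_cst].
    apply: cvgD; last exact: cvg_cst.
    apply: cvgD; first exact: (parameterized_integral_continuous (ltW ab) igr).
    by apply: cvgMr; apply: cvgB; [exact: cid|exact: cvg_cst].
  - by rewrite /Phi set_itv1 Rintegral_set1 !subrr mulr0 !add0r subr0.
  - move=> x xab.
    have xab' : a <= x <= b by case/andP: xab => ? ?; rewrite !ltW.
    have [d1 /= d10 hd1] : nbhs x [set y | ((f x)%:E <= g y)%E] by exact: fg.
    have [d2 d20 hd2] := slopeF x xab e e0.
    case/andP: xab => ax xb.
    pose m := Num.min (Num.min (d1 / 2) (d2 / 2)) (b - x).
    have m0 : 0 < m by rewrite !lt_min !divr_gt0//= subr_gt0.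
    have mb : x + m <= b by rewrite -lerBrDl ge_min lexx orbT.
    have md1 : m < d1.
      by rewrite !gt_min ltr_pdivrMr// ltr_pMr// ltr1n.
    have md2 : m < d2.
      by rewrite !gt_min (ltr_pdivrMr _ d2)// (ltr_pMr _ d20) ltr1n orbT.
    exists (x + m); first by rewrite ltrDl m0.
    have Fm : F (x + m) - F x <= (f x + e) * m.
      by have := hd2 (x + m); rewrite ltrDl m0 ltrD2l md2 => /(_ isT); rewrite addrAC subrr add0r.
    have gm : f x * m <= \int[mu]_(t in `[a, x + m]) gr t - \int[mu]_(t in `[a, x]) gr t.
      rewrite Rintegral_itvB//; last 3 first.
      + by apply: integrableS igr => //; apply: subset_itvl; rewrite bnd_simp.
      + by rewrite bnd_simp ltW.
      + by rewrite bnd_simp ltW// ltrDl.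
      have sub : `]x, x + m] `<=` `[a, b] by apply: subset_itvScc; rewrite bnd_simp// ltW.
      rewrite -lee_fin /Rintegral -gE'// fineK; last first.
        by apply: integrable_fin_num => //; apply: integrableS ig.
      have -> : (f x * m)%:E = (\int[mu]_(t in `]x, (x + m)%R]) (f x)%:E)%E.
        by rewrite integral_cst//= lebesgue_measure_itv/= lte_fin ltrDl m0 -EFinB -EFinM
          addrAC subrr add0r.
      apply: ge0_le_integral => //.
      + by move=> y _; rewrite lee_fin.
      + exact: measurable_funTS.
      + move=> y; rewrite /= in_itv/= => /andP[xy yxm]; apply: hd1 => /=.
        rewrite distrC gtr0_norm ?subr_gt0//.
        by rewrite (le_lt_trans _ md1)// lerBlDl.
    rewrite /Phi; lra.
rewrite /Phi => Pb.
have : \int[mu]_(x in `[a, b]) gr x <= \int[mu]_(x in `[a, b]) f x + (e * (b - a) + e).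
  rewrite -lee_fin EFinD /Rintegral fineK; last exact: integrable_fin_num.
  by rewrite fineK// -gE'.
lra.
Qed.

(** Truncating [f] from below at [- n%:R] only weakens the slope condition, and adding [n%:R * x] to
    [F] makes the integrand nonnegative. Dominated convergence removes the truncation. *)
Lemma ftc_le F f a b : a < b -> mu.-integrable `[a, b] (EFin \o f) ->
  {within `[a, b], continuous F} -> right_slope_le a b F f ->
  F b - F a <= \int[mu]_(x in `[a, b]) f x.
Proof.
move=> ab intf cF slopeF.
pose f1 := f \_ `[a, b].
have mf1 : measurable_fun setT f1.
  by apply/(measurable_restrictT _ _).1 => //; apply/measurable_EFinP; exact: measurable_int intf.
have f1E x : a <= x <= b -> f1 x = f x.
  by move=> xab; rewrite /f1 patchE mem_set//= in_itv.
have intf1 : mu.-integrable `[a, b] (EFin \o f1).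
  apply: eq_integrable intf => // x; rewrite inE/= in_itv/= => xab.
  by rewrite f1E.
have fn_le (n : nat) x : `|Num.max (f1 x) (- n%:R)| <= `|f1 x|.
  have n0 : 0 <= n%:R :> R by [].
  have [h|h] := leP (- n%:R) (f1 x); first by rewrite lexx.
  have fx : f1 x < 0 by lra.
  by rewrite (ltr0_norm fx) normrN ger0_norm//; lra.
have mfn (n : nat) : measurable_fun setT (fun x => Num.max (f1 x) (- n%:R)).
  exact: measurable_maxr.
have fn_int (n : nat) : mu.-integrable `[a, b] (EFin \o (fun x => Num.max (f1 x) (- n%:R))).
  apply: (@le_integrable _ _ _ mu _ _ _ (EFin \o f1)) => //.
    by apply: measurable_funTS; apply/measurable_EFinP; exact (mfn n).
  by move=> x _ /=; rewrite lee_fin.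
have Hn (n : nat) : F b - F a <= \int[mu]_(x in `[a, b]) Num.max (f1 x) (- n%:R).
  have icst : mu.-integrable `[a, b] (EFin \o (fun=> n%:R)).
    apply/integrableP; split; first exact: measurable_cst.
    rewrite integral_cst//= lebesgue_measure_itv/= lte_fin ab -EFinB -EFinM.
    by rewrite ltry.
  have := @ge0_ftc_le (fun x => F x + n%:R * x) (fun x => Num.max (f1 x) (- n%:R) + n%:R) a b ab.
  rewrite RintegralD// Rintegral_cst//= lebesgue_measure_itv/= lte_fin ab/=.
  move=> H; suff : F b + n%:R * b - (F a + n%:R * a) <=
    \int[mu]_(x in `[a, b]) Num.max (f1 x) (- n%:R) + n%:R * (b - a) by lra.
  apply: H.
  - exact: measurable_funD.
  - by move=> x; rewrite -lerBlDr sub0r le_max lexx orbT.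
  - exact: RintegrableD.
  - have cid : {within `[a, b], continuous (fun x : R => x)}.
      by apply: continuous_subspaceT => x; exact: cvg_id.
    by move=> z; apply: cvgD; [exact: cF|apply: cvgMr; exact: cid].
  - move=> x xab e e0; have [d d0 hd] := slopeF x xab e e0; exists d => // y xyd.
    have fx : f1 x <= Num.max (f1 x) (- n%:R) by rewrite le_max lexx.
    have yx : 0 < y - x by rewrite subr_gt0; case/andP: xyd.
    have := hd y xyd; rewrite -f1E; last by case/andP: xab => ? ?; rewrite !ltW.
    have : (f1 x + e) * (y - x) <= (Num.max (f1 x) (- n%:R) + e) * (y - x).
      by rewrite ler_pM2r// lerD2r.
    lra.
have -> : \int[mu]_(x in `[a, b]) f x = \int[mu]_(x in `[a, b]) f1 x.
  by apply: eq_Rintegral => x; rewrite inE/= in_itv/= => xab; rewrite f1E.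
have [] := @dominated_convergence _ _ _ mu `[a, b]%classic _
  (fun n x => (Num.max (f1 x) (- n%:R))%:E) (EFin \o f1) (abse \o (EFin \o f1)).
- exact: measurable_itv.
- by move=> n; apply: measurable_funTS; apply/measurable_EFinP; exact (mfn n).
- by apply: measurable_funTS; apply/measurable_EFinP.
- apply/nearW => x _; apply: cvg_near_cst; near=> n => /=.
  suff h : - n%:R <= f1 x by rewrite (max_idPl h).
  rewrite lerNl (le_trans (ler_norm _))// normrN.
  near: n; exact: nbhs_infty_ger.
- exact: integrable_abse.
- by apply/nearW => x n _ /=; rewrite lee_fin.
move=> _ _ cv.
rewrite -lee_fin [in leRHS]/Rintegral fineK; last exact: integrable_fin_num.
rewrite -(cvg_lim _ cv)//; apply: lime_ge; first by apply/cvg_ex; eexists; exact: cv.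
apply: nearW => n; have := Hn n; rewrite -lee_fin /Rintegral fineK//.
by apply: integrable_fin_num => //; exact: fn_int.
Unshelve. all: by end_near.
Qed.

End fundamental_theorem_right_derivative.

Section fundamental_theorem_equality.
Context {R : realType}.
Notation mu := (@lebesgue_measure R).
Implicit Types (F f : R -> R) (a b : R).

Definition right_derivative_in a b F f := forall x, a < x < b ->
  e^-1 * (F (x + e) - F x) @[e --> 0^'+] --> f x.

Lemma right_derivative_slope a b F f : right_derivative_in a b F f ->
  right_slope_le a b F f /\ right_slope_le a b (fun x => - F x) (fun x => - f x).
Proof.
move=> dF.
suff H x e : a < x < b -> 0 < e -> exists2 d, 0 < d &
    forall y, x < y < x + d -> `|(y - x)^-1 * (F y - F x) - f x| <= e.
  split=> x xab e e0; have [d d0 hd] := H x e xab e0; exists d => // y xyd;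
    have := hd y xyd; have yx : 0 < y - x by [rewrite subr_gt0; case/andP: xyd|];
    rewrite ler_norml lerBlDl lerBrDr => /andP[h1 h2].
  - by rewrite mulrC -ler_pdivrMl.
  - rewrite -lerN2 -mulNr mulrC -ler_pdivlMl//; lra.
move=> xab e0; have /cvgrPdist_le/(_ _ e0) := dF x xab.
move=> [d/= d0 hd]; exists d => // y /andP[xy yd].
have := hd (y - x); rewrite /= sub0r normrN subr_gt0 xy gtr0_norm ?subr_gt0//.
rewrite ltrBlDl yd => /(_ isT isT).
by rewrite subrKC distrC.
Qed.

Lemma is_derive_right_derivative F (x l : R) : is_derive x (1 : R) F l ->
  e^-1 * (F (x + e) - F x) @[e --> 0^'+] --> l.
Proof.
move=> [dF <-]; apply/cvgrPdist_lt => e e0.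
have /cvgrPdist_lt/(_ _ e0) : h^-1 *: (F (h *: (1 : R) + x) - F x) @[h --> 0^'] --> 'D_1 F x.
  exact: dF.
move=> [d/= d0 hd]; exists d => // y /= yd y0.
by have := hd y yd; rewrite gt_eqF// => /(_ isT); rewrite /GRing.scale/= mulr1 (addrC y).
Qed.

Lemma ftc F f a b : a < b -> mu.-integrable `[a, b] (EFin \o f) ->
  {within `[a, b], continuous F} -> right_derivative_in a b F f ->
  \int[mu]_(x in `[a, b]) f x = F b - F a.
Proof.
move=> ab intf cF /right_derivative_slope[sF sNF].
apply/eqP; rewrite eq_le (ftc_le ab intf cF sF) andbT.
have := @ftc_le R (fun x => - F x) (fun x => - f x) a b ab.
have -> : \int[mu]_(x in `[a, b]) - f x = - \int[mu]_(x in `[a, b]) f x.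
  by under eq_Rintegral do rewrite -mulN1r; rewrite RintegralZl// mulN1r.
move=> H; suff : - F b - - F a <= - \int[mu]_(x in `[a, b]) f x by lra.
apply: H => //; first exact: RintegrableN.
by move=> z; apply: cvgN; exact: cF.
Qed.

(** Integrability of [f] is part of the conclusion. The truncations of [f] at [n] are integrable and
    bound the slopes of [F] from below, so [ftc_le] applied to [- F] bounds their integrals by
    [F b - F a]; monotone convergence does the rest. *)
Lemma ge0_ftc F f a b : a < b -> measurable_fun setT f ->
  (forall x, 0 <= f x) ->
  {within `[a, b], continuous F} -> right_derivative_in a b F f ->
  (\int[mu]_(x in `[a, b]) (f x)%:E = (F b - F a)%:E)%E.
Proof.
move=> ab mf f0 cF dF.
have [sF sNF] := right_derivative_slope dF.
suff H : (\int[mu]_(x in `[a, b]) (f x)%:E <= (F b - F a)%:E)%E.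
  have intf : mu.-integrable `[a, b] (EFin \o f).
    apply/integrableP; split.
      by apply: measurable_funTS; exact/measurable_EFinP.
    under eq_integral do rewrite gee0_abs ?lee_fin//.
    by rewrite (le_lt_trans H)// ltry.
  rewrite -(ftc ab intf cF dF) /Rintegral fineK//.
  exact: integrable_fin_num.
pose fn (n : nat) x := Num.min (f x) n%:R.
have mfn n : measurable_fun setT (fn n) by exact: measurable_minr.
have fn0 n x : 0 <= fn n x by rewrite le_min f0/=.
have -> : (\int[mu]_(x in `[a, b]) (f x)%:E =
    limn (fun n => \int[mu]_(x in `[a, b]) (fn n x)%:E))%E.
  rewrite -monotone_convergence//.
  - apply: eq_integral => x _; apply/esym/cvg_lim => //.
    apply: cvg_near_cst; near=> n.
    rewrite /fn; suff /min_idPl -> : f x <= n%:R by [].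
    near: n; exact: nbhs_infty_ger.
  - by move=> n; apply: measurable_funTS; apply/measurable_EFinP; exact (mfn n).
  - by move=> n x _; rewrite lee_fin.
  - move=> x _ m n mn; rewrite lee_fin /fn le_min ge_min lexx/= ge_min.
    by rewrite ler_nat mn orbT.
apply: lime_le.
  apply: ereal_nondecreasing_is_cvgn => m n mn.
  apply: ge0_le_integral => //.
  - by move=> x _; rewrite lee_fin.
  - by apply: measurable_funTS; apply/measurable_EFinP; exact (mfn m).
  - by apply: measurable_funTS; apply/measurable_EFinP; exact (mfn n).
  - move=> x _; rewrite lee_fin /fn le_min ge_min lexx/= ge_min.
    by rewrite ler_nat mn orbT.
apply: nearW => n.
have ifn : mu.-integrable `[a, b] (EFin \o fn n).
  apply: (@le_Rintegrable _ _ _ (fun=> n%:R)) => //.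
  - by apply: measurable_funTS; exact (mfn n).
  - by move=> x _; rewrite ger0_norm// ge_min lexx orbT.
  - apply/integrableP; split; first exact: measurable_cst.
    rewrite integral_cst//= lebesgue_measure_itv/= lte_fin ab -EFinB -EFinM.
    by rewrite ltry.
have := @ftc_le R (fun x => - F x) (fun x => - fn n x) a b ab.
have -> : \int[mu]_(x in `[a, b]) - fn n x = - \int[mu]_(x in `[a, b]) fn n x.
  by under eq_Rintegral do rewrite -mulN1r; rewrite RintegralZl// mulN1r.
move=> H; have : - F b - - F a <= - \int[mu]_(x in `[a, b]) fn n x.
  apply: H.
  - exact: RintegrableN.
  - by move=> z; apply: cvgN; exact: cF.
  - move=> x xab e e0; have [d d0 hd] := sNF x xab e e0; exists d => // y xyd.
    apply: (le_trans (hd y xyd)); rewrite ler_pM2r; last first.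
      by rewrite subr_gt0; case/andP: xyd.
    by rewrite lerD2r lerN2 ge_min lexx.
move=> {}H; have : \int[mu]_(x in `[a, b]) fn n x <= F b - F a by lra.
rewrite -lee_fin /Rintegral fineK//.
exact: integrable_fin_num.
Unshelve. all: by end_near. Qed.

Lemma continuous_pw (p : R) : 0 < p -> continuous (pw p).
Proof.
move=> p0 x; have [x0|x0|->] := ltgtP x 0.
- apply: cvg_near_cst; near=> y; rewrite !pw_le0// ltW//.
  by near: y; exact: lt_nbhsl.
- have cx : {for x, continuous (fun y : R => y `^ p)}.
    apply: differentiable_continuous.
    by apply/derivable1_diffP; apply: derivable_powR; rewrite in_itv/= x0.
  rewrite /continuous_at pwE//; apply: cvg_trans cx.
  apply: near_eq_cvg; near=> y; rewrite /= pwE//.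
  by near: y; exact: lt_nbhsr.
- rewrite /continuous_at (pw_le0 _ (lexx 0)); apply/cvgrPdist_lt => e e0.
  near=> y; rewrite sub0r normrN ger0_norm ?pw_ge0//.
  have [y0|y0] := leP y 0; first by rewrite pw_le0.
  rewrite pwE// -[ltRHS](powRr1 (ltW e0)) -(mulVf (lt0r_neq0 p0)) powRrM.
  apply: gt0_ltr_powR => //; rewrite ?nnegrE ?powR_ge0 ?ltW//.
  near: y; apply: lt_nbhsl; exact: powR_gt0.
Unshelve. all: by end_near. Qed.

End fundamental_theorem_equality.

(** * Gamma and Beta integrals *)

Section power_integrals.
Context {R : realType}.
Notation mu := (@lebesgue_measure R).
Implicit Types (F f : R -> R) (a b p : R).

Lemma is_derive_pw p (x : R) : 0 < x -> is_derive x 1 (pw p) (p * pw (p - 1) x).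
Proof.
move=> x0; rewrite pwE//; apply: (near_eq_is_derive (f := fun y => y `^ p)).
- by near=> y; rewrite pwE//; near: y; exact: lt_nbhsr.
- exact: is_derive1_powR.
Unshelve. all: by end_near. Qed.

Lemma continuous_pw_gt0 p (x : R) : 0 < x -> {for x, continuous (pw p)}.
Proof.
move=> x0; apply: differentiable_continuous; apply/derivable1_diffP.
by have [] := is_derive_pw p x0.
Qed.

Lemma integral_oo_natr (f : R -> R) a b :
  (\int[mu]_(x in `]a, b[) (f x)%:E =
   \int[mu]_x (f x * ((a < x)%R%:R * (x < b)%R%:R))%:E)%E.
Proof.
rewrite integral_mkcond; apply: eq_integral => x _; rewrite patchE.
case: ifPn => [|/negP h]; first by rewrite inE/= in_itv/= => /andP[-> ->]; rewrite !mulr1.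
move: h; rewrite inE/= in_itv/=.
by case: (a < x); case: (x < b); rewrite ?(mulr1, mulr0)// => /(_ isT).
Qed.

(* Not a class, unlike [is_derive], so that rewriting with [ge0_ftcT] leaves the
   derivative as an ordinary side goal. *)
Definition has_derive F x (l : R) : Prop := is_derive x (1 : R) F l.

Lemma ge0_ftcT F f a b : a <= b -> measurable_fun setT f ->
  (forall x, 0 <= f x) ->
  {within `[a, b], continuous F} ->
  (forall x, a < x < b -> has_derive F x (f x)) ->
  (\int[mu]_x (f x * ((a < x)%R%:R * (x < b)%R%:R))%:E = (F b - F a)%:E)%E.
Proof.
rewrite le_eqVlt => /predU1P[->|ab] mf f0 cF dF.
  rewrite subrr; apply: integral0_eq => x _.
  by have [h|h|h] := ltgtP b x; rewrite ?(mulr0, mul0r).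
rewrite -integral_oo_natr -(@integral_itv_bndoo _ a b _ true false)//; last first.
  by apply: measurable_funTS; exact/measurable_EFinP.
by rewrite (ge0_ftc ab mf f0 cF)// => x /dF; exact: is_derive_right_derivative.
Qed.

Lemma integral_pw_lt p t : 0 < p ->
  (\int[mu]_v (pw (p - 1) v * (v < t)%R%:R)%:E = (pw p t / p)%:E)%E.
Proof.
move=> p0; have [t0|t0] := leP t 0.
  rewrite pw_le0// mul0r; apply: integral0_eq => x _.
  have [x0|x0] := leP x 0; first by rewrite pw_le0// mul0r.
  by rewrite ltNge (le_trans t0 (ltW x0)) mulr0.
have := @ge0_ftcT (fun x => p^-1 * pw p x) (pw (p - 1)) 0 t (ltW t0).
rewrite [pw p 0]pw_le0// mulr0 subr0 mulrC => <-//.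
- apply: eq_integral => x _; have [x0|x0] := ltP 0 x; first by rewrite mul1r.
  by rewrite pw_le0// !mul0r.
- by meas.
- by move=> x; exact: pw_ge0.
- apply: continuous_subspaceT => x; apply: cvgMr; exact: continuous_pw.
- move=> x /andP[x0 _].
  have dx := is_derive_pw p x0.
  rewrite /has_derive; apply: is_derive_eq; rewrite /GRing.scale/= mulrA mulVf ?mul1r// gt_eqF//.
Qed.

Lemma integral_pwN_itv b u t : 0 < b -> 0 < u -> u <= t ->
  (\int[mu]_v (pw (- b - 1) v * ((u < v)%R%:R * (v < t)%R%:R))%:E =
   ((pw (- b) u - pw (- b) t) / b)%:E)%E.
Proof.
move=> b0 u0 ut.
rewrite (@ge0_ftcT (fun x => - b^-1 * pw (- b) x) (pw (- b - 1)))//.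
- by congr EFin; field; rewrite gt_eqF.
- by meas.
- by move=> x; exact: pw_ge0.
- apply: continuous_in_subspaceT => x; rewrite inE/= in_itv/= => /andP[ux _].
  by apply: cvgMr; apply: continuous_pw_gt0; exact: lt_le_trans ux.
- move=> x /andP[ux _].
  have x0 := lt_trans u0 ux.
  have dx := is_derive_pw (- b) x0.
  rewrite /has_derive; apply: is_derive_eq; 
    rewrite /GRing.scale/= mulrA mulrNN mulVf ?mul1r// gt_eqF//.
Qed.

(** The integrand is the derivative of [pw a (v - s) * pw a v], which vanishes at [v = s]. In
    [KH_KN] this identity merges the two terms of [KH] into one nonnegative integral. *)
Lemma integral_pw_by_parts a s t : 0 < a -> 0 < s -> s <= t ->
  (\int[mu]_v ((a * (pw (a - 1) (v - s) * pw a v + pw a (v - s) * pw (a - 1) v))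
     * ((s < v)%R%:R * (v < t)%R%:R))%:E = (pw a (t - s) * pw a t)%:E)%E.
Proof.
move=> a0 s0 st.
rewrite (@ge0_ftcT (fun v => pw a (v - s) * pw a v))//.
- by rewrite subrr [pw a 0]pw_le0// mul0r subr0.
- by meas.
- by move=> x; rewrite mulr_ge0 ?(ltW a0)// addr_ge0// mulr_ge0// pw_ge0.
- apply: continuous_subspaceT => x; apply: cvgM; last exact: continuous_pw.
  apply: (@continuous_comp _ _ _ (fun v => v - s) (pw a)); last exact: continuous_pw.
  by apply: cvgB; [exact: cvg_id|exact: cvg_cst].
- move=> x /andP[sx _].
  have d1 := is_derive_pw a (lt_trans s0 sx).
  have d2 : is_derive x 1 (fun v => pw a (v - s)) (a * pw (a - 1) (x - s)).
    have := is_derive_shift x (1 : R) (- s) => ds.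
    have := @is_derive1_comp _ (pw a) (fun v => v - s) x _ _ (is_derive_pw a _) ds.
    rewrite mulr1; apply; rewrite subr_gt0//.
  rewrite /has_derive; apply: is_derive_eq; rewrite /GRing.scale/=; ring.
Qed.

End power_integrals.

Section gamma_function.
Context {R : realType}.
Notation mu := (@lebesgue_measure R).
Implicit Types (p t : R).

Lemma measurable_expR_comp d (T : measurableType d) (g : T -> R) :
  measurable_fun [set: T] g -> measurable_fun [set: T] (fun x => expR (g x)).
Proof. by move=> mg; exact: measurableT_comp. Qed.

Lemma integral_expRN r : 0 < r ->
  (\int[mu]_x (pw 0 x * expR (- (r * x)))%:E = (r^-1)%:E)%E.
Proof.
move=> r0.
transitivity (\int[mu]_x (r^-1%:E * (exponential_pdf r x)%:E))%E; last first.
  rewrite ge0_integralZl_EFin//.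
  - by rewrite integral_exponential_pdf// mule1.
  - by move=> x _; rewrite lee_fin exponential_pdf_ge0// ltW.
  - by apply/measurable_EFinP; exact: measurable_exponential_pdf.
  - by rewrite invr_ge0 ltW.
apply: ae_eq_integral => //.
- by apply/measurable_EFinP; apply: measurable_funM; [meas|apply: measurable_expR_comp; meas].
- apply: emeasurable_funM => //.
  by apply/measurable_EFinP; exact: measurable_exponential_pdf.
- apply: ae_eqI; exists [set 0 : R]; split => //; first exact: lebesgue_measure_set1.
  move=> x /= h; apply: contrapT => x0; apply: h.
  have [xlt0|xgt0|//] := ltgtP x 0.
  + by rewrite pw_le0 ?ltW// mul0r lt0_exponential_pdf ?mule0.
  + rewrite /exponential_pdf patchE mem_set/= ?in_itv/= ?ltW// pwE// powRr0 mul1r.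
    by rewrite -EFinM mulrA mulVf ?gt_eqF// mul1r mulNr.
Qed.

Lemma integral_expRN_gt s :
  (\int[mu]_x (pw 0 (x - s) * expR (- x))%:E = (expR (- s))%:E)%E.
Proof.
rewrite -(@ge0_integral_shift _ (fun x => (pw 0 (x - s) * expR (- x))%:E) s); last 2 first.
- by apply/measurable_EFinP; apply: measurable_funM; [meas|apply: measurable_expR_comp; meas].
- by move=> x; rewrite lee_fin mulr_ge0 ?pw_ge0 ?expR_ge0.
transitivity (\int[mu]_x ((expR (- s))%:E * (pw 0 x * expR (- (1 * x)))%:E))%E.
  apply: eq_integral => x _; rewrite addrK -EFinM mul1r; congr (_%:E).
  by rewrite opprD expRD; ring.
rewrite ge0_integralZl_EFin ?integral_expRN ?invr1 ?mule1 ?expR_ge0//.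
- by move=> x _; rewrite lee_fin mulr_ge0 ?pw_ge0 ?expR_ge0.
- by apply/measurable_EFinP; apply: measurable_funM; [meas|apply: measurable_expR_comp; meas].
Qed.

(** Below 1 the exponential is at most 1. Above 1, [p <= 2] gives
    [x ^ (p - 1) <= x <= 2 * exp (x / 2)], which leaves an integrable exponential. *)
Lemma EGamma_lty p : 0 < p <= 2 ->
  (\int[mu]_x (pw (p - 1) x * expR (- x))%:E < +oo)%E.
Proof.
move=> /andP[p0 p2].
apply: (@le_lt_trans _ _ (\int[mu]_x ((pw (p - 1) x * (x < 1)%R%:R)%:E +
    2%:E * (pw 0 x * expR (- (2^-1 * x)))%:E))%E).
  apply: ge0_le_integral => //.
  - by move=> x _; rewrite lee_fin mulr_ge0 ?pw_ge0 ?expR_ge0.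
  - by apply/measurable_EFinP; apply: measurable_funM; [meas|apply: measurable_expR_comp; meas].
  - apply: emeasurable_funD; first by meas.
    apply: emeasurable_funM => //.
    by apply/measurable_EFinP; apply: measurable_funM; [meas|apply: measurable_expR_comp; meas].
  - move=> x _; rewrite -EFinM -EFinD lee_fin.
    have [x0|x0] := leP x 0; first by rewrite !pw_le0// !mul0r mulr0 addr0.
    have e0 := expR_ge0 (- (2^-1 * x)); have f0 := pw_ge0 0 x.
    have [x1|x1] := ltP x 1.
      rewrite mulr1 -[leLHS]addr0 lerD//; last by rewrite !mulr_ge0.
      rewrite ler_piMr ?pw_ge0//.
      by rewrite -expR0 ler_expR oppr_le0 ltW.
    rewrite mulr0 add0r !pwE// powRr0 mul1r.
    have -> : expR (- x) = expR (- (2^-1 * x)) * expR (- (2^-1 * x)).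
      by rewrite -expRD; congr expR; lra.
    rewrite mulrA ler_wpM2r//.
    have : x `^ (p - 1) <= x.
      by apply: ler1_powR => //; lra.
    move=> h; apply: (@le_trans _ _ (x * expR (- (2^-1 * x)))).
      by rewrite ler_wpM2r.
    have := expR_ge1Dx (2^-1 * x) => h2.
    rewrite expRN ler_pdivrMr ?expR_gt0//; lra.
rewrite ge0_integralD//; last 4 first.
- by move=> x _; rewrite lee_fin mulr_ge0 ?pw_ge0.
- by meas.
- by move=> x _; rewrite mule_ge0// lee_fin mulr_ge0 ?pw_ge0 ?expR_ge0.
- apply: emeasurable_funM => //.
  by apply/measurable_EFinP; apply: measurable_funM; [meas|apply: measurable_expR_comp; meas].
rewrite integral_pw_lt// ge0_integralZl_EFin//; last 2 first.
- by move=> x _; rewrite lee_fin mulr_ge0 ?pw_ge0 ?expR_ge0.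
- by apply/measurable_EFinP; apply: measurable_funM; [meas|apply: measurable_expR_comp; meas].
by rewrite integral_expRN// -EFinM -EFinD ltry.
Qed.

Lemma Gamma_E p : 0 < p <= 2 ->
  (\int[mu]_x (pw (p - 1) x * expR (- x))%:E = (Gamma p)%:E)%E.
Proof.
move=> p02.
have -> : Gamma p = fine (\int[mu]_x (pw (p - 1) x * expR (- x))%:E)%E.
  rewrite /Gamma /Rintegral integral_mkcond; congr fine.
  apply: eq_integral => x _; rewrite patchE; case: ifPn => [|/negP h].
    by rewrite inE/= in_itv/= andbT => x0; rewrite pwE.
  rewrite pw_le0 ?mul0r// leNgt; apply/negP => x0; apply: h.
  by rewrite inE/= in_itv/= x0.
rewrite fineK// ge0_fin_numE ?EGamma_lty//.
by apply: integral_ge0 => x _; rewrite lee_fin mulr_ge0 ?pw_ge0 ?expR_ge0.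
Qed.

Lemma Gamma_gt0 p : 0 < p <= 2 -> 0 < Gamma p.
Proof.
move=> p02; rewrite lt_neqAle -!lee_fin -Gamma_E// integral_ge0 ?andbT; last first.
  by move=> x _; rewrite lee_fin mulr_ge0 ?pw_ge0 ?expR_ge0.
apply/eqP => G0.
have mf : measurable_fun setT (fun x => (pw (p - 1) x * expR (- x))%:E : \bar R).
  by apply/measurable_EFinP; apply: measurable_funM; [meas|apply: measurable_expR_comp; meas].
have /(ae_eq_integral_abs mu measurableT mf).1 :
    (\int[mu]_x `|(pw (p - 1) x * expR (- x))%:E| = 0)%E.
  under eq_integral do rewrite gee0_abs ?lee_fin ?mulr_ge0 ?pw_ge0 ?expR_ge0//.
  by rewrite Gamma_E// -G0.
move=> [N [mN N0 subN]].
have : (mu `]0%R, 1%R[%classic <= mu N)%E.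
  apply: le_measure; rewrite ?inE//.
  move=> x; rewrite /= in_itv/= => /andP[x0 x1]; apply: subN => /= /(_ I)[].
  by apply/eqP; rewrite mulf_neq0 ?gt_eqF ?pw_gt0 ?expR_gt0.
by rewrite N0 lebesgue_measure_itv/= lte_fin ltr01 oppr0 adde0 lee_fin ler10.
Qed.

(** Writing [x ^ p] as [p] times the integral of [s ^ (p - 1)] over [(0, x)] and exchanging the
    integrals replaces an integration by parts at infinity. *)
Lemma Gamma_add1 p : 0 < p <= 1 -> Gamma (p + 1) = p * Gamma p.
Proof.
move=> /andP[p0 p1]; apply: EFin_inj.
have mE (g h : R * R -> R) : measurable_fun setT g -> measurable_fun setT h ->
    measurable_fun setT (fun z => g z * expR (h z)).
  by move=> mg mh; apply: measurable_funM => //; exact: measurable_expR_comp.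
rewrite -Gamma_E ?addrK; last lra.
transitivity (\int[mu]_x \int[mu]_s (p * (pw (p - 1) s * pw 0 (x - s) * expR (- x)))%:E)%E.
  apply: eq_integral => x _.
  transitivity (\int[mu]_s ((p * expR (- x))%:E * (pw (p - 1) s * (s < x)%R%:R)%:E))%E.
    rewrite ge0_integralZl_EFin ?integral_pw_lt// -?EFinM.
    - by congr EFin; field; rewrite gt_eqF.
    - by move=> s _; rewrite lee_fin mulr_ge0 ?pw_ge0.
    - by meas.
    - by rewrite mulr_ge0 ?expR_ge0// ltW.
  apply: eq_integral => s _; rewrite -EFinM; congr EFin.
  case: ltP => sx; last by rewrite [pw 0 _]pw_le0 ?subr_le0// !(mulr0, mul0r).
  by rewrite [pw 0 _]pwE ?subr_gt0// powRr0 !mulr1 -mulrA [expR _ * _]mulrC.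
rewrite tonelli; last 2 first.
- by apply: measurable_funM => //; apply: mE; meas.
- by move=> x y; rewrite !mulr_ge0 ?pw_ge0 ?expR_ge0// ltW.
transitivity (\int[mu]_s (p%:E * (pw (p - 1) s * expR (- s))%:E))%E; last first.
  rewrite ge0_integralZl_EFin ?EFinM ?Gamma_E//; first lra.
  - by move=> s _; rewrite lee_fin mulr_ge0 ?pw_ge0 ?expR_ge0.
  - by apply/measurable_EFinP; apply: measurable_funM; [meas|apply: measurable_expR_comp; meas].
  - exact: ltW.
apply: eq_integral => s _.
transitivity (\int[mu]_x ((p * pw (p - 1) s)%:E * (pw 0 (x - s) * expR (- x))%:E))%E.
  by apply: eq_integral => x _; rewrite -EFinM; congr EFin; ring.
rewrite ge0_integralZl_EFin ?integral_expRN_gt -?EFinM ?mulrA//.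
- by move=> x _; rewrite lee_fin mulr_ge0 ?pw_ge0 ?expR_ge0.
- by apply/measurable_EFinP; apply: measurable_funM; [meas|apply: measurable_expR_comp; meas].
- by rewrite mulr_ge0 ?pw_ge0// ltW.
Qed.

End gamma_function.

Section beta_integral.
Context {R : realType}.
Notation mu := (@lebesgue_measure R).
Variable b : R.
Hypotheses (b0 : 0 < b) (b1 : b < 1).

Let Bf (t : R) := (\int[mu]_s (pw (b - 1) s * pw (- b) (t - s))%:E)%E.

Let Bf_ge0 t : (0 <= Bf t)%E.
Proof. by apply: integral_ge0 => s _; rewrite lee_fin mulr_ge0 ?pw_ge0. Qed.

Let Bf_le0 t : t <= 0 -> Bf t = 0%E.
Proof.
move=> t0; apply: integral0_eq => s _.
have [s0|s0] := leP s 0; first by rewrite pw_le0// mul0r.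
by rewrite [pw (- b) _]pw_le0 ?mulr0// subr_le0 (le_trans t0)// ltW.
Qed.

Let Bf_gt0 t : 0 < t -> Bf t = Bf 1.
Proof.
move=> t0; rewrite /Bf.
rewrite -(@ge0_integral_scale _ (fun s => (pw (b - 1) s * pw (- b) (t - s))%:E) t)//; last 2 first.
- by meas.
- by move=> s; rewrite lee_fin mulr_ge0 ?pw_ge0.
rewrite -ge0_integralZl_EFin//; last 3 first.
- by move=> s _; rewrite lee_fin mulr_ge0 ?pw_ge0.
- by meas.
- exact: ltW.
apply: eq_integral => s _; rewrite -EFinM; congr EFin.
have -> : t - t * s = t * (1 - s) by rewrite mulrBr mulr1.
rewrite !pw_scale// [LHS](_ : _ = (t `^ 1 * t `^ (b - 1) * t `^ (- b)) *
  (pw (b - 1) s * pw (- b) (1 - s))).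
  have tn (r : R) (q : R) : (r + q == 0) ==> (t != 0) by rewrite gt_eqF// implybT.
  rewrite -!powRD// (_ : 1 + (b - 1) + - b = 0); last by ring.
  by rewrite powRr0 mul1r.
by rewrite powRr1 ?ltW// !mulrA; congr (_ * _); rewrite -!mulrA; congr (_ * (_ * _)); rewrite mulrC.
Qed.

Let onemb : 0 < 1 - b <= 2.
Proof. by rewrite subr_gt0 b1 lerBlDr -[leLHS]addr0 lerD ?(ltW b0)// ler1n. Qed.

Let b02 : 0 < b <= 2.
Proof. by rewrite b0 (le_trans (ltW b1))// ler1n. Qed.

(* The convolution Bf is constant on (0, oo); integrate it against exp (- t). *)
Let Bf1 : Bf 1 = (Gamma b * Gamma (1 - b))%:E.
Proof.
have mE (g h : R * R -> R) : measurable_fun setT g -> measurable_fun setT h ->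
    measurable_fun setT (fun z => g z * expR (h z)).
  by move=> mg mh; apply: measurable_funM => //; exact: measurable_expR_comp.
have mE1 (g h : R -> R) : measurable_fun setT g -> measurable_fun setT h ->
    measurable_fun setT (fun z => (g z * expR (h z))%:E).
  move=> mg mh; apply/measurable_EFinP; apply: measurable_funM => //.
  exact: measurable_expR_comp.
have -> : Bf 1 = (\int[mu]_x \int[mu]_s
    (pw (b - 1) s * pw (- b) (x - s) * expR (- x))%:E)%E.
  transitivity (\int[mu]_x ((pw 0 x * expR (- (1 * x)))%:E * Bf 1))%E.
    rewrite ge0_integralZr//.
    - by rewrite integral_expRN// invr1 mul1e.
    - by apply: mE1; meas.
    - by move=> x _; rewrite lee_fin mulr_ge0 ?pw_ge0 ?expR_ge0.
  apply: eq_integral => x _.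
  transitivity ((expR (- x))%:E * Bf x)%E.
    have [x0|x0] := leP x 0; first by rewrite (Bf_le0 x0) (pw_le0 _ x0) mul0r mul0e mule0.
    by rewrite (Bf_gt0 x0) pwE// powRr0 mul1r mul1r.
  rewrite /Bf -ge0_integralZl_EFin ?expR_ge0//.
  - by apply: eq_integral => s _; rewrite -EFinM mulrC.
  - by move=> s _; rewrite lee_fin mulr_ge0 ?pw_ge0.
  - by meas.
rewrite tonelli; last 2 first.
- by apply: mE; meas.
- by move=> x y; rewrite !mulr_ge0 ?pw_ge0 ?expR_ge0.
transitivity (\int[mu]_s ((pw (b - 1) s * expR (- s))%:E * (Gamma (1 - b))%:E))%E.
  apply: eq_integral => s _.
  have <- : (\int[mu]_x (pw (- b) (x - s) * expR (- (x - s)))%:E)%E = (Gamma (1 - b))%:E.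
    rewrite -(Gamma_E onemb) (_ : 1 - b - 1 = - b); last by ring.
    rewrite -(@ge0_integral_shift _ (fun x => (pw (- b) (x - s) * expR (- (x - s)))%:E) s).
    - apply: eq_integral => x _; rewrite addrK; congr (pw _ _ * _)%:E; ring.
    - by apply: mE1; meas.
    - by move=> x; rewrite lee_fin mulr_ge0 ?pw_ge0 ?expR_ge0.
  rewrite -ge0_integralZl_EFin//.
  - apply: eq_integral => x _; rewrite -EFinM; congr EFin.
    have -> : expR (- x) = expR (- s) * expR (- (x - s)).
      by rewrite -expRD; congr expR; rewrite opprB addrA addNr sub0r.
    by rewrite !mulrA; congr (_ * _); rewrite -!mulrA; congr (_ * _); rewrite mulrC.
  - by move=> x _; rewrite lee_fin mulr_ge0 ?pw_ge0 ?expR_ge0.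
  - by apply: mE1; meas.
  - by rewrite mulr_ge0 ?pw_ge0 ?expR_ge0.
rewrite ge0_integralZr//.
- by rewrite (Gamma_E b02) EFinM.
- by apply: mE1; meas.
- by move=> x _; rewrite lee_fin mulr_ge0 ?pw_ge0 ?expR_ge0.
- by rewrite lee_fin ltW// Gamma_gt0.
Qed.

(** The exponents [b - 1] and [- b] add up to [-1], so the convolution is invariant under scaling
    and depends only on the order of [u] and [v]. That Abel kernels of complementary orders convolve
    to an indicator function is the source of every inversion below. *)
Lemma beta_integral u v :
  (\int[mu]_s (pw (b - 1) (s - u) * pw (- b) (v - s))%:E =
   (Gamma b * Gamma (1 - b) * (u < v)%R%:R)%:E)%E.
Proof.
transitivity (Bf (v - u)); last first.
  case: ltP => uv; last by rewrite Bf_le0 ?subr_le0// mulr0.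
  by rewrite Bf_gt0 ?subr_gt0// Bf1 mulr1.
rewrite -(@ge0_integral_shift _ (fun s => (pw (b - 1) (s - u) * pw (- b) (v - s))%:E) u).
- by apply: eq_integral => s _; rewrite addrK opprD addrA addrAC.
- by meas.
- by move=> s; rewrite lee_fin mulr_ge0 ?pw_ge0.
Qed.

End beta_integral.

Section measurable_integral.
Context d (T : measurableType d) {R : realType}.
Notation mu := (@lebesgue_measure R).

Lemma measurable_fun_integral (f : T -> R -> \bar R) :
  measurable_fun [set: T * R] (fun z => f z.1 z.2) ->
  (forall x y, 0 <= f x y)%E ->
  measurable_fun setT (fun x => \int[mu]_y f x y)%E.
Proof.
move=> mf f0.
by have := @measurable_fun_fubini_tonelli_F _ _ _ _ R mu
  (fun z : T * R => f z.1 z.2) mf (fun z => f0 z.1 z.2).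
Qed.

End measurable_integral.

Section pw_monotone.
Context {R : realType}.
Notation mu := (@lebesgue_measure R).

Lemma pw_mono (p x y : R) : 0 <= p -> x <= y -> pw p x <= pw p y.
Proof.
move=> p0 xy; have [x0|x0] := leP x 0; first by rewrite (pw_le0 _ x0) pw_ge0.
have y0 := lt_le_trans x0 xy.
by rewrite !pwE//; apply: ge0_ler_powR => //; rewrite nnegrE ltW.
Qed.

Lemma pw_anti (p x y : R) : p <= 0 -> 0 < x -> x <= y -> pw p y <= pw p x.
Proof.
move=> p0 x0 xy; have y0 := lt_le_trans x0 xy.
rewrite !pwE// -(opprK p) !(powRN _ (- p)) lef_pV2 ?posrE ?powR_gt0//.
by apply: ge0_ler_powR => //; rewrite ?nnegrE ?oppr_ge0// ltW.
Qed.

Lemma pw0E (x : R) : pw 0 x = (0 < x)%R%:R.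
Proof. by rewrite /pw powRr0; case: ifP. Qed.

Lemma pwV (p x : R) : 0 < x -> pw (- p) x * pw p x = 1.
Proof. by move=> x0; rewrite pwM addNr pwE// powRr0. Qed.

Lemma integral_pw_shift_lt (p s t : R) : 0 < p ->
  (\int[mu]_v (pw (p - 1) (v - s) * (v < t)%R%:R)%:E = (pw p (t - s) / p)%:E)%E.
Proof.
move=> p0; rewrite -integral_pw_lt//.
rewrite -(@ge0_integral_shift _ (fun v => (pw (p - 1) (v - s) * (v < t)%R%:R)%:E) s).
- by apply: eq_integral => v _; rewrite addrK ltrBrDr.
- by meas.
- by move=> v; rewrite lee_fin mulr_ge0 ?pw_ge0.
Qed.

Lemma integral_pw_reflect_gt (p t : R) : 0 < p ->
  (\int[mu]_v (pw (p - 1) (t - v) * (0 < v)%R%:R)%:E = (pw p t / p)%:E)%E.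
Proof.
move=> p0; rewrite -integral_pw_lt//.
rewrite -(@ge0_integral_reflect _ (fun v => (pw (p - 1) (t - v) * (0 < v)%R%:R)%:E) t).
- apply: eq_integral => v _; rewrite subr_gt0; congr (pw _ _ * _)%:E.
  by rewrite opprB addrC subrK.
- by meas.
- by move=> v; rewrite lee_fin mulr_ge0 ?pw_ge0.
Qed.

End pw_monotone.

(** * Square integrable functions on the half-line *)

Section square_integrable.
Context {R : realType}.
Notation mu := (@lebesgue_measure R).

(* Square integrable functions on the half-line, extended by 0. *)
Definition L2p (chi : R -> R) : Prop :=
  [/\ measurable_fun setT chi, forall x, x <= 0 -> chi x = 0 &
      mu.-integrable setT (EFin \o (fun x => chi x ^+ 2))].

Lemma mul_le_sqr (x y : R) : `|x * y| <= x ^+ 2 + y ^+ 2.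
Proof.
rewrite normrM -[in leRHS](real_normK (num_real x)) -[in leRHS](real_normK (num_real y)).
have := sqr_ge0 (`|x| - `|y|); have := normr_ge0 x; have := normr_ge0 y; nra.
Qed.

Lemma L2p_mul (f g : R -> R) : L2p f -> L2p g ->
  mu.-integrable setT (EFin \o (fun x => f x * g x)).
Proof.
move=> [mf _ f2] [mg _ g2].
apply: (@le_Rintegrable _ _ _ (fun x => f x ^+ 2 + g x ^+ 2)) => //.
- exact: measurable_funM.
- by move=> x _; exact: mul_le_sqr.
- exact: RintegrableD.
Qed.

Lemma L2p_sqr_ge0 (f : R -> R) : measurable_fun setT f ->
  (forall x, x <= 0 -> f x = 0) -> (\int[mu]_x (f x ^+ 2)%:E < +oo)%E -> L2p f.
Proof.
move=> mf f0 f2; split => //; apply/integrableP; split.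
  by apply/measurable_EFinP; exact: measurable_funX.
by under eq_integral do rewrite /= ger0_norm ?sqr_ge0//.
Qed.

Lemma L2pZ c f : L2p f -> L2p (fun x => c * f x).
Proof.
move=> [mf f0 f2]; split; first exact: measurable_funM.
- by move=> x x0; rewrite f0// mulr0.
- have := RintegrableZ measurableT (c ^+ 2) f2; congr (is_true (mu.-integrable _ _)).
  by apply/funext => x /=; rewrite exprMn.
Qed.

Lemma L2pD f g : L2p f -> L2p g -> L2p (fun x => f x + g x).
Proof.
move=> [mf f0 f2] [mg g0 g2]; split; first exact: measurable_funD.
- by move=> x x0; rewrite f0// g0// addr0.
- apply: (@le_Rintegrable _ _ _ (fun x => 2 * (f x ^+ 2 + g x ^+ 2))) => //.
  + by apply: measurable_funX; exact: measurable_funD.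
  + move=> x _; rewrite ger0_norm ?sqr_ge0//.
    by have := sqr_ge0 (f x - g x); nra.
  + by apply: RintegrableZ => //; exact: RintegrableD.
Qed.

Lemma L2p_le (f g : R -> R) : measurable_fun setT g -> L2p f ->
  (forall x, `|g x| <= `|f x|) -> L2p g.
Proof.
move=> mg [mf f0 f2] gf; split => //.
- move=> x x0; apply/eqP; rewrite -normr_eq0 eq_le normr_ge0 andbT.
  by rewrite (le_trans (gf x))// f0// normr0.
- apply: (@le_Rintegrable _ _ _ (fun x => f x ^+ 2)) => //.
  + exact: measurable_funX.
  + move=> x _; rewrite ger0_norm ?sqr_ge0//.
    by rewrite -(real_normK (num_real (g x))) -(real_normK (num_real (f x))) lerXn2r ?nnegrE.
Qed.

Lemma L2pB f g : L2p f -> L2p g -> L2p (fun x => f x - g x).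
Proof.
move=> hf hg; have := L2pD hf (L2pZ (- 1) hg).
by congr L2p; apply/funext => x; rewrite mulN1r.
Qed.

Lemma L2p_pw_lt p t : 0 <= p < 2^-1 -> L2p (fun s => pw (- p) s * (s < t)%R%:R).
Proof.
move=> /andP[p0 p1]; apply: L2p_sqr_ge0.
- by meas.
- by move=> x x0; rewrite pw_le0// mul0r.
- have p2 : 0 < 1 - 2 * p by lra.
  have := integral_pw_lt t p2 => E.
  rewrite [ltLHS](_ : _ = (pw (1 - 2 * p) t / (1 - 2 * p))%:E) ?ltry// -E.
  apply: eq_integral => x _; congr EFin; rewrite exprMn expr2 pwM.
  have -> : - p + - p = 1 - 2 * p - 1 by lra.
  by case: (x < t); rewrite ?expr1n ?expr0n.
Qed.

Lemma L2p_pw_reflect p t : 0 <= p < 2^-1 ->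
  L2p (fun s => pw (- p) (t - s) * (0 < s)%R%:R).
Proof.
move=> /andP[p0 p1]; apply: L2p_sqr_ge0.
- by meas.
- by move=> x x0; rewrite ltNge x0/= mulr0.
- have p2 : 0 < 1 - 2 * p by lra.
  have := integral_pw_reflect_gt t p2 => E.
  rewrite [ltLHS](_ : _ = (pw (1 - 2 * p) t / (1 - 2 * p))%:E) ?ltry// -E.
  apply: eq_integral => x _; congr EFin; rewrite exprMn expr2 pwM.
  have -> : - p + - p = 1 - 2 * p - 1 by lra.
  by case: (0 < x); rewrite ?expr1n ?expr0n.
Qed.

End square_integrable.

(** * The Volterra kernel *)

Section volterra_kernel_neg.
Context {R : realType}.
Notation mu := (@lebesgue_measure R).
Variable b : R.
Hypotheses (b0 : 0 < b) (b12 : b < 2^-1).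

Local Opaque Gamma pw.

Ltac slra := move: b0 b12; lra.

Let b1 : b < 1. Proof. slra. Qed.

Let G1b : 0 < Gamma (1 - b).
Proof. by apply: Gamma_gt0; apply/andP; split; slra. Qed.

Let Gb : 0 < Gamma b.
Proof. by apply: Gamma_gt0; apply/andP; split; slra. Qed.

Let Jn (t s : R) : \bar R :=
  (\int[mu]_v (pw (- b) (v - s) * pw (- b - 1) v * (v < t)%R%:R)%:E)%E.

(* K_H / C_1 for H = 1/2 - b. *)
Definition KNneg (t s : R) : R := (Gamma (1 - b))^-1 * (pw b s *
  (pw (- b) t * pw (- b) (t - s) + b * fine (Jn t s))).

Let Jn_ge0 t s : (0 <= Jn t s)%E.
Proof. by apply: integral_ge0 => v _; rewrite lee_fin !mulr_ge0 ?pw_ge0. Qed.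

(** In the integrand of [Jn] the power [- b - 1] of [v] is split: [- b - d] is charged to [s] and
    [d - 1] to [v - s]. Integrability at [v = s] then requires [b < d], and square integrability of
    [pw (- d) s] at 0 requires [d < 2^-1]; the midpoint satisfies both. *)
Let d := (b + 2^-1) / 2.

Let Jn_le t s : 0 < s ->
  (Jn t s <= (pw (- d) s * (s < t)%R%:R * (pw (- b) s * pw (d - b) t / (d - b)))%:E)%E.
Proof.
move=> s0; have db : 0 < d - b by rewrite /d; slra.
have [ts|st] := leP t s.
  rewrite mulr0 mul0r /Jn integral0_eq// => v _.
  have [vs|vs] := leP v s; first by rewrite (pw_le0 _ (_ : v - s <= 0)) ?subr_le0// !mul0r.
  by rewrite ltNge (ltW (le_lt_trans ts vs)) mulr0.
apply: (@le_trans _ _ (\int[mu]_v ((pw (- b - d) s)%:E *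
    (pw (d - b - 1) (v - s) * (v < t)%R%:R)%:E))%E).
  apply: ge0_le_integral => //.
  - by move=> v _; rewrite lee_fin !mulr_ge0 ?pw_ge0.
  - by meas.
  - by apply: emeasurable_funM => //; meas.
  - move=> v _; rewrite -EFinM lee_fin mulrA ler_wpM2r//.
    have [vs|vs] := leP v s.
      by rewrite !(pw_le0 _ (_ : v - s <= 0)) ?subr_le0// mul0r mulr0.
    have -> : d - b - 1 = - b + (d - 1) by ring.
    rewrite -(pwM (- b) (d - 1)) mulrCA ler_wpM2l ?pw_ge0//.
    have -> : - b - 1 = (- b - d) + (d - 1) by ring.
    rewrite -(pwM (- b - d) (d - 1)) ler_pM ?pw_ge0//; apply: pw_anti; rewrite /d ?subr_gt0//; slra.
rewrite ge0_integralZl_EFin ?pw_ge0//; last 2 first.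
- by move=> v _; rewrite lee_fin !mulr_ge0 ?pw_ge0.
- by meas.
rewrite integral_pw_shift_lt// -EFinM lee_fin mulr1.
have -> : - b - d = - d + - b by ring.
rewrite -(pwM (- d) (- b)) -[leLHS]mulrA ler_wpM2l ?pw_ge0// -[leRHS]mulrA ler_wpM2l ?pw_ge0//.
rewrite ler_pM2r ?invr_gt0//; apply: pw_mono; first exact: ltW.
by rewrite lerBlDr lerDl ltW.
Qed.

Let Jn_fin t s : 0 < s -> (fine (Jn t s))%:E = Jn t s.
Proof.
move=> s0; rewrite fineK// ge0_fin_numE//.
by apply: (le_lt_trans (Jn_le t s0)); rewrite ltry.
Qed.

Lemma KNneg_ge0 t s : 0 <= KNneg t s.
Proof.
rewrite mulr_ge0 ?invr_ge0 ?(ltW G1b)// mulr_ge0 ?pw_ge0//.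
by rewrite addr_ge0 ?mulr_ge0 ?pw_ge0 ?fine_ge0// ltW.
Qed.

Lemma KNneg_supp t s : t <= s -> KNneg t s = 0.
Proof.
move=> ts; have [s0|s0] := leP s 0; first by rewrite /KNneg (pw_le0 _ s0) mul0r mulr0.
rewrite /KNneg (pw_le0 _ (_ : t - s <= 0)) ?subr_le0// mulr0 add0r.
suff -> : Jn t s = 0%E by rewrite mulr0 mulr0 mulr0.
apply/eqP; rewrite eq_le Jn_ge0 andbT (le_trans (Jn_le t s0))//.
by rewrite ltNge ts mulr0 mul0r.
Qed.

Lemma KNneg_le0 t s : s <= 0 -> KNneg t s = 0.
Proof. by move=> s0; rewrite /KNneg (pw_le0 _ s0) mul0r mulr0. Qed.

Lemma measurable_KNneg : measurable_fun [set: R * R] (fun z => KNneg z.1 z.2).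
Proof.
have mJ : measurable_fun [set: R * R] (fun z => Jn z.1 z.2).
  apply: (@measurable_fun_integral _ (R * R)%type R
    (fun w v => (pw (- b) (v - w.2) * pw (- b - 1) v * (v < w.1)%R%:R)%:E)).
  - have m11 : measurable_fun [set: (R * R) * R] (fun w => w.1.1).
      exact: (measurableT_comp measurable_fst).
    have m12 : measurable_fun [set: (R * R) * R] (fun w => w.1.2).
      exact: (measurableT_comp measurable_snd).
    by meas.
  - by move=> w v; rewrite lee_fin !mulr_ge0 ?pw_ge0.
have mfJ : measurable_fun [set: R * R] (fun z => fine (Jn z.1 z.2)).
  exact: (measurableT_comp (fine_measurable measurableT)).
by rewrite /KNneg; meas.
Qed.

Lemma measurable_KNneg2 t : measurable_fun [set: R] (KNneg t).
Proof.
by apply: (measurableT_comp measurable_KNneg (g := fun s => (t, s))); exact: measurable_pair1.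
Qed.

(** As [s <= t], the first term is at most a multiple of [(t - s) ^ (- b)]; by [Jn_le] the second is
    at most a multiple of [s ^ (- d)]. Both exponents lie above [- 2^-1]. *)
Lemma KNneg_L2p t : L2p (KNneg t).
Proof.
have db : 0 < d - b by rewrite /d; slra.
apply: (@L2p_le _ (fun s => (Gamma (1 - b))^-1 * (pw (- b) (t - s) * (0 < s)%R%:R +
   (b * (pw (d - b) t / (d - b))) * (pw (- d) s * (s < t)%R%:R)))).
- exact: measurable_KNneg2.
- apply: L2pZ; apply: L2pD; first by apply: L2p_pw_reflect; apply/andP; split; slra.
  by apply: L2pZ; apply: L2p_pw_lt; rewrite /d; apply/andP; split; slra.
- move=> s; have [s0|s0] := leP s 0; first by rewrite KNneg_le0// normr0.
  have [ts|st] := leP t s; first by rewrite KNneg_supp// normr0.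
  have t0 := lt_trans s0 st.
  have i0 : 0 <= (Gamma (1 - b))^-1 by rewrite invr_ge0; exact: ltW G1b.
  rewrite ger0_norm ?KNneg_ge0// (le_trans _ (ler_norm _))//.
  rewrite /KNneg ler_wpM2l// mulrDr lerD//.
  + rewrite mulr1 mulrA ler_piMl ?pw_ge0//.
    rewrite -[leRHS](pwV b t0) mulrC ler_wpM2l ?pw_ge0//.
    by apply: pw_mono; rewrite ltW.
  + rewrite mulrCA -!mulrA ler_wpM2l ?(ltW b0)//.
    have h := Jn_le t s0; rewrite -(Jn_fin t s0) lee_fin st !mulr1 in h.
    apply: (le_trans (ler_wpM2l (pw_ge0 b s) h)).
    rewrite le_eqVlt; apply/orP; left; apply/eqP.
    by have := pwV b s0; move: (pw (- b) s) (pw b s) => x y xy; rewrite mulr1 -[RHS]mul1r -xy; ring.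
Qed.

(** Up to constants and weights, the operator K_{oo-}^{H,*} maps the kernel to the indicator of
    [(0, t)]. Both terms of the kernel reduce to [beta_integral]; the term with [Jn] contributes
    [pw (- b) u - pw (- b) t], and the powers of [t] cancel. *)
Lemma integral_KNneg t u : 0 < u ->
  (\int[mu]_s (pw (b - 1) (s - u) * (pw (- b) s * KNneg t s))%:E =
   (Gamma b * (pw (- b) u * (u < t)%R%:R))%:E)%E.
Proof.
move=> u0.
have [tu|ut] := leP t u.
  rewrite mulr0 mulr0; apply: integral0_eq => s _.
  have [su|su] := leP s u; first by rewrite (pw_le0 _ (_ : s - u <= 0)) ?subr_le0// !mul0r.
  by rewrite KNneg_supp ?mulr0// (le_trans tu)// ltW.
have t0 := lt_trans u0 ut.
have mJ : measurable_fun [set: R] (fun s => Jn t s).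
  apply: measurable_fun_integral.
  - by meas.
  - by move=> s v; rewrite lee_fin !mulr_ge0 ?pw_ge0.
have i0 : 0 <= (Gamma (1 - b))^-1 by rewrite invr_ge0; exact: ltW G1b.
transitivity (\int[mu]_s ((Gamma (1 - b))^-1%:E *
   ((pw (- b) t)%:E * (pw (b - 1) (s - u) * pw (- b) (t - s))%:E +
    b%:E * ((pw (b - 1) (s - u))%:E * Jn t s))))%E.
  apply: eq_integral => s _.
  have [su|su] := leP s u.
    by rewrite (pw_le0 _ (_ : s - u <= 0)) ?subr_le0// !mul0r !(mule0, mul0e, adde0).
  have s0 := lt_trans u0 su.
  transitivity ((Gamma (1 - b))^-1 * (pw (- b) t * (pw (b - 1) (s - u) *
      pw (- b) (t - s)) + b * (pw (b - 1) (s - u) * fine (Jn t s))))%:E; last first.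
    by rewrite !(EFinM, EFinD) Jn_fin.
  congr EFin; rewrite /KNneg.
  have := pwV b s0; move: (pw (- b) s) (pw b s) => x y xy.
  move: (pw _ _) (pw _ _) (pw _ _) (fine _) (Gamma _)^-1 => p q r j g.
  by rewrite -[RHS]mul1r -xy; ring.
rewrite ge0_integralZl_EFin//; last 2 first.
- move=> s _; rewrite adde_ge0 ?mule_ge0// lee_fin ?mulr_ge0 ?pw_ge0//; exact: ltW.
- apply: emeasurable_funD; apply: emeasurable_funM => //; first by meas.
  by apply: emeasurable_funM => //; meas.
rewrite ge0_integralD//; last 4 first.
- by move=> s _; rewrite ?mule_ge0// lee_fin ?mulr_ge0 ?pw_ge0.
- by apply: emeasurable_funM => //; meas.
- by move=> s _; rewrite !mule_ge0// lee_fin ?pw_ge0// ltW.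
- by do 2 apply: emeasurable_funM => //; meas.
rewrite ge0_integralZl_EFin ?pw_ge0//; last 2 first.
- by move=> s _; rewrite lee_fin ?mulr_ge0 ?pw_ge0.
- by meas.
rewrite ge0_integralZl_EFin ?(ltW b0)//; last 2 first.
- by move=> s _; rewrite mule_ge0// lee_fin ?pw_ge0.
- by apply: emeasurable_funM => //; meas.
rewrite beta_integral// ut mulr1.
have -> : (\int[mu]_s ((pw (b - 1) (s - u))%:E * Jn t s) =
    (Gamma b * Gamma (1 - b))%:E * ((pw (- b) u - pw (- b) t) / b)%:E)%E.
  transitivity (\int[mu]_s \int[mu]_v (pw (b - 1) (s - u) *
      (pw (- b) (v - s) * pw (- b - 1) v * (v < t)%R%:R))%:E)%E.
    apply: eq_integral => s _; rewrite -ge0_integralZl_EFin ?pw_ge0//.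
    + by move=> v _; rewrite lee_fin !mulr_ge0 ?pw_ge0.
    + by meas.
  rewrite tonelli; last 2 first.
  + by meas.
  + by move=> s v; rewrite !mulr_ge0 ?pw_ge0.
  rewrite -(integral_pwN_itv b0 u0 (ltW ut)) -ge0_integralZl_EFin//.
  + apply: eq_integral => v _.
    transitivity (\int[mu]_s ((pw (- b - 1) v * (v < t)%R%:R)%:E *
        (pw (b - 1) (s - u) * pw (- b) (v - s))%:E))%E.
      by apply: eq_integral => s _; rewrite -EFinM; congr EFin; ring.
    rewrite ge0_integralZl_EFin ?beta_integral// -?EFinM.
    * congr EFin; move: (Gamma _) (Gamma _) (pw _ _) (_%:R) => x y z w; ring.
    * by move=> s _; rewrite lee_fin ?mulr_ge0 ?pw_ge0.
    * by meas.
    * by rewrite mulr_ge0 ?pw_ge0.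
  + by move=> s _; rewrite lee_fin ?mulr_ge0 ?pw_ge0.
  + by meas.
  + by apply: mulr_ge0; [exact: ltW Gb|exact: ltW G1b].
transitivity ((Gamma (1 - b))^-1 * (pw (- b) t * (Gamma b * Gamma (1 - b)) +
  b * (Gamma b * Gamma (1 - b) * ((pw (- b) u - pw (- b) t) / b))))%:E.
  by rewrite !(EFinM, EFinD).
congr EFin; rewrite mulr1.
have := lt0r_neq0 b0; have := lt0r_neq0 G1b.
move: (pw _ _) (pw _ _) (Gamma _) (Gamma _) => x y g h g0 c0.
by field; rewrite g0 c0.
Qed.

End volterra_kernel_neg.

Section zero_primitive.
Context {R : realType}.
Notation mu := (@lebesgue_measure R).

(* No integrability is needed: otherwise both sides have the junk value 0. *)
Lemma RintegralZlT (c : R) (f : R -> R) : measurable_fun setT f ->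
  \int[mu]_x (c * f x) = c * \int[mu]_x f x.
Proof.
move=> mf; have [->|c0] := eqVneq c 0.
  by rewrite mul0r; under eq_Rintegral do rewrite mul0r; rewrite /Rintegral integral0.
have junk (g : R -> R) : measurable_fun setT g ->
    ~ mu.-integrable setT (EFin \o g) -> \int[mu]_x g x = 0.
  move=> mg ng; rewrite /Rintegral.
  have : (\int[mu]_x (g x)%:E)%E \isn't a fin_num.
    apply/negP; rewrite -integral_fin_num_abs// => h; apply: ng.
    by apply/integrableP; split => //; exact/measurable_EFinP.
  by case: (\int[mu]_x (g x)%:E)%E.
have [intf|nf] := pselect (mu.-integrable setT (EFin \o f)); first exact: RintegralZl.
rewrite (junk f)// mulr0 junk//; first exact: measurable_funM.
move=> /(RintegrableZ measurableT c^-1) h; apply: nf.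
by congr (is_true (mu.-integrable _ _)): h; apply/funext => x /=; rewrite mulKf.
Qed.

Lemma Rintegral_lt (q : R -> R) t :
  \int[mu]_x (q x * (x < t)%R%:R) = \int[mu]_(x in `]-oo, t[) q x.
Proof.
rewrite [RHS]Rintegral_mkcond; apply: eq_Rintegral => x _; rewrite patchE.
case: ifPn => [|/negP]; rewrite inE/= in_itv/=; first by move=> ->; rewrite mulr1.
by move/negP/negbTE => ->; rewrite mulr0.
Qed.

Lemma integrable_lt (q : R -> R) t : measurable_fun setT q ->
  mu.-integrable setT (EFin \o (fun x => q x * (x < t)%R%:R)) ->
  mu.-integrable `]-oo, t[ (EFin \o q).
Proof.
move=> mq iq.
have itN : mu.-integrable `]-oo, t[ (EFin \o (fun x => q x * (x < t)%R%:R)).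
  by apply: integrableS iq.
apply: eq_integrable itN => // x; rewrite inE/= in_itv/= => ->.
by rewrite mulr1.
Qed.

(** By Lebesgue differentiation [q] is almost everywhere the derivative of its primitive, here a
    constant. *)
Lemma ae_eq0_primitive (q : R -> R) : measurable_fun setT q ->
  (forall t, mu.-integrable setT (EFin \o (fun x => q x * (x < t)%R%:R))) ->
  (forall t, \int[mu]_x (q x * (x < t)%R%:R) = 0) ->
  {ae mu, forall x, q x = 0}.
Proof.
move=> mq iq q0.
have iq' y : mu.-integrable `]-oo, y] (EFin \o q).
  have : mu.-integrable `]-oo, y + 1[ (EFin \o q) by exact: integrable_lt.
  by apply: integrableS => //; apply: subset_itvl; rewrite bnd_simp ltrDl.
have loc : locally_integrable [set: R] q.
  split => //; first exact: openT.
  move=> K _ cK.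
  have [M [Mr hM]] := compact_bounded cK.
  have KM : K `<=` `]-oo, M + 1].
    move=> x Kx; rewrite /= in_itv/=; apply: (le_trans (ler_norm x)).
    by apply: (hM (M + 1)) => //; rewrite ltrDl.
  have mK : measurable K by exact: compact_measurable.
  have /integrableP[_ iM] := iq' (M + 1).
  apply: le_lt_trans iM; apply: ge0_subset_integral => //=.
  by apply/measurable_EFinP; apply: measurableT_comp => //; exact: measurable_funTS.
have := FTC1Ny iq' loc.
move=> /aeW; apply => x [dF <-].
have -> : (fun x => \int[mu]_(t in `]-oo, x]) q t) = cst 0.
  apply/funext => y; rewrite -Rintegral_itv_bndo_bndc; last exact: integrable_lt.
  by rewrite -Rintegral_lt.
by rewrite derive1_cst.
Qed.

End zero_primitive.

Section volterra_kernel_pos.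
Context {R : realType}.
Notation mu := (@lebesgue_measure R).
Variable a : R.
Hypotheses (a0 : 0 < a) (a12 : a < 2^-1).

Local Opaque Gamma pw.

Ltac slra := move: a0 a12; lra.

Let a1 : a < 1. Proof. slra. Qed.

Let Ga : 0 < Gamma a.
Proof. by apply: Gamma_gt0; apply/andP; split; slra. Qed.

Let iGa : 0 <= (Gamma a)^-1.
Proof. by rewrite invr_ge0; exact: ltW Ga. Qed.

Let Jp (t s : R) : \bar R :=
  (\int[mu]_v (pw (a - 1) (v - s) * pw a v * (v < t)%R%:R)%:E)%E.

(* K_H / C_1 for H = 1/2 + a, after the integration by parts that removes the
   difference of two terms. *)
Definition KNpos (t s : R) : R :=
  (Gamma a)^-1 * (pw (- a) s * fine (Jp t s)).

Let Jp_ge0 t s : (0 <= Jp t s)%E.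
Proof. by apply: integral_ge0 => v _; rewrite lee_fin !mulr_ge0 ?pw_ge0. Qed.

Let Jp_le t s : 0 < s -> (Jp t s <= (pw a t * (pw a t / a) * (s < t)%R%:R)%:E)%E.
Proof.
move=> s0.
have [ts|st] := leP t s.
  rewrite mulr0 /Jp integral0_eq// => v _.
  have [vs|vs] := leP v s; first by rewrite (pw_le0 _ (_ : v - s <= 0)) ?subr_le0// !mul0r.
  by rewrite ltNge (ltW (le_lt_trans ts vs)) mulr0.
apply: (@le_trans _ _ (\int[mu]_v ((pw a t)%:E *
    (pw (a - 1) (v - s) * (v < t)%R%:R)%:E))%E).
  apply: ge0_le_integral => //.
  - by move=> v _; rewrite lee_fin !mulr_ge0 ?pw_ge0.
  - by meas.
  - by apply: emeasurable_funM => //; meas.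
  - move=> v _; rewrite -EFinM lee_fin.
    have [vt|vt] := ltP v t; last by rewrite !mulr0.
    by rewrite !mulr1 mulrC ler_wpM2r ?pw_ge0// pw_mono// ltW.
rewrite ge0_integralZl_EFin ?pw_ge0//; last 2 first.
- by move=> v _; rewrite lee_fin !mulr_ge0 ?pw_ge0.
- by meas.
rewrite integral_pw_shift_lt// -EFinM lee_fin mulr1 ler_wpM2l ?pw_ge0//.
rewrite ler_pM2r ?invr_gt0//; apply: pw_mono; first exact: ltW.
by rewrite lerBlDr lerDl ltW.
Qed.

Let Jp_fin t s : 0 < s -> (fine (Jp t s))%:E = Jp t s.
Proof.
move=> s0; rewrite fineK// ge0_fin_numE//.
by apply: (le_lt_trans (Jp_le t s0)); rewrite ltry.
Qed.

Lemma KNposE t s : 0 < s -> (KNpos t s)%:E = (((Gamma a)^-1 * pw (- a) s)%:E *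
  \int[mu]_v (pw (a - 1) (v - s) * pw a v * (v < t)%R%:R)%:E)%E.
Proof. by move=> s0; rewrite -/(Jp t s) -(Jp_fin t s0) -EFinM /KNpos mulrA. Qed.

Lemma KNpos_ge0 t s : 0 <= KNpos t s.
Proof. by rewrite /KNpos mulr_ge0// mulr_ge0 ?pw_ge0// fine_ge0. Qed.

Lemma KNpos_le0 t s : s <= 0 -> KNpos t s = 0.
Proof. by move=> s0; rewrite /KNpos (pw_le0 _ s0) mul0r mulr0. Qed.

Lemma KNpos_supp t s : t <= s -> KNpos t s = 0.
Proof.
move=> ts; have [s0|s0] := leP s 0; first exact: KNpos_le0.
suff JE : Jp t s = 0%E by rewrite /KNpos JE mulr0 mulr0.
apply/eqP; rewrite eq_le Jp_ge0 andbT (le_trans (Jp_le t s0))//.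
by rewrite ltNge ts mulr0.
Qed.

Lemma measurable_KNpos : measurable_fun [set: R * R] (fun z => KNpos z.1 z.2).
Proof.
have mJ : measurable_fun [set: R * R] (fun z => Jp z.1 z.2).
  apply: (@measurable_fun_integral _ (R * R)%type R
    (fun w v => (pw (a - 1) (v - w.2) * pw a v * (v < w.1)%R%:R)%:E)).
  - have m11 : measurable_fun [set: (R * R) * R] (fun w => w.1.1).
      exact: (measurableT_comp measurable_fst).
    have m12 : measurable_fun [set: (R * R) * R] (fun w => w.1.2).
      exact: (measurableT_comp measurable_snd).
    by meas.
  - by move=> w v; rewrite lee_fin !mulr_ge0 ?pw_ge0.
have mfJ : measurable_fun [set: R * R] (fun z => fine (Jp z.1 z.2)).
  exact: (measurableT_comp (fine_measurable measurableT)).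
by rewrite /KNpos; meas.
Qed.

Lemma measurable_KNpos2 t : measurable_fun [set: R] (KNpos t).
Proof.
by apply: (measurableT_comp measurable_KNpos (g := fun s => (t, s))); exact: measurable_pair1.
Qed.

Lemma KNpos_L2p t : L2p (KNpos t).
Proof.
apply: (@L2p_le _ (fun s => ((Gamma a)^-1 * (pw a t * (pw a t / a))) *
   (pw (- a) s * (s < t)%R%:R))).
- exact: measurable_KNpos2.
- by apply: L2pZ; apply: L2p_pw_lt; rewrite (ltW a0) a12.
- move=> s; have [s0|s0] := leP s 0; first by rewrite KNpos_le0// normr0.
  rewrite ger0_norm ?KNpos_ge0// (le_trans _ (ler_norm _))//.
  rewrite /KNpos -mulrA ler_wpM2l// mulrCA ler_wpM2l ?pw_ge0//.
  by have h := Jp_le t s0; rewrite -(Jp_fin t s0) lee_fin in h.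
Qed.

(* With v = s + w, the kernel is a multiple of the integral of
   w^(a - 1) (1 + w / s)^a over 0 < w < t - s. *)
Lemma KNpos_anti t s1 s2 : 0 < s1 -> s1 <= s2 -> KNpos t s2 <= KNpos t s1.
Proof.
move=> s10 s12; have s20 := lt_le_trans s10 s12.
have JE s : 0 < s -> (pw (- a) s * fine (Jp t s))%:E = (\int[mu]_w (pw (a - 1) w *
    (pw (- a) s * pw a (w + s)) * (w + s < t)%R%:R)%:E)%E.
  move=> s0; rewrite EFinM Jp_fin// /Jp -ge0_integralZl_EFin ?pw_ge0//; last 2 first.
  - by move=> v _; rewrite lee_fin !mulr_ge0 ?pw_ge0.
  - by meas.
  rewrite -(@ge0_integral_shift _ (fun v => (pw (- a) s)%:E *
    (pw (a - 1) (v - s) * pw a v * (v < t)%R%:R)%:E)%E s).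
  - apply: eq_integral => w _; rewrite -EFinM; congr EFin; rewrite addrK.
    by rewrite !mulrA; congr (_ * _ * _); rewrite mulrC.
  - by apply: emeasurable_funM => //; meas.
  - by move=> v; rewrite -EFinM lee_fin !mulr_ge0 ?pw_ge0.
apply: (ler_wpM2l iGa).
suff : ((pw (- a) s2 * fine (Jp t s2))%:E <= (pw (- a) s1 * fine (Jp t s1))%:E)%E.
  by rewrite lee_fin.
rewrite [X in (X <= _)%E](JE s2 s20) [X in (_ <= X)%E](JE s1 s10).
apply: ge0_le_integral => //.
- by move=> v _; rewrite lee_fin !mulr_ge0 ?pw_ge0.
- by meas.
- by meas.
- move=> w _; rewrite lee_fin.
  have [w0|w0] := leP w 0; first by rewrite !(pw_le0 _ w0) !mul0r.
  apply: ler_pM; rewrite ?mulr_ge0 ?pw_ge0//; last first.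
    rewrite ler_nat; case: (ltP (w + s2) t) => // h.
    by rewrite (le_lt_trans _ h)// lerD2l.
  rewrite ler_wpM2l ?pw_ge0//.
  have ws1 : 0 < w + s1 by rewrite addr_gt0.
  have ws2 : 0 < w + s2 by rewrite addr_gt0.
  have h : pw a (w + s2) * pw a s1 <= pw a (w + s1) * pw a s2.
    have u1 := ltW ws1; have u2 := ltW ws2; have v1 := ltW s10; have v2 := ltW s20.
    rewrite !pwE// -!powRM//.
    apply: ge0_ler_powR; rewrite ?nnegrE ?mulr_ge0//; first exact: ltW.
    by rewrite !mulrDl [s1 * s2]mulrC lerD2r ler_pM2l.
  have p1 := pwV a s10; have p2 := pwV a s20.
  have -> : pw (- a) s2 * pw a (w + s2) = (pw (- a) s2 * pw (- a) s1) * (pw a (w + s2) * pw a s1).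
    by rewrite -[LHS]mul1r -p1; ring.
  have -> : pw (- a) s1 * pw a (w + s1) = (pw (- a) s2 * pw (- a) s1) * (pw a (w + s1) * pw a s2).
    by rewrite -[LHS]mul1r -p2; ring.
  by rewrite ler_wpM2l ?mulr_ge0 ?pw_ge0.
Qed.

Section against.
Variable chi : R -> R.
Hypothesis Lchi : L2p chi.

(** This is K_{0+}^H applied to [chi], divided by C_1. Since [t] enters [KNpos] only as the upper
    end of the integral over [v], it is the density in [t] of the integral of [KNpos a t s * chi s]
    over [s]. *)
Definition potential_pos (v : R) : R :=
  (Gamma a)^-1 * (pw a v * \int[mu]_s (pw (a - 1) (v - s) * (pw (- a) s * chi s))).

Let F (t s v : R) : R := (Gamma a)^-1 * (pw a v * (pw (a - 1) (v - s) *
  (pw (- a) s * chi s))) * (v < t)%R%:R.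

Let mchi : measurable_fun setT chi. Proof. by case: Lchi. Qed.

Let mF t : measurable_fun [set: R * R] (fun z => F t z.1 z.2).
Proof. by rewrite /F; meas. Qed.

Let iF t : (\int[mu]_s \int[mu]_v `|F t s v|%:E < +oo)%E.
Proof.
rewrite [ltLHS](_ : _ = \int[mu]_s `|(KNpos t s * chi s)%:E|)%E.
  by case/integrableP : (L2p_mul (KNpos_L2p t) Lchi).
apply: eq_integral => s _; rewrite /= normrM (ger0_norm (KNpos_ge0 _ _)).
have [s0|s0] := leP s 0.
  rewrite KNpos_le0// mul0r integral0_eq// => v _.
  by rewrite /F (pw_le0 _ s0) !(mul0r, mulr0) normr0.
rewrite /KNpos; transitivity (((Gamma a)^-1 * (pw (- a) s * `|chi s|))%:E * Jp t s)%E; last first.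
  rewrite -[X in (_ * X)%E](Jp_fin t s0) -EFinM; congr EFin.
  by move: (Gamma _) (fine _) => x y; ring.
rewrite /Jp -ge0_integralZl_EFin ?mulr_ge0 ?pw_ge0//.
- apply: eq_integral => v _; rewrite -EFinM; congr EFin; rewrite /F !normrM.
  rewrite !(ger0_norm (pw_ge0 _ _)) (ger0_norm iGa) (ger0_norm (ler0n _ _)).
  by move: (Gamma _) (pw a v) => x y; ring.
- by move=> v _; rewrite lee_fin !mulr_ge0 ?pw_ge0.
- by meas.
Qed.

Let FG t v : \int[mu]_s F t s v = potential_pos v * (v < t)%R%:R.
Proof.
rewrite /potential_pos /F; have [vt|vt] := ltP v t; last first.
  by rewrite mulr0; under eq_Rintegral do rewrite mulr0; rewrite /Rintegral integral0.
rewrite mulr1; under eq_Rintegral do rewrite mulr1.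
have [v0|v0] := leP v 0.
  by rewrite (pw_le0 _ v0) mul0r mulr0; under eq_Rintegral do rewrite mul0r mulr0;
    rewrite /Rintegral integral0.
rewrite mulrA -RintegralZlT; last by meas.
by apply: eq_Rintegral => s _; rewrite !mulrA.
Qed.

Lemma integrable_potential_pos t :
  mu.-integrable setT (EFin \o (fun v => potential_pos v * (v < t)%R%:R)).
Proof.
have := integrable_Rfubini_F (measurable_Rswap (@mF t)) (finite_Rswap (@mF t) (@iF t)).
by congr (is_true (mu.-integrable _ _)); apply/funext => v /=; rewrite FG.
Qed.

Lemma KNpos_potential t :
  \int[mu]_s (KNpos t s * chi s) = \int[mu]_v (potential_pos v * (v < t)%R%:R).
Proof.
under [RHS]eq_Rintegral do rewrite -FG.
rewrite -Rfubini//.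
apply: eq_Rintegral => s _.
have [s0|s0] := leP s 0.
  rewrite KNpos_le0// mul0r; under eq_Rintegral do rewrite /F (pw_le0 _ s0) mul0r !mulr0 mul0r.
  by rewrite /Rintegral integral0.
transitivity (((Gamma a)^-1 * (pw (- a) s * chi s)) *
    \int[mu]_v (pw (a - 1) (v - s) * pw a v * (v < t)%R%:R)).
  by rewrite /KNpos /Rintegral -/(Jp t s); move: (Gamma _) (fine _) => x y; ring.
rewrite -RintegralZlT; last by meas.
apply: eq_Rintegral => v _; rewrite /F.
by move: (Gamma _) (pw a v) => x y; ring.
Qed.

End against.
End volterra_kernel_pos.

(** * The kernel for both ranges of the Hurst index *)

Section volterra_kernel.
Context {R : realType}.
Notation mu := (@lebesgue_measure R).
Local Opaque Gamma pw.

(** K_H divided by C_1 and extended by 0 outside [0 < s < t], so that all integrals run over the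
    whole line and no factor C_1 enters the kernel estimates. *)
Definition KN (H t s : R) : R :=
  if H < 2^-1 then KNneg (2^-1 - H) t s else KNpos (H - 2^-1) t s.

Definition cut (f : R -> R) (x : R) : R := (0 < x)%R%:R * f x.

Lemma Rintegral_oo (f : R -> R) (a b : R) :
  \int[mu]_(x in `]a, b[) f x = \int[mu]_x (f x * ((a < x)%R%:R * (x < b)%R%:R)).
Proof. by rewrite /Rintegral integral_oo_natr. Qed.

Section parameter.
Variable H : R.
Hypotheses (H0 : 0 < H) (H1 : H < 1) (Hh : H != 2^-1).

Lemma hurst_cases : (H < 2^-1 /\ 0 < 2^-1 - H < 2^-1) \/
  ((H < 2^-1) = false /\ 0 < H - 2^-1 < 2^-1).
Proof.
have [h|h|/eqP] := ltgtP H 2^-1; last by rewrite (negbTE Hh).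
- by left; split => //; apply/andP; split; move: H0 H1 h; lra.
- by right; split => //; apply/andP; split; move: H0 H1 h; lra.
Qed.

Lemma C1_gt0 : 0 < C1 H.
Proof.
have G x : 0 < x <= 2 -> 0 < Gamma x by exact: Gamma_gt0.
rewrite /C1 sqrtr_gt0 divr_gt0 ?mulr_gt0 ?G//; apply/andP; split; move: H0 H1; lra.
Qed.

Lemma KN_ge0 t s : 0 <= KN H t s.
Proof.
rewrite /KN; have [[-> /andP[b0 b1]]|[-> /andP[b0 b1]]] := hurst_cases.
- exact: KNneg_ge0.
- exact: KNpos_ge0.
Qed.

Lemma KN_le0 t s : s <= 0 -> KN H t s = 0.
Proof. by move=> s0; rewrite /KN; case: ifP => _; [exact: KNneg_le0|exact: KNpos_le0]. Qed.

Lemma KN_supp t s : t <= s -> KN H t s = 0.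
Proof.
move=> ts; rewrite /KN; have [[-> /andP[b0 b1]]|[-> /andP[b0 b1]]] := hurst_cases.
- exact: KNneg_supp.
- exact: KNpos_supp.
Qed.

Lemma KN_L2p t : L2p (KN H t).
Proof.
rewrite /KN; have [[-> /andP[b0 b1]]|[-> /andP[b0 b1]]] := hurst_cases.
- exact: KNneg_L2p.
- exact: KNpos_L2p.
Qed.

Lemma powR_div (x y p : R) : 0 < x -> 0 < y -> (x / y) `^ p = pw p x * pw (- p) y.
Proof.
move=> x0 y0; rewrite !pwE// powRM ?invr_ge0 ?(ltW x0) ?(ltW y0)//; congr (_ * _).
by rewrite -powR_inv1 ?(ltW y0)// -powRrM mulN1r.
Qed.

(** For [H < 2^-1] only exponents are rewritten. For [H > 2^-1] put [a = H - 2^-1]: integration by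
    parts expresses the boundary term of [KH] as [a] times the sum of the integrals of [X] and [Y],
    the integral of [Y] cancels, and [Gamma (a + 1) = a * Gamma a] absorbs the factor [a]. *)
Lemma KH_KN t s : 0 < s -> s < t -> KH H t s = C1 H * KN H t s.
Proof.
move=> s0 st; have t0 := lt_trans s0 st.
have ts0 : 0 < t - s by rewrite subr_gt0.
rewrite /KH /KN powR_div//.
have [[-> /andP[b0 b1]]|[-> /andP[b0 b1]]] := hurst_cases.
- pose b := 2^-1 - H; rewrite -/b.
  have -> : H + 2^-1 = 1 - b by rewrite /b; field.
  have -> : H - 2^-1 = - b by rewrite /b; field.
  have -> : H - 3 / 2 = - b - 1 by rewrite /b; field.
  have -> : \int[mu]_(u in `]s, t[) ((u - s) `^ (- b) * u `^ (- b - 1)) =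
      fine (\int[mu]_v (pw (- b) (v - s) * pw (- b - 1) v * (v < t)%R%:R)%:E)%E.
    rewrite Rintegral_oo; congr fine; apply: eq_integral => v _; congr EFin.
    have [sv|vs] := ltP s v; last first.
      by rewrite (pw_le0 _ (_ : v - s <= 0)) ?subr_le0// !mul0r mulr0.
    by rewrite mul1r !pwE// ?subr_gt0// (lt_trans s0).
  rewrite opprK /KNneg -(pwE _ s0) -(pwE _ ts0).
  move: (fine _) (Gamma _)^-1 (C1 H) (pw _ _) (pw _ _) (pw _ _) => x y z p q r.
  ring.
- pose a := H - 2^-1; rewrite -/a.
  have a0 : 0 < a by [].
  have -> : H + 2^-1 = a + 1 by rewrite /a; field.
  have -> : 2^-1 - H = - a by rewrite /a; field.
  have -> : H - 3 / 2 = a - 1 by rewrite /a; field.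
  rewrite Gamma_add1; last by apply/andP; split => //; move: b1; rewrite -/a; lra.
  pose X v := pw (a - 1) (v - s) * pw a v * (v < t)%R%:R.
  pose Y v := pw a (v - s) * pw (a - 1) v * ((s < v)%R%:R * (v < t)%R%:R).
  have mX : measurable_fun setT X by rewrite /X; meas.
  have mY : measurable_fun setT Y by rewrite /Y; meas.
  have X0 v : 0 <= X v by rewrite /X !mulr_ge0 ?pw_ge0.
  have Y0 v : 0 <= Y v by rewrite /Y !mulr_ge0 ?pw_ge0.
  have XY := integral_pw_by_parts a0 s0 (ltW st).
  have {}XY : (a%:E * (\int[mu]_v (X v)%:E + \int[mu]_v (Y v)%:E) =
      (pw a (t - s) * pw a t)%:E)%E.
    rewrite -XY -ge0_integralD//; last 4 first.
    - by move=> v _; rewrite lee_fin.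
    - exact/measurable_EFinP.
    - by move=> v _; rewrite lee_fin.
    - exact/measurable_EFinP.
    rewrite -ge0_integralZl_EFin ?(ltW a0)//; last 2 first.
    - by move=> v _; rewrite adde_ge0// lee_fin.
    - by apply: emeasurable_funD; exact/measurable_EFinP.
    apply: eq_integral => v _; rewrite -EFinD -EFinM; congr EFin; rewrite /X /Y.
    have [sv|vs] := ltP s v; first by
      rewrite mul1r; move: (_%:R) (pw _ _) (pw _ _) (pw _ _) (pw _ _) => *; ring.
    by rewrite !(pw_le0 _ (_ : v - s <= 0)) ?subr_le0// !(mul0r, mulr0) addr0 mulr0.
  have XYfin : (\int[mu]_v (X v)%:E + \int[mu]_v (Y v)%:E)%E \is a fin_num.
    have : ((a%:E * (\int[mu]_v (X v)%:E + \int[mu]_v (Y v)%:E))%E \is a fin_num) by rewrite XY.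
    case: (_ + _)%E => //=.
      by rewrite gt0_muley ?lte_fin.
    by rewrite gt0_muleNy ?lte_fin.
  have intX0 : (0 <= \int[mu]_v (X v)%:E)%E by apply: integral_ge0 => v _; rewrite lee_fin.
  have intY0 : (0 <= \int[mu]_v (Y v)%:E)%E by apply: integral_ge0 => v _; rewrite lee_fin.
  move: XYfin; rewrite fin_numD => /andP[fX fY].
  have {}XY : a * (\int[mu]_v X v + \int[mu]_v Y v) = pw a (t - s) * pw a t.
    have /= <- := congr1 fine XY.
    have sfin : (\int[mu]_v (X v)%:E + \int[mu]_v (Y v)%:E)%E \is a fin_num.
      by rewrite fin_numD fX fY.
    by rewrite (fineM _ sfin)// (fineD fX fY).
  have -> : \int[mu]_(u in `]s, t[) ((u - s) `^ a * u `^ (a - 1)) = \int[mu]_v Y v.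
    rewrite Rintegral_oo; apply: eq_Rintegral => v _; rewrite /Y.
    have [sv|vs] := ltP s v; last by rewrite !mul0r !mulr0.
    by rewrite !pwE// ?subr_gt0// (lt_trans s0).
  have -> : KNpos a t s = (Gamma a)^-1 * (pw (- a) s * \int[mu]_v X v) by [].
  rewrite -(pwE _ s0) -(pwE _ ts0).
  have -> : pw a t * pw (- a) s * pw a (t - s) =
      pw (- a) s * (a * (\int[mu]_v X v + \int[mu]_v Y v)) by rewrite XY; ring.
  have Ga : Gamma a != 0.
    by rewrite gt_eqF// Gamma_gt0//; apply/andP; split => //; move: b1; rewrite -/a; lra.
  have r0 := gt_eqF a0.
  move: (\int[mu]_v X v) (\int[mu]_v Y v) (Gamma _) (C1 H) (pw _ _) Ga => x y z p q z0.
  by field; rewrite z0 r0.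
Qed.

End parameter.
End volterra_kernel.

(** * Representation of primitives by the kernel *)

Section representation.
Context {R : realType}.
Notation mu := (@lebesgue_measure R).
Local Opaque Gamma pw KNneg KNpos.
Implicit Types f phi : R -> R.

Lemma cutE f x : 0 < x -> cut f x = f x.
Proof. by move=> x0; rewrite /cut x0 mul1r. Qed.

Lemma cut_le0 f x : x <= 0 -> cut f x = 0.
Proof. by move=> x0; rewrite /cut ltNge x0 mul0r. Qed.

Lemma cut_restrict f : cut f = f \_ `]0, +oo[.
Proof.
apply/funext => x; rewrite patchE; case: ifPn => [|/negP h].
  by rewrite inE/= in_itv/= andbT => x0; rewrite cutE.
rewrite cut_le0// leNgt; apply/negP => x0; apply: h.
by rewrite inE/= in_itv/= x0.
Qed.

Lemma measurable_cut f : measurable_fun Rplus f -> measurable_fun setT (cut f).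
Proof.
move=> mf; rewrite cut_restrict; apply/(measurable_restrictT _ _).1 => //.
apply: measurable_funS mf; first exact: measurable_itv.
by rewrite /Rplus; apply: subset_itvr; rewrite bnd_simp.
Qed.

Lemma Lp_norm_sqr f : measurable_fun Rplus f ->
  Lp_norm Rplus 2 f = ((\int[mu]_x (cut f x ^+ 2)%:E) `^ (2^-1))%E.
Proof.
move=> mf; rewrite /Lp_norm unlock; congr (_ `^ _)%E.
have mr : measurable_fun setT (f \_ Rplus).
  by apply/(measurable_restrictT _ _).1 => //; exact: measurable_itv.
transitivity (\int[mu]_x ((f \_ Rplus) x ^+ 2)%:E)%E.
  apply: eq_integral => x _ /=.
  by rewrite powR_mulrn// real_normK// num_real.
apply: ae_eq_integral => //.
- by apply/measurable_EFinP; exact: measurable_funX.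
- by apply/measurable_EFinP; apply: measurable_funX; exact: measurable_cut.
- apply: ae_eqI; apply: aeW (ae_neq 0) _ => x x0; congr (_ ^+ _)%:E.
  have [xlt0|xgt0|/eqP] := ltgtP x 0; last by rewrite (negbTE x0).
  + rewrite cut_le0 ?ltW// patchE memNset// /Rplus /= in_itv/= andbT.
    by apply/negP; rewrite -ltNge.
  + by rewrite cutE// patchE mem_set// /Rplus /= in_itv/= ltW.
Qed.

Lemma in_L2_L2p f : in_L2 f -> L2p (cut f).
Proof.
move=> [mf]; rewrite Lp_norm_sqr// => h; apply: L2p_sqr_ge0.
- exact: measurable_cut.
- by move=> x; exact: cut_le0.
- move: h; have : (0 <= \int[mu]_x (cut f x ^+ 2)%:E)%E.
    by apply: integral_ge0 => x _; rewrite lee_fin sqr_ge0.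
  case: (\int[mu]_x (cut f x ^+ 2)%:E)%E => [r||]//= _.
    by move=> _; rewrite ltry.
  by rewrite invr_eq0 pnatr_eq0.
Qed.

Section parameter.
Variable H : R.
Hypotheses (H0 : 0 < H) (H1 : H < 1) (Hh : H != 2^-1).

Lemma Rintegral_KH phi t : measurable_fun Rplus phi ->
  \int[mu]_(s in `]0, t[) (KH H t s * phi s) =
  C1 H * \int[mu]_s (KN H t s * cut phi s).
Proof.
move=> mphi.
have mKN : measurable_fun setT (KN H t) by case: (KN_L2p H0 H1 Hh t).
have mcut := measurable_cut mphi.
rewrite -RintegralZlT; last by meas.
rewrite Rintegral_oo; apply: eq_Rintegral => s _.
have [s0|s0] := ltP 0 s; last by rewrite mul0r mulr0 KN_le0// mul0r mulr0.
have [st|ts] := ltP s t; last by rewrite !mulr0 KN_supp// mul0r mulr0.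
by rewrite (KH_KN H0 H1 Hh s0 st) !mulr1 cutE// mulrA.
Qed.

Lemma rkhs_reprE f phi : rkhs_repr H f phi <->
  in_L2 phi /\ forall t, 0 <= t -> f t = C1 H * \int[mu]_s (KN H t s * cut phi s).
Proof.
split=> -[Lphi E]; split => // t t0; rewrite E// Rintegral_KH//; by case: Lphi.
Qed.

Lemma primitive_cut f t : mu.-integrable setT (EFin \o (fun v => cut f v * (v < t)%R%:R)) ->
  primitive f t = \int[mu]_v (cut f v * (v < t)%R%:R).
Proof.
move=> icut; have E : \int[mu]_v (cut f v * (v < t)%R%:R) = \int[mu]_(s in `]0, t[) f s.
  rewrite Rintegral_oo; apply: eq_Rintegral => v _.
  by rewrite /cut mulrAC mulrC.
have iot : mu.-integrable `]0, t[ (EFin \o f).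
  have iot' : mu.-integrable `]0, t[ (EFin \o (fun v => cut f v * (v < t)%R%:R)).
    exact: integrableS icut.
  apply: eq_integrable iot' => // v; rewrite inE/= in_itv/= => /andP[v0 vt].
  by rewrite cutE// vt mulr1.
rewrite E /primitive /Rintegral integral_itv_bndoo//.
exact: measurable_int iot.
Qed.

Lemma L2p_integrable_lt chi t : L2p chi ->
  mu.-integrable setT (EFin \o (fun v => chi v * (v < t)%R%:R)).
Proof.
move=> Lchi; have Lp := @L2p_pw_lt R 0 t.
have p0 : 0 <= (0 : R) < 2^-1 by rewrite lexx invr_gt0 ltr0n.
have := L2p_mul Lchi (Lp p0); congr (is_true (mu.-integrable _ _)).
apply/funext => v /=; rewrite oppr0 pw0E.
case: (ltP 0 v) => v0; first by rewrite mul1r.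
by case: Lchi => _ -> // _; rewrite !mul0r.
Qed.

Lemma ftc_cut (F F' : R -> R) t : L2p (cut F') -> F 0 = 0 -> right_derivative F F' ->
  (0 < t -> {within `[0, t], continuous F}) -> 0 <= t ->
  \int[mu]_x (cut F' x * (x < t)%R%:R) = F t.
Proof.
move=> LF' F0 dF cF; have iF := L2p_integrable_lt t LF'.
have cutK : cut (cut F') = cut F'.
  by apply/funext => x; rewrite {1}/cut; case: (ltP 0 x) => x0; rewrite ?mul1r// mul0r cut_le0.
have := iF; rewrite -[in X in X -> _]cutK => /primitive_cut; rewrite cutK => <-.
rewrite le_eqVlt => /orP[/eqP <-|t0].
  by rewrite /primitive F0 set_itv1 /Rintegral integral_set1.
rewrite /primitive (@ftc _ F (cut F') 0 t)//.
- by rewrite F0 subr0.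
- have iF1 : mu.-integrable `[0, t] (EFin \o (fun v => cut F' v * (v < t + 1)%R%:R)).
    by apply: integrableS (L2p_integrable_lt (t + 1) LF').
  apply: eq_integrable iF1 => // v; rewrite inE/= in_itv/= => /andP[v0 vt].
  by rewrite (le_lt_trans vt) ?ltrDl// mulr1.
- exact: cF.
- by move=> x /andP[x0 _]; rewrite cutE//; exact: dF.
Qed.

(** The two ranges work in opposite directions. For [H < 2^-1], [phi] is a weighted fractional
    integral of [f'], and Fubini with [integral_KNneg] returns [f']. For [H > 2^-1], [f'] is itself
    a weighted fractional integral of [phi], namely [C1 H] times [potential_pos], whose primitive is
    known. *)
Lemma primitive_Kleft_star f' phi : in_L2 f' -> in_L2 phi ->
  Kleft_star H f' phi -> forall t, 0 <= t ->
  primitive f' t = C1 H * \int[mu]_s (KN H t s * cut phi s).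
Proof.
move=> /in_L2_L2p Lf' /in_L2_L2p Lphi [k Ik phik] t t0.
have mf' : measurable_fun setT (cut f') by case: Lf'.
have mphi : measurable_fun setT (cut phi) by case: Lphi.
have C10 := C1_gt0 H0 H1.
rewrite primitive_cut; last exact: L2p_integrable_lt.
move: Ik phik; rewrite /I_left /KN.
have [[Hlt /andP[b0 b1]]|[Hgt /andP[b0 b1]]] := hurst_cases H0 H1 Hh.
- rewrite Hlt.
  pose b := 2^-1 - H; rewrite -/b in b0 b1 *.
  have -> : H - 2^-1 = - b by rewrite /b; field.
  rewrite b0 => Ik phik.
  have Gb : 0 < Gamma b by apply: Gamma_gt0; apply/andP; split => //; move: b1; lra.
  have iC : 0 <= (C1 H)^-1 by rewrite invr_ge0 ltW.
  have iG : 0 <= (Gamma b)^-1 by rewrite invr_ge0 ltW.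
  have G1b : 0 < Gamma (1 - b).
    by apply: Gamma_gt0; apply/andP; split; move: b0 b1; lra.
  have mKNt := @measurable_KNneg2 R b t.
  have KNt0 : forall s, 0 <= KNneg b t s by move=> s; exact: KNneg_ge0.
  have KNt_le0 : forall s, s <= 0 -> KNneg b t s = 0 by move=> s; exact: KNneg_le0.
  have intKNt : forall u, 0 < u ->
    (\int[mu]_s (pw (b - 1) (s - u) * (pw (- b) s * KNneg b t s))%:E =
   (Gamma b * (pw (- b) u * (u < t)%R%:R))%:E)%E by move=> u; exact: integral_KNneg.
  move: (KNneg b t) mKNt KNt0 KNt_le0 intKNt => N mN N0 N_le0 intN.
  (* Integrated over [u] this is [N s * phi s] for almost every [s > 0]; integrated over [s] it is,
     by [intN], [(C1 H)^-1 * f' u] on [(0, t)]. *)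
  pose F s u := (C1 H)^-1 * (Gamma b)^-1 *
    (pw (b - 1) (s - u) * (pw (- b) s * N s)) * (pw b u * cut f' u).
  have mF : measurable_fun [set: R * R] (fun z => F z.1 z.2).
    have mN' : measurable_fun [set: R * R] (fun z => N z.1).
      by apply: measurableT_comp => //; exact: measurable_fst.
    have mft' : measurable_fun [set: R * R] (fun z => cut f' z.2).
      by apply: measurableT_comp => //; exact: measurable_snd.
    by rewrite /F; meas.
  have KNint (u : R) : \int[mu]_s (pw (b - 1) (s - u) * (pw (- b) s * N s)) * pw b u =
      Gamma b * ((0 < u)%R%:R * (u < t)%R%:R).
    have [u0|u0] := ltP 0 u; last by rewrite (pw_le0 _ u0) mulr0 mul0r mulr0.
    rewrite /Rintegral intN//= mul1r -!mulrA; congr (_ * _).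
    by rewrite mulrCA pwV// mulr1.
  have mI (u : R) : measurable_fun setT (fun s : R => pw (b - 1) (s - u) * (pw (- b) s * N s)).
    by meas.
  have FE u : (\int[mu]_s `|F s u|%:E)%E = ((C1 H)^-1 * `|cut f' u * (u < t)%R%:R|)%:E.
    have [u0|u0] := leP u 0.
      rewrite integral0_eq => [|s _].
        by rewrite cut_le0// mul0r normr0 mulr0.
      by rewrite /F (pw_le0 _ u0) mul0r mulr0 normr0.
    transitivity (\int[mu]_s (((C1 H)^-1 * (Gamma b)^-1 * (pw b u * `|cut f' u|))%:E *
        (pw (b - 1) (s - u) * (pw (- b) s * N s))%:E))%E.
      apply: eq_integral => s _; rewrite -EFinM; congr EFin; rewrite /F.
      rewrite (normrM _ (pw b u * _)) (normrM (pw b u)) (ger0_norm (pw_ge0 b u)) ger0_norm.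
        by rewrite mulrAC.
      by rewrite !mulr_ge0 ?pw_ge0.
    rewrite ge0_integralZl_EFin//; last 3 first.
    + by move=> s _; rewrite lee_fin !mulr_ge0 ?pw_ge0 ?N0.
    + by apply/measurable_EFinP; refine (mI u).
    + by rewrite !mulr_ge0 ?pw_ge0.
    rewrite intN// -EFinM (normrM (cut f' u)) (ger0_norm (ler0n _ _)); congr EFin.
    have := pwV b u0; have := lt0r_neq0 Gb; have := lt0r_neq0 C10.
    move: (Gamma b) (C1 H) (pw b u) (pw (- b) u) ((u < t)%R%:R) `|cut f' u| => g c x y z w c0 g0 yx.
    by rewrite -[RHS]mul1r -yx; field; rewrite c0 g0.
  have icut := L2p_integrable_lt t Lf'.
  have iF' : (\int[mu]_u \int[mu]_s `|F s u|%:E < +oo)%E.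
    under eq_integral do rewrite FE.
    have /integrableP[_] := RintegrableZ measurableT (C1 H)^-1 icut.
    apply: le_lt_trans; apply: ge0_le_integral => //.
    + by move=> u _; rewrite lee_fin mulr_ge0.
    + by meas.
    + by rewrite /=; meas.
    + by move=> u _; rewrite lee_fin (normrM (C1 H)^-1) (ger0_norm iC).
  have iF : (\int[mu]_s \int[mu]_u `|F s u|%:E < +oo)%E.
    by rewrite tonelli//; meas.
  transitivity (C1 H * \int[mu]_s \int[mu]_u F s u).
    rewrite Rfubini// -RintegralZlT; last first.
      apply: Rintegrable_measurable.
      exact: integrable_Rfubini_F (measurable_Rswap mF) iF'.
    apply: eq_Rintegral => u _.
    have [u0|u0] := leP u 0.
      rewrite cut_le0// mul0r; under eq_Rintegral do rewrite /F (pw_le0 _ u0) mul0r mulr0.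
      by rewrite /Rintegral integral0 mulr0.
    transitivity (C1 H * \int[mu]_s ((C1 H)^-1 * (Gamma b)^-1 * (pw b u * cut f' u) *
        (pw (b - 1) (s - u) * (pw (- b) s * N s)))); last first.
      by congr (_ * _); apply: eq_Rintegral => s _; rewrite /F mulrAC.
    rewrite RintegralZlT//.
    have := KNint u; rewrite u0 mul1r.
    have := lt0r_neq0 Gb; have := lt0r_neq0 C10.
    move: (Rintegral _ _ _) (Gamma b) (C1 H) (pw b u) => w g c x c0 g0 wx.
    transitivity (g^-1 * (w * x) * cut f' u); last by field; rewrite c0 g0.
    by rewrite wx; field.
  congr (_ * _); apply: ae_eq_Rintegral.
  + apply: Rintegrable_measurable; exact: integrable_Rfubini_F.
  + by meas.
  apply: aeW (aeI Ik phik) _ => s [Iks phiks].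
  have [s0|s0] := leP s 0.
    rewrite N_le0// mul0r; under eq_Rintegral do rewrite /F N_le0// !mulr0 mul0r.
    by rewrite /Rintegral integral0.
  rewrite cutE// phiks//; have [_ ->] := Iks s0.
  rewrite Rintegral_oo.
  transitivity (\int[mu]_u (((C1 H)^-1 * (Gamma b)^-1 * (pw (- b) s * N s)) *
    (pw (b - 1) (s - u) * (pw b u * cut f' u)))).
    apply: eq_Rintegral => u _; rewrite /F.
    by move: (Gamma b) (C1 H) (N s) => g c w; ring.
  rewrite RintegralZlT; last by meas.
  rewrite -(pwE _ s0).
  have -> : \int[mu]_x (pw (b - 1) (s - x) * (pw b x * cut f' x)) =
    \int[mu]_x ((s - x) `^ (b - 1) * (x `^ b * f' x) * ((0 < x)%R%:R * (x < s)%R%:R)).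
    apply: eq_Rintegral => u _.
    have [u0|u0] := ltP 0 u; last by rewrite cut_le0// mul0r !mulr0.
    have [us|su] := ltP u s; last by rewrite (pw_le0 _ (_ : s - u <= 0)) ?subr_le0// mul0r !mulr0.
    by rewrite cutE// !mulr1 !pwE// subr_gt0.
  by move: (Rintegral _ _ _) (Gamma b) (C1 H) (N s) => w g c x; ring.
- rewrite Hgt.
  pose a := H - 2^-1; rewrite -/a in b0 b1 *.
  have -> : 2^-1 - H = - a by rewrite /a; field.
  have -> : (0 < - a) = false by apply/negbTE; rewrite -leNgt oppr_le0 ltW.
  rewrite opprK => -[_ Ik] phik.
  rewrite (KNpos_potential b0 b1 Lphi) -RintegralZlT; last first.
    exact: Rintegrable_measurable (integrable_potential_pos b0 b1 Lphi t).
  apply: ae_eq_Rintegral.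
  + by meas.
  + have := Rintegrable_measurable (integrable_potential_pos b0 b1 Lphi t).
    by move=> mp; meas.
  apply: aeW Ik _ => v Ikv; rewrite mulrA; congr (_ * _).
  have [v0|v0] := leP v 0.
    by rewrite cut_le0// /potential_pos (pw_le0 _ v0) mul0r !mulr0.
  have [iv Ev] := Ikv v0.
  have -> : cut f' v = pw a v * (v `^ (- a) * f' v).
    by rewrite cutE// mulrA -(pwE _ v0) (mulrC (pw a v)) pwV// mul1r.
  rewrite Ev /potential_pos.
  suff -> : \int[mu]_(u in `]0, v[) ((v - u) `^ (a - 1) * k u) =
      C1 H * \int[mu]_s (pw (a - 1) (v - s) * (pw (- a) s * cut phi s)).
    by move: (Gamma a) (C1 H) (Rintegral _ _ _) (pw a v) => g c w x; ring.
  rewrite -RintegralZlT; last by meas.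
  have -> : \int[mu]_x (C1 H * (pw (a - 1) (v - x) * (pw (- a) x * cut phi x))) =
      \int[mu]_(x in `]0, v[) (C1 H * (pw (a - 1) (v - x) * (pw (- a) x * cut phi x))).
    rewrite Rintegral_oo; apply: eq_Rintegral => x _.
    have [x0|x0] := ltP 0 x; last by rewrite (pw_le0 _ x0) !mul0r !mulr0 ?mul0r.
    have [xv|vx] := ltP x v; first by rewrite !mulr1.
    by rewrite (pw_le0 _ (_ : v - x <= 0)) ?subr_le0// !mul0r !mulr0 ?mul0r.
  rewrite /Rintegral; congr fine; apply: ae_eq_integral => //.
  + exact: measurable_int iv.
  + apply: measurable_funTS; apply/measurable_EFinP; by meas.
  apply: aeW phik _ => u phiku; rewrite /= in_itv/= => /andP[u0 uv].
  congr EFin; rewrite cutE// phiku// !pwE ?subr_gt0//.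
  have ua : u `^ (- a) * u `^ a = 1 by rewrite -!(pwE _ u0) pwV.
  have := lt0r_neq0 C10.
  move: (C1 H) (k u) (u `^ a) (u `^ (- a)) (_ `^ _) ua => c w x y z yx c0.
  by rewrite -[LHS]mulr1 -yx; field.
Qed.

End parameter.
End representation.

(** * Layer-cake formula *)

Section layer_cake.
Context {R : realType}.
Notation mu := (@lebesgue_measure R).

Lemma measurable_nonincreasing_cut (k : R -> R) :
  (forall s t, 0 < s -> s <= t -> k t <= k s) -> measurable_fun setT (cut k).
Proof.
move=> k_anti.
have -> : cut k = k \_ `]0, +oo[.
  apply/funext => x; rewrite patchE /cut; case: ifPn => [|/negP]; rewrite inE/= in_itv/= andbT.
    by move=> ->; rewrite mul1r.
  by move=> /negP/negbTE ->; rewrite mul0r.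
apply/(measurable_restrictT _ _).1 => //.
apply: (measurability (@RGenCInfty.G R)) => [|/= _ [_] [r] -> <-].
  exact: RGenCInfty.measurableE.
apply: is_interval_measurable => s t/=.
rewrite !in_itv/= !andbT => -[s0 ks] [t0 kt] u /andP[su ut].
have u0 := lt_le_trans s0 su.
by rewrite !in_itv/= !andbT; split => //; apply: le_trans kt _; exact: k_anti.
Qed.

Lemma integral_lt_natr (c : R) : 0 <= c ->
  (\int[mu]_y ((0 < y)%R%:R * (y < c)%R%:R)%:E = c%:E)%E.
Proof.
move=> c0; transitivity (pw 1 c / 1)%:E; last first.
  have [c0'|c0'] := ltP 0 c; first by rewrite pwE// powRr1// divr1.
  by rewrite pw_le0// mul0r; congr EFin; apply/le_anti/andP.
rewrite -integral_pw_lt//; apply: eq_integral => y _.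
by rewrite subrr pw0E.
Qed.

Variable k : R -> R.
Hypotheses (k_ge0 : forall s, 0 < s -> 0 <= k s)
  (k_anti : forall s t, 0 < s -> s <= t -> k t <= k s)
  (k_bounded : forall y, 0 < y -> exists M, forall s, M < s -> k s <= y).

(** The point 0 is adjoined so that [sup] is never taken over the empty set. *)
Definition superlevel (y : R) : set R := [set s | s = 0 \/ (0 < s /\ y < k s)].

(** The [sigma] of the overview. It is set to 0 for [y <= 0], where the superlevel set may be
    unbounded and [sup] would be a default value. *)
Definition level : R -> R := cut (fun y => sup (superlevel y)).

Lemma has_sup_superlevel y : 0 < y -> has_sup (superlevel y).
Proof.
move=> y0; split; first by exists 0; left.
have [M HM] := k_bounded y0; exists (Num.max M 0) => s [->|[s0 ys]].
  by rewrite le_max lexx orbT.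
by rewrite le_max leNgt; apply/orP; left; apply/negP => /HM; rewrite leNgt ys.
Qed.

Lemma level_ge0 y : 0 <= level y.
Proof.
rewrite /level /cut; case: ltP => y0; last by rewrite mul0r.
by rewrite mul1r; apply: sup_upper_bound; [exact: has_sup_superlevel|left].
Qed.

Lemma le_level y s : 0 < y -> 0 < s -> y < k s -> s <= level y.
Proof.
move=> y0 s0 ys; rewrite /level /cut y0 mul1r.
by apply: sup_upper_bound; [exact: has_sup_superlevel|right].
Qed.

Lemma lt_level y s : 0 < y -> 0 < s -> s < level y -> y < k s.
Proof.
move=> y0 s0; rewrite /level /cut y0 mul1r => ss.
have := sup_adherent (_ : 0 < sup (superlevel y) - s) (has_sup_superlevel y0).
rewrite subr_gt0 => /(_ ss)[r [->|[r0 yr]]]; rewrite subKr => sr.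
  by move: (lt_trans s0 sr); rewrite ltxx.
by apply: lt_le_trans yr _; apply: k_anti => //; exact: ltW.
Qed.

Lemma measurable_level : measurable_fun setT level.
Proof.
apply: measurable_nonincreasing_cut => s t s0 st.
apply: le_sup.
- move=> r [->|[r0 tr]]; apply: le_down; first by left.
  by right; split => //; exact: le_lt_trans tr.
- by exists 0; left.
- exact: has_sup_superlevel.
Qed.

(** For fixed [s], the conditions [s < level y] and [y < k s] can disagree only where [level y = s],
    which has positive measure when [k] jumps at [s]. The indicator [e s y] of that coincidence is
    null in [s] for each [y], so by Tonelli it is null in [y] for almost every [s]. *)
Lemma integral_level : {ae mu, forall s, 0 < s ->
  (\int[mu]_y ((0 < y)%R%:R * (s < level y)%R%:R)%:E = (k s)%:E)%E}.
Proof.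
have ml := measurable_level.
pose e s y : R := 1 - (s < level y)%R%:R - (level y < s)%R%:R.
have e_ge0 s y : 0 <= e s y by rewrite /e; case: ltgtP => _; rewrite ?subr0 ?subrr.
have me : measurable_fun [set: R * R] (fun z => e z.1 z.2).
  have ml2 : measurable_fun [set: R * R] (fun z => level z.2).
    by apply: (measurableT_comp ml); exact: measurable_snd.
  by rewrite /e; meas.
have e0 y : (\int[mu]_s (e s y)%:E = 0)%E.
  rewrite (ae_eq_integral (cst 0%E))//; first by rewrite integral0.
  + by apply/measurable_EFinP; rewrite /e; meas.
  + apply: ae_eqI; exists [set level y]; split => //; first exact: lebesgue_measure_set1.
    move=> s /= sl; apply: contrapT => sy; apply: sl; rewrite /e.
    by case: ltgtP sy => //= _ _; rewrite ?subr0 ?subrr.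
have E : (\int[mu]_s \int[mu]_y (e s y)%:E = 0)%E.
  by rewrite tonelli// integral0_eq.
have mE : measurable_fun setT (fun s => \int[mu]_y (e s y)%:E)%E.
  apply: measurable_fun_integral => [|s y]; last by rewrite lee_fin.
  exact/measurable_EFinP.
have Eabs : (\int[mu]_s `|\int[mu]_y (e s y)%:E| = 0)%E.
  rewrite -[RHS]E; apply: eq_integral => s _; rewrite gee0_abs//.
  by apply: integral_ge0 => y _; rewrite lee_fin.
have h := (ae_eq_integral_abs mu measurableT mE).1 Eabs.
have h' : {ae mu, forall s, (\int[mu]_y (e s y)%:E = 0)%E}.
  by apply: (@aeW _ _ _ h) => s /(_ I).
apply: aeW h' _ => s es s0.
have mL : measurable_fun setT (fun y : R => (0 < y)%R%:R * (s < level y)%R%:R : R) by meas.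
have mes : measurable_fun setT (e s) by rewrite /e; meas.
apply/le_anti/andP; split.
  rewrite -integral_lt_natr ?k_ge0//; apply: ge0_le_integral => //.
  - by apply/measurable_EFinP; refine mL.
  - by apply/measurable_EFinP; meas.
  - move=> y _; rewrite lee_fin; have [y0|y0] := ltP 0 y; last by rewrite !mul0r.
    rewrite !mul1r; have [sy|//] := ltP s (level y).
      by rewrite (lt_level y0 s0 sy).
rewrite -integral_lt_natr ?k_ge0// -[leRHS]adde0 -es -ge0_integralD//; last 3 first.
- by apply/measurable_EFinP; refine mL.
- by move=> y _; rewrite lee_fin.
- by apply/measurable_EFinP; refine mes.
apply: ge0_le_integral => //.
- by apply/measurable_EFinP; meas.
- by apply: emeasurable_funD; apply/measurable_EFinP; [refine mL|refine mes].
- move=> y _; rewrite -EFinD lee_fin; have [y0|y0] := ltP 0 y; last by rewrite !mul0r addr_ge0.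
  rewrite !mul1r; have [yk|//] := ltP y (k s).
    have sl := le_level y0 s0 yk; rewrite /e; move: sl.
    by case: ltgtP => // _ _; rewrite ?addr0 ?subr0 ?add0r// subrr addr0.
  by rewrite addr_ge0.
Qed.

(** As [N] is nonnegative, the absolute double integral equals that of [chi * eta], so integrability
    of the product is all that Fubini asks for. [N] is kept abstract to cover both the Volterra
    kernels and the indicator of [s < t]. *)
Lemma layer_pairing (N : R -> R -> R) (chi eta : R -> R) :
  measurable_fun [set: R * R] (fun z => N z.1 z.2) -> (forall t s, 0 <= N t s) ->
  measurable_fun setT chi -> (forall s, s <= 0 -> chi s = 0) ->
  mu.-integrable setT (EFin \o (fun s => chi s * eta s)) ->
  {ae mu, forall s, 0 < s ->
    (\int[mu]_y ((0 < y)%R%:R * N (level y) s)%:E = (eta s)%:E)%E} ->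
  \int[mu]_s (chi s * eta s) =
  \int[mu]_y ((0 < y)%R%:R * \int[mu]_s (N (level y) s * chi s)).
Proof.
move=> mN N0 mchi chi0 iche etaE.
have mNl : measurable_fun [set: R * R] (fun z => N (level z.2) z.1).
  apply: (measurableT_comp mN (g := fun z => (level z.2, z.1))).
  apply/measurable_fun_pairP; split => /=; last exact: measurable_fst.
  by apply: (measurableT_comp measurable_level); exact: measurable_snd.
have mNs s : measurable_fun setT (fun y => N (level y) s).
  by apply: (measurableT_comp mNl (g := fun y => (s, y))); exact: measurable_pair1.
have mNy y : measurable_fun setT (N (level y)).
  by apply: (measurableT_comp mN (g := fun s => (level y, s))); exact: measurable_pair1.
pose F s y := chi s * ((0 < y)%R%:R * N (level y) s).
have mF : measurable_fun [set: R * R] (fun z => F z.1 z.2).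
  have mchi1 : measurable_fun [set: R * R] (fun z => chi z.1).
    by apply: (measurableT_comp mchi); exact: measurable_fst.
  by rewrite /F; meas.
have mFs s : measurable_fun setT (fun y : R => (0 < y)%R%:R * N (level y) s : R).
  have := mNs s; move: (fun y => N (level y) s) => g mg.
  by apply: measurable_funM => //; meas.
have iF : (\int[mu]_s \int[mu]_y `|F s y|%:E < +oo)%E.
  have /integrableP[_] := iche; apply: le_lt_trans; rewrite le_eqVlt; apply/orP; left.
  apply/eqP; apply: ae_eq_integral => //.
  - apply: measurable_fun_integral; last by move=> *; rewrite lee_fin.
    by apply/measurable_EFinP; apply: measurable_fun_norm; refine mF.
  - have := Rintegrable_measurable iche => m; rewrite /=; meas.
  - apply: ae_eqI; apply: aeW etaE _ => s etas.
    have [s0|s0] := leP s 0.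
      rewrite /= chi0// mul0r normr0 integral0_eq// => y _.
      by rewrite /F chi0// mul0r normr0.
    have eta0 : 0 <= eta s.
      by rewrite -lee_fin -(etas s0) integral_ge0// => y _; rewrite lee_fin mulr_ge0.
    rewrite /= normrM (ger0_norm eta0) EFinM -(etas s0) -ge0_integralZl_EFin//; last 2 first.
    + by move=> y _; rewrite lee_fin mulr_ge0.
    + by apply/measurable_EFinP; refine (mFs s).
    apply: eq_integral => y _; rewrite -EFinM; congr EFin.
    by rewrite /F normrM (ger0_norm (_ : 0 <= _ * _)) ?mulr_ge0.
transitivity (\int[mu]_s \int[mu]_y F s y).
  apply: ae_eq_Rintegral.
  - exact: Rintegrable_measurable iche.
  - apply: Rintegrable_measurable; exact: integrable_Rfubini_F.
  - apply: aeW etaE _ => s etas.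
    have [s0|s0] := leP s 0.
      rewrite chi0// mul0r; under eq_Rintegral do rewrite /F chi0// mul0r.
      by rewrite /Rintegral integral0.
    by rewrite RintegralZlT; [rewrite /Rintegral etas|exact: mFs].
rewrite Rfubini//; apply: eq_Rintegral => y _.
rewrite -RintegralZlT; last by have := mNy y; move: (N (level y)) => g mg; meas.
by apply: eq_Rintegral => s _; rewrite /F mulrC mulrA.
Qed.

End layer_cake.

(** * Abel transforms *)

Section abel.
Context {R : realType}.
Notation mu := (@lebesgue_measure R).
Local Opaque Gamma pw.
Variable b : R.
Hypotheses (b0 : 0 < b) (b1 : b < 1).

Let Gb : 0 < Gamma b.
Proof. by apply: Gamma_gt0; apply/andP; split; move: b0 b1; lra. Qed.

Let G1b : 0 < Gamma (1 - b).
Proof. by apply: Gamma_gt0; apply/andP; split; move: b0 b1; lra. Qed.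

(** The kernel of complementary order is applied and [beta_integral] collapses the convolution.
    Measurability of the outer integrand is returned as well, since [abel_left_injective] modifies
    that integrand on a null set. *)
Lemma abel_left_inversion (q : R -> R) (r : R) : measurable_fun setT q ->
  mu.-integrable setT (EFin \o (fun s => q s * (s < r)%R%:R)) ->
  measurable_fun setT (fun v : R => pw (- b) (r - v) * \int[mu]_s (pw (b - 1) (v - s) * q s)) /\
  \int[mu]_v (pw (- b) (r - v) * \int[mu]_s (pw (b - 1) (v - s) * q s)) =
  Gamma b * Gamma (1 - b) * \int[mu]_s (q s * (s < r)%R%:R).
Proof.
move=> mq iq.
pose F s v := q s * (pw (b - 1) (v - s) * pw (- b) (r - v)).
have mF : measurable_fun [set: R * R] (fun z => F z.1 z.2).
  have mq1 : measurable_fun [set: R * R] (fun z => q z.1).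
    by apply: (measurableT_comp mq); exact: measurable_fst.
  by rewrite /F; meas.
have mI (s : R) : measurable_fun setT (fun v : R => pw (b - 1) (v - s) * pw (- b) (r - v)).
  by meas.
have FE s : (\int[mu]_v `|F s v|%:E)%E =
    (Gamma b * Gamma (1 - b) * `|q s * (s < r)%R%:R|)%:E.
  transitivity (`|q s|%:E * \int[mu]_v (pw (b - 1) (v - s) * pw (- b) (r - v))%:E)%E.
    rewrite -ge0_integralZl_EFin//; last 2 first.
    - by move=> v _; rewrite lee_fin mulr_ge0 ?pw_ge0.
    - by apply/measurable_EFinP; refine (mI s).
    apply: eq_integral => v _; rewrite -EFinM; congr EFin.
    by rewrite /F normrM (ger0_norm (_ : 0 <= _ * _)) ?mulr_ge0 ?pw_ge0.
  rewrite (beta_integral b0 b1) -EFinM (normrM (q s)) (ger0_norm (ler0n _ _)); congr EFin.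
  by rewrite mulrCA mulrA.
have iF : (\int[mu]_s \int[mu]_v `|F s v|%:E < +oo)%E.
  under eq_integral do rewrite FE.
  have /integrableP[_] := RintegrableZ measurableT (Gamma b * Gamma (1 - b)) iq.
  apply: le_lt_trans; rewrite le_eqVlt; apply/orP; left; apply/eqP.
  apply: eq_integral => s _ /=.
  by rewrite (normrM (Gamma b * _)) (ger0_norm (ltW (mulr_gt0 Gb G1b))).
have FG v : pw (- b) (r - v) * \int[mu]_s (pw (b - 1) (v - s) * q s) = \int[mu]_s F s v.
  rewrite -RintegralZlT; last by meas.
  by apply: eq_Rintegral => s _; rewrite /F mulrCA mulrA mulrC.
split; last transitivity (\int[mu]_v \int[mu]_s F s v); last 2 first.
- by apply: eq_Rintegral => v _; exact: FG.
- rewrite -Rfubini// -RintegralZlT; last exact: Rintegrable_measurable iq.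
  apply: eq_Rintegral => s _; rewrite /F RintegralZlT//.
  by rewrite /Rintegral (beta_integral b0 b1)/= mulrCA mulrA.
rewrite (funext FG); apply: Rintegrable_measurable.
exact: integrable_Rfubini_F (measurable_Rswap mF) (finite_Rswap mF iF).
Qed.

Lemma abel_left_injective (q : R -> R) : measurable_fun setT q ->
  (forall r, mu.-integrable setT (EFin \o (fun s => q s * (s < r)%R%:R))) ->
  {ae mu, forall v, \int[mu]_s (pw (b - 1) (v - s) * q s) = 0} ->
  {ae mu, forall s, q s = 0}.
Proof.
move=> mq iq q0; apply: ae_eq0_primitive => // r.
have [mv] := abel_left_inversion mq (iq r).
have -> : \int[mu]_v (pw (- b) (r - v) * \int[mu]_s (pw (b - 1) (v - s) * q s)) = \int[mu]_v 0.
  apply: ae_eq_Rintegral => //.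
  by apply: aeW q0 _ => v ->; rewrite mulr0.
have c0 := lt0r_neq0 (mulr_gt0 Gb G1b).
by rewrite {1}/Rintegral integral0 => /esym/eqP; rewrite mulf_eq0 (negbTE c0) => /eqP.
Qed.

(** With values in [[0, +oo]] Tonelli takes the place of Fubini, so the identity can be used before
    [A] is known to be finite. *)
Lemma abel_right_inversion (A : R -> \bar R) (r : R) : measurable_fun setT A ->
  (forall s, 0 <= A s)%E ->
  (\int[mu]_u ((pw (- b) (u - r))%:E * \int[mu]_s ((pw (b - 1) (s - u))%:E * A s)) =
  (Gamma b * Gamma (1 - b))%:E * \int[mu]_s ((r < s)%R%:R%:E * A s))%E.
Proof.
move=> mA A0.
pose F (u s : R) := ((pw (- b) (u - r) * pw (b - 1) (s - u))%:E * A s)%E.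
have mF : measurable_fun [set: R * R] (fun z => F z.1 z.2).
  apply: emeasurable_funM; first by meas.
  by apply: (measurableT_comp mA); exact: measurable_snd.
transitivity (\int[mu]_u \int[mu]_s F u s)%E.
  apply: eq_integral => u _; rewrite -ge0_integralZl_EFin ?pw_ge0//; last 2 first.
  - by move=> s _; rewrite mule_ge0// lee_fin pw_ge0.
  - by apply: emeasurable_funM; [meas|refine mA].
  by apply: eq_integral => s _; rewrite muleA -EFinM.
rewrite etonelli//; last by move=> u s; rewrite mule_ge0// lee_fin mulr_ge0 ?pw_ge0.
rewrite -ge0_integralZl_EFin//; last 3 first.
- by move=> s _; rewrite mule_ge0// lee_fin.
- by apply: emeasurable_funM; [meas|refine mA].
- exact: ltW (mulr_gt0 Gb G1b).
apply: eq_integral => s _.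
transitivity (\int[mu]_u ((pw (b - 1) (s - u) * pw (- b) (u - r))%:E * A s))%E.
  by apply: eq_integral => u _; rewrite /F mulrC.
rewrite ge0_integralZr//.
- have -> : (\int[mu]_u (pw (b - 1) (s - u) * pw (- b) (u - r))%:E =
      \int[mu]_u (pw (b - 1) (u - (- s)) * pw (- b) ((- r) - u))%:E)%E.
    rewrite -(@ge0_integral_reflect _ (fun u => (pw (b - 1) (s - u) * pw (- b) (u - r))%:E)%E 0).
    + by apply: eq_integral => u _; rewrite sub0r !opprK (addrC s) (addrC (- u)).
    + by meas.
    + by move=> u; rewrite lee_fin mulr_ge0 ?pw_ge0.
  by rewrite (beta_integral b0 b1) ltrN2 EFinM muleA.
- by meas.
- by move=> u _; rewrite lee_fin mulr_ge0 ?pw_ge0.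
Qed.

(** [A] will be a superposition of kernels, whose finiteness is not known in advance. Inversion
    shows that [A] and [B] have the same integrals over [(r, +oo)] for [r >= 0]. Those of [B] are
    finite, which makes [A] integrable and allows the subtraction [q], whose integrals over all
    intervals vanish. *)
Lemma abel_right_injective (A : R -> \bar R) (B : R -> R) :
  measurable_fun setT A -> (forall s, 0 <= A s)%E -> (forall s, s <= 0 -> A s = 0%E) ->
  mu.-integrable setT (EFin \o B) -> (forall s, 0 <= B s) -> (forall s, s <= 0 -> B s = 0) ->
  {ae mu, forall u, 0 < u ->
    (\int[mu]_s ((pw (b - 1) (s - u))%:E * A s) =
     \int[mu]_s (pw (b - 1) (s - u) * B s)%:E)%E} ->
  {ae mu, forall s, A s = (B s)%:E}.
Proof.
move=> mA A0 A_le0 iB B0 B_le0 AB.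
have mB := Rintegrable_measurable iB.
have cpos := mulr_gt0 Gb G1b.
have mT (D : R -> \bar R) : measurable_fun setT D -> (forall s, 0 <= D s)%E ->
    measurable_fun setT (fun u : R => \int[mu]_s ((pw (b - 1) (s - u))%:E * D s))%E.
  move=> mD D0.
  apply: (@measurable_fun_integral _ R R (fun u s => ((pw (b - 1) (s - u))%:E * D s)%E)).
    apply: emeasurable_funM; first by meas.
    by apply: (measurableT_comp mD); exact: measurable_snd.
  by move=> u s; rewrite mule_ge0// lee_fin pw_ge0.
have AE r : 0 <= r -> (\int[mu]_s ((r < s)%R%:R%:E * A s) =
    \int[mu]_s ((r < s)%R%:R%:E * (B s)%:E))%E.
  move=> r0; have B0' s : (0 <= (B s)%:E)%E by rewrite lee_fin.
  have mBE : measurable_fun setT (fun s => (B s)%:E) by exact/measurable_EFinP.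
  suff : ((Gamma b * Gamma (1 - b))%:E * \int[mu]_s ((r < s)%R%:R%:E * A s) =
      (Gamma b * Gamma (1 - b))%:E * \int[mu]_s ((r < s)%R%:R%:E * (B s)%:E))%E.
    move/(congr1 (fun z => (Gamma b * Gamma (1 - b))^-1%:E * z)%E).
    by rewrite !muleA -EFinM mulVf ?gt_eqF// !mul1e.
  rewrite -(abel_right_inversion r mA A0) -(abel_right_inversion r mBE B0').
  apply: ae_eq_integral.
  - exact: measurableT.
  - by apply: emeasurable_funM; [meas|exact: mT].
  - by apply: emeasurable_funM; [meas|exact: mT].
  - apply: ae_eqI; apply: aeW AB _ => u ABu.
    have [u0|u0] := leP u 0.
      by rewrite pw_le0 ?mul0e// subr_le0 (le_trans u0).
    rewrite ABu//; congr (_ * _)%E; apply: eq_integral => s _.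
have iBr r : mu.-integrable setT (EFin \o (fun s => B s * (r < s)%R%:R)).
  apply: le_Rintegrable iB => //; first by meas.
  by move=> s _; case: ltP => _; rewrite ?mulr1 ?mulr0 ger0_norm.
have intB r : (\int[mu]_s ((r < s)%R%:R%:E * (B s)%:E) =
    (\int[mu]_s (B s * (r < s)%R%:R))%:E)%E.
  rewrite /Rintegral fineK; last by apply: integrable_fin_num => //; exact (iBr r).
  by apply: eq_integral => s _; rewrite -EFinM mulrC.
have iAr r : 0 <= r -> mu.-integrable setT (fun s => (r < s)%R%:R%:E * A s)%E.
  move=> r0; apply/integrableP; split; first by apply: emeasurable_funM => //; meas.
  under eq_integral do rewrite gee0_abs ?mule_ge0 ?lee_fin//.
  by rewrite AE// intB ltry.
have fineA r s : fine ((r < s)%R%:R%:E * A s) = fine (A s) * (r < s)%R%:R.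
  by case: ltP => _; rewrite ?mul1e ?mulr1// mul0e mulr0.
pose q s := fine (A s) - B s.
have mq : measurable_fun setT q.
  by apply: measurable_funB => //; exact: measurableT_comp mA.
have iq r : 0 <= r -> mu.-integrable setT (EFin \o (fun s => q s * (r < s)%R%:R)).
  move=> r0; have [iA _] := integrable_fine (iAr r r0).
  have := RintegrableB measurableT iA (iBr r); congr (is_true (mu.-integrable _ _)).
  by apply/funext => s /=; rewrite fineA /q mulrBl.
have q0 r : 0 <= r -> \int[mu]_s (q s * (r < s)%R%:R) = 0.
  move=> r0; have [iA EA] := integrable_fine (iAr r r0).
  transitivity (\int[mu]_s (fine ((r < s)%R%:R%:E * A s) - B s * (r < s)%R%:R)).
    by apply: eq_Rintegral => s _; rewrite fineA /q mulrBl.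
  by rewrite RintegralB// EA AE// intB/= subrr.
have q_le0 s : s <= 0 -> q s = 0 by move=> s0; rewrite /q A_le0// B_le0// subrr.
have qr0 s : q s * (0 < s)%R%:R = q s.
  by case: ltP => s0; rewrite ?mulr1// mulr0 q_le0.
have iq' : mu.-integrable setT (EFin \o q).
  by have := iq 0 (lexx _); congr (is_true (mu.-integrable _ _)); apply/funext => s /=; rewrite qr0.
have qae : {ae mu, forall s, q s = 0}.
  apply: ae_eq0_primitive => // t.
    apply: le_Rintegrable (_ : mu.-integrable setT (EFin \o (fun s => `|q s|))) => //.
    - by meas.
    - by move=> s _; case: ltP => _; rewrite ?mulr1 ?mulr0 ?normr0.
    - exact (integrable_norm iq').
  have [t0|t0] := leP t 0.
    rewrite /Rintegral integral0_eq// => s _.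
    by case: ltP => st; rewrite ?mulr0// q_le0 ?mul0r// ltW// (lt_le_trans st).
  transitivity (\int[mu]_s (q s - q s * (t < s)%R%:R)).
    apply: ae_eq_Rintegral; [by meas|by meas|].
    apply: aeW (ae_neq t) _ => s.
    by case: ltgtP => // _ _; rewrite ?mulr0 ?mulr1 ?subr0 ?subrr.
  rewrite RintegralB// ?iq ?ltW// q0 ?(ltW t0)// subr0.
  by rewrite -[RHS](q0 0)//; apply: eq_Rintegral => s _; rewrite qr0.
have finA : {ae mu, forall s, A s \is a fin_num}.
  have /integrable_ae := iAr 0 (lexx _) => /(_ measurableT) h.
  apply: (@aeW _ _ _ h) => s /(_ I).
  by case: (ltP 0 s) => s0; [rewrite mul1e|rewrite A_le0].
apply: aeW (aeI qae finA) _ => s [/eqP]; rewrite subr_eq0 => /eqP <- fA.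
by rewrite fineK.
Qed.

End abel.

(** * Superpositions of the kernel *)

Section layer_pos.
Context {R : realType}.
Notation mu := (@lebesgue_measure R).
Local Opaque Gamma pw KNpos.

Lemma measurable_fun_Rintegral (G : R -> R -> R) :
  measurable_fun [set: R * R] (fun z => G z.1 z.2) ->
  measurable_fun setT (fun x => \int[mu]_y G x y).
Proof.
move=> mG.
have mp : measurable_fun setT (fun x => \int[mu]_y (Num.max (G x y) 0)%:E)%E.
  apply: measurable_fun_integral; last by move=> x y; rewrite lee_fin le_max lexx orbT.
  by apply/measurable_EFinP; exact: measurable_maxr.
have mn : measurable_fun setT (fun x => \int[mu]_y (Num.max (- G x y) 0)%:E)%E.
  apply: measurable_fun_integral; last by move=> x y; rewrite lee_fin le_max lexx orbT.
  by apply/measurable_EFinP; apply: measurable_maxr => //; exact: measurable_fun_opp.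
have : measurable_fun setT (fun x => fine (\int[mu]_y (Num.max (G x y) 0)%:E -
    \int[mu]_y (Num.max (- G x y) 0)%:E)%E).
  by apply: measurableT_comp => //; exact: emeasurable_funB.
congr (measurable_fun _ _); apply/funext => x; rewrite /Rintegral integralE.
congr (fine (_ - _)); apply: eq_integral => y _; rewrite ?funeposE ?funenegE//=.
  by rewrite EFin_max.
by rewrite EFin_max.
Qed.

Variable a : R.
Hypotheses (a0 : 0 < a) (a12 : a < 2^-1).

Let Ga : 0 < Gamma a.
Proof. by apply: Gamma_gt0; apply/andP; split; move: a0 a12; lra. Qed.

(** First the density [potential_pos] vanishes because its primitive does. It is a weighted Abel
    transform of [s ^ (- a) * chi s], so injectivity of Abel transforms finishes. *)
Lemma KNpos_complete (chi : R -> R) : L2p chi ->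
  (forall t, \int[mu]_s (KNpos a t s * chi s) = 0) -> {ae mu, forall s, chi s = 0}.
Proof.
move=> Lchi chi0.
have mchi : measurable_fun setT chi by case: Lchi.
have mpot : measurable_fun setT (potential_pos a chi).
  rewrite /potential_pos; have mG : measurable_fun setT (fun v : R =>
      \int[mu]_s (pw (a - 1) (v - s) * (pw (- a) s * chi s))).
    apply: (@measurable_fun_Rintegral (fun v s => pw (a - 1) (v - s) * (pw (- a) s * chi s))).
    have mchi2 : measurable_fun [set: R * R] (fun z => chi z.2).
      by apply: (measurableT_comp mchi); exact: measurable_snd.
    by meas.
  by apply: measurable_funM; [meas|apply: measurable_funM; [meas|refine mG]].
have pot0 : {ae mu, forall v, potential_pos a chi v = 0}.
  apply: ae_eq0_primitive => // t; first exact: integrable_potential_pos.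
  by rewrite -KNpos_potential.
pose q s := pw (- a) s * chi s.
have q0 : {ae mu, forall s, q s = 0}.
  apply: (@abel_left_injective _ a) => //.
  - by move: a12; lra.
  - by rewrite /q; meas.
  - move=> r.
    have a2 : 0 <= a < 2^-1 by rewrite (ltW a0).
    have := L2p_mul (L2p_pw_lt r a2) Lchi; congr (is_true (mu.-integrable _ _)).
    by apply/funext => s /=; rewrite /q mulrAC.
  - apply: aeW pot0 _ => v /eqP.
    have [v0|v0] := leP v 0.
      move=> _; rewrite /Rintegral integral0_eq// => s _.
      have [s0|s0] := leP s 0; first by rewrite /q (pw_le0 _ s0) mul0r mulr0.
      by rewrite (pw_le0 _ (_ : v - s <= 0)) ?mul0r// subr_le0 ltW// (le_lt_trans v0).
    rewrite /potential_pos mulf_eq0 invr_eq0 gt_eqF//= mulf_eq0 gt_eqF ?pw_gt0//=.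
    by move/eqP.
apply: aeW q0 _ => s /eqP; rewrite mulf_eq0 => /orP[|/eqP//].
have [s0 _|s0] := leP s 0; first by case: Lchi => _ ->.
by rewrite gt_eqF ?pw_gt0.
Qed.

Variables (k eta : R -> R).
Hypotheses (k_ge0 : forall s, 0 < s -> 0 <= k s)
  (k_anti : forall s t, 0 < s -> s <= t -> k t <= k s)
  (k_bounded : forall y, 0 < y -> exists M, forall s, M < s -> k s <= y).

(** Here [eta] is given as a weighted Abel integral of [k], and [KNpos a t] is the same integral of
    the indicator of [v < t]. Inserting the layer-cake formula for [k] and exchanging the integrals
    is therefore enough. *)
Lemma layer_KNpos :
  {ae mu, forall s, 0 < s ->
    (\int[mu]_v (pw (a - 1) (v - s) * (pw a v * k v))%:E =
     (Gamma a * (pw a s * eta s))%:E)%E} ->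
  {ae mu, forall s, 0 < s ->
    (\int[mu]_y ((0 < y)%R%:R * KNpos a (level k y) s)%:E = (eta s)%:E)%E}.
Proof.
move=> keta.
have ml : measurable_fun setT (level k) by exact: measurable_level.
have mck : measurable_fun setT (cut k) by exact: measurable_nonincreasing_cut.
apply: aeW keta _ => s ks s0.
pose w v : R := pw (a - 1) (v - s) * pw a v.
have mw : measurable_fun setT w by rewrite /w; meas.
have w0 v : 0 <= w v by rewrite mulr_ge0 ?pw_ge0.
have c0 : 0 <= (Gamma a)^-1 * pw (- a) s by rewrite mulr_ge0 ?pw_ge0// invr_ge0 ltW.
pose F (y v : R) : R := w v * ((0 < y)%R%:R * (v < level k y)%R%:R).
have F0 y v : 0 <= F y v by rewrite mulr_ge0.
have mF : measurable_fun [set: R * R] (fun z => F z.1 z.2).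
  have mw2 : measurable_fun [set: R * R] (fun z => w z.2).
    by apply: (measurableT_comp mw); exact: measurable_snd.
  have ml1 : measurable_fun [set: R * R] (fun z => level k z.1).
    by apply: (measurableT_comp ml); exact: measurable_fst.
  by rewrite /F; meas.
have mFy y : measurable_fun setT (F y).
  by apply: (measurableT_comp mF (g := fun v => (y, v))); exact: measurable_pair1.
have mIy : measurable_fun setT (fun y => \int[mu]_v (F y v)%:E)%E.
  apply: measurable_fun_integral; first by apply/measurable_EFinP.
  by move=> y v; rewrite lee_fin.
transitivity (\int[mu]_y (((Gamma a)^-1 * pw (- a) s)%:E * \int[mu]_v (F y v)%:E))%E.
  apply: eq_integral => y _.
  have [y0|y0] := ltP 0 y; last first.
    rewrite mul0r integral0_eq ?mule0// => v _.
    by rewrite /F ltNge y0 mul0r mulr0.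
  rewrite mul1r KNposE//; congr (_ * _)%E; apply: eq_integral => v _.
  by rewrite /F y0 mul1r.
rewrite ge0_integralZl_EFin//; last by move=> y _; apply: integral_ge0 => v _; rewrite lee_fin.
rewrite tonelli//.
have -> : (\int[mu]_v \int[mu]_y (F y v)%:E =
    \int[mu]_v (pw (a - 1) (v - s) * (pw a v * k v))%:E)%E.
  transitivity (\int[mu]_v (w v * cut k v)%:E)%E; last first.
    apply: eq_integral => v _; congr EFin; rewrite /w.
    have [v0|v0] := leP v 0; first by rewrite (pw_le0 _ v0) mulr0 !mul0r mulr0.
    by rewrite /cut v0 mul1r mulrA.
  apply: ae_eq_integral => //.
  - apply: (@measurable_fun_integral _ R R (fun v y => (F y v)%:E)).
      by apply/measurable_EFinP; exact: (measurable_Rswap mF).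
    by move=> y v; rewrite lee_fin.
  - by meas.
  - apply: ae_eqI; apply: aeW (integral_level k_ge0 k_anti k_bounded) _ => v kv.
    have mlv : measurable_fun setT (fun y : R => (0 < y)%R%:R * (v < level k y)%R%:R : R).
      by meas.
    rewrite /F; transitivity ((w v)%:E *
        \int[mu]_y ((0 < y)%R%:R * (v < level k y)%R%:R)%:E)%E.
      rewrite -ge0_integralZl_EFin//; last by apply/measurable_EFinP; refine mlv.
    have [v0|v0] := leP v 0; first by rewrite /w (pw_le0 _ v0) mulr0 mul0e mul0r.
    by rewrite kv// /cut v0 mul1r EFinM.
rewrite ks// -EFinM; congr EFin.
have := pwV a s0; have := lt0r_neq0 Ga.
move: (Gamma a) (pw a s) (pw (- a) s) => g x y g0 xy.
transitivity (y * x * eta s); first by field.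
by rewrite xy mul1r.
Qed.

End layer_pos.

Section layer_neg.
Context {R : realType}.
Notation mu := (@lebesgue_measure R).
Local Opaque Gamma pw KNneg.
Variable b : R.
Hypotheses (b0 : 0 < b) (b12 : b < 2^-1).

Let b1 : b < 1. Proof. by move: b12; lra. Qed.

Let Gb : 0 < Gamma b.
Proof. by apply: Gamma_gt0; apply/andP; split; move: b0 b12; lra. Qed.

Section layer.
Variables (k eta : R -> R).
Hypotheses (k_ge0 : forall s, 0 < s -> 0 <= k s)
  (k_anti : forall s t, 0 < s -> s <= t -> k t <= k s)
  (k_bounded : forall y, 0 < y -> exists M, forall s, M < s -> k s <= y).

(** Here the Abel transform of [eta] is prescribed, not [eta] itself. By [integral_KNneg] the
    superposition of kernels has the same transform, and [abel_right_injective] identifies the two;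
    its integrability condition is the one imposed on [pw (- b) s * eta s]. *)
Lemma layer_KNneg : (forall s, 0 <= eta s) ->
  mu.-integrable setT (EFin \o (fun s => pw (- b) s * eta s)) ->
  {ae mu, forall u, 0 < u ->
    (\int[mu]_s (pw (b - 1) (s - u) * (pw (- b) s * eta s))%:E =
     (Gamma b * (pw (- b) u * k u))%:E)%E} ->
  {ae mu, forall s, 0 < s ->
    (\int[mu]_y ((0 < y)%R%:R * KNneg b (level k y) s)%:E = (eta s)%:E)%E}.
Proof.
move=> eta0 ieta keta.
have ml : measurable_fun setT (level k) by exact: measurable_level.
have N0 t s : 0 <= KNneg b t s by exact: KNneg_ge0.
have mN : measurable_fun [set: R * R] (fun z => KNneg b (level k z.2) z.1).
  apply: (measurableT_comp (@measurable_KNneg R b) (g := fun z => (level k z.2, z.1))).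
  apply/measurable_fun_pairP; split => /=; last exact: measurable_fst.
  by apply: (measurableT_comp ml); exact: measurable_snd.
pose F (s y : R) : R := (0 < y)%R%:R * (pw (- b) s * KNneg b (level k y) s).
have F0 s y : 0 <= F s y 
  by rewrite /F; apply: mulr_ge0 => //; apply: mulr_ge0; [exact: pw_ge0|exact: N0].
have mF : measurable_fun [set: R * R] (fun z => F z.1 z.2).
  rewrite /F; apply: measurable_funM; first by meas.
  by apply: measurable_funM; [meas|refine mN].
pose A (s : R) : \bar R := (\int[mu]_y (F s y)%:E)%E.
have mA : measurable_fun setT A.
  apply: measurable_fun_integral; last by move=> s y; rewrite lee_fin.
  exact/measurable_EFinP.
have A0 s : (0 <= A s)%E by apply: integral_ge0 => y _; rewrite lee_fin.
have A_le0 s : s <= 0 -> A s = 0%E.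
  by move=> s0; rewrite /A integral0_eq// => y _; rewrite /F (pw_le0 _ s0) mul0r mulr0.
have B_le0 s : s <= 0 -> pw (- b) s * eta s = 0 by move=> s0; rewrite (pw_le0 _ s0) mul0r.
have AB : {ae mu, forall s, A s = (pw (- b) s * eta s)%:E}.
  apply: (@abel_right_injective _ b) => //.
    by move=> s; rewrite mulr_ge0 ?pw_ge0.
  apply: aeW (aeI keta (integral_level k_ge0 k_anti k_bounded)) _ => u [ku lu] u0.
  rewrite ku//.
  have mG : measurable_fun [set: R * R] (fun z => pw (b - 1) (z.1 - u) * F z.1 z.2).
    by apply: measurable_funM; [meas|refine mF].
  transitivity (\int[mu]_s \int[mu]_y (pw (b - 1) (s - u) * F s y)%:E)%E.
    apply: eq_integral => s _; rewrite /A -ge0_integralZl_EFin ?pw_ge0//.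
    - by move=> y _; rewrite lee_fin.
    - apply/measurable_EFinP.
      by apply: (measurableT_comp mF (g := fun y => (s, y))); exact: measurable_pair1.
  rewrite (tonelli mG); last by move=> s y; rewrite mulr_ge0 ?pw_ge0.
  transitivity (\int[mu]_y ((Gamma b * pw (- b) u)%:E *
      ((0 < y)%R%:R * (u < level k y)%R%:R)%:E))%E.
    apply: eq_integral => y _.
    transitivity ((0 < y)%R%:R%:E *
      \int[mu]_s (pw (b - 1) (s - u) * (pw (- b) s * KNneg b (level k y) s))%:E)%E.
      rewrite -ge0_integralZl_EFin//.
      - by apply: eq_integral => s _; rewrite -EFinM /F; congr EFin; rewrite mulrCA.
      - move=> s _; rewrite lee_fin; apply: mulr_ge0; first exact: pw_ge0.
        by apply: mulr_ge0; [exact: pw_ge0|exact: N0].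
      - have := @measurable_KNneg2 R b (level k y); move: (KNneg b (level k y)) => g mg.
        by meas.
    rewrite (integral_KNneg b0 b12)// -!EFinM; congr EFin.
    by move: (Gamma b) (pw (- b) u) => g x; ring.
  rewrite ge0_integralZl_EFin//; last 2 first.
  - by apply/measurable_EFinP; apply: measurable_funM; meas.
  - by rewrite mulr_ge0 ?pw_ge0 ?(ltW Gb).
  by rewrite lu// -EFinM mulrA.
apply: aeW AB _ => s As s0.
have p0 := pwV b s0.
have E1 : (\int[mu]_y ((0 < y)%R%:R * KNneg b (level k y) s)%:E = (pw b s)%:E * A s)%E.
  rewrite /A -ge0_integralZl_EFin ?pw_ge0//.
  - apply: eq_integral => y _; rewrite -EFinM /F; congr EFin.
    move: p0; move: (pw b s) (pw (- b) s) (KNneg _ _ _) => p q w pq.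
    by rewrite -[LHS]mul1r -pq; ring.
  - by move=> y _; rewrite lee_fin.
  - apply/measurable_EFinP.
    by apply: (measurableT_comp mF (g := fun y => (s, y))); exact: measurable_pair1.
by rewrite E1 As -EFinM mulrA (mulrC (pw b s)) p0 mul1r.
Qed.

End layer.

(** For each [T > 0], the function [s ^ (- b)] cut at [T] is a superposition of kernels, hence
    orthogonal to [chi]. So the primitive of [s ^ (- b) * chi s] vanishes identically. *)
Lemma KNneg_complete (chi : R -> R) : L2p chi ->
  (forall t, \int[mu]_s (KNneg b t s * chi s) = 0) -> {ae mu, forall s, chi s = 0}.
Proof.
move=> Lchi chi0.
have mchi : measurable_fun setT chi by case: Lchi.
have chi_le0 s : s <= 0 -> chi s = 0 by case: Lchi => _ + _; exact.
have b2 : 0 <= b < 2^-1 by rewrite (ltW b0).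
pose q s := pw (- b) s * chi s.
have iq r : mu.-integrable setT (EFin \o (fun s => q s * (s < r)%R%:R)).
  have := L2p_mul (L2p_pw_lt r b2) Lchi; congr (is_true (mu.-integrable _ _)).
  by apply/funext => s /=; rewrite /q mulrAC.
suff q0 : {ae mu, forall s, q s = 0}.
  apply: aeW q0 _ => s /eqP; rewrite mulf_eq0 => /orP[|/eqP//].
  have [s0 _|s0] := leP s 0; first exact: chi_le0.
  by rewrite gt_eqF ?pw_gt0.
apply: ae_eq0_primitive => // [|T]; first by rewrite /q; meas.
have [T0|T0] := leP T 0.
  rewrite /Rintegral integral0_eq// => s _.
  by case: ltP => st; rewrite ?mulr0// /q chi_le0 ?mulr0 ?mul0r// ltW// (lt_le_trans st).
(* By scaling, the Abel transform of s^(-2b) on (0, T) is u^(-b) times a nonincreasing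
   function k, so that layer_KNneg applies. *)
pose g (u x : R) : R := pw (b - 1) (x - 1) * (pw (- b) x * pw (- b) x) * (u * x < T)%R%:R.
have g0 u x : 0 <= g u x by rewrite /g !mulr_ge0 ?pw_ge0.
have mg u : measurable_fun setT (g u) by rewrite /g; meas.
have ig u : 0 < u -> (\int[mu]_x (g u x)%:E < +oo)%E.
  move=> u0; apply: (@le_lt_trans _ _ (\int[mu]_x (pw (b - 1) (x - 1) * (x < T / u)%R%:R)%:E)%E).
    apply: ge0_le_integral => //.
    - by move=> x _; rewrite lee_fin.
    - by apply/measurable_EFinP; refine (mg u).
    - by meas.
    - move=> x _; rewrite lee_fin /g ltr_pdivlMr// (mulrC x).
      apply: ler_wpM2r => //; rewrite -[leRHS]mulr1.
      have [x1|x1] := leP x 1; first by rewrite (pw_le0 _ (_ : x - 1 <= 0)) ?subr_le0// !mul0r.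
      apply: ler_wpM2l; first exact: pw_ge0.
      have p1 : pw (- b) x <= 1.
        have := @pw_anti R (- b) 1 x; rewrite oppr_le0 => /(_ (ltW b0) ltr01 (ltW x1)).
        by rewrite (pwE _ ltr01) powR1.
      by rewrite mulr_ile1 ?pw_ge0.
  by rewrite (integral_pw_shift_lt _ _ b0) ltry.
pose k u := (Gamma b)^-1 * \int[mu]_x g u x.
have igR u : 0 < u -> mu.-integrable setT (EFin \o g u).
  move=> u0; apply/integrableP; split; first by apply/measurable_EFinP; refine (mg u).
  by under eq_integral do rewrite gee0_abs ?lee_fin//; exact: ig.
have k_ge0 s : 0 < s -> 0 <= k s.
  move=> s0; rewrite mulr_ge0 ?invr_ge0 ?(ltW Gb)//.
  by apply: Rintegral_ge0.
have k_anti s t : 0 < s -> s <= t -> k t <= k s.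
  move=> s0 st; have t0 := lt_le_trans s0 st.
  apply: ler_wpM2l; first by rewrite invr_ge0 ltW.
  apply: le_Rintegral; [exact: measurableT|exact: igR|exact: igR|].
  move=> x _; rewrite /g.
  have [x1|x1] := leP x 1; first by rewrite (pw_le0 _ (_ : x - 1 <= 0)) ?subr_le0// !mul0r.
  apply: ler_wpM2l; first by rewrite !mulr_ge0 ?pw_ge0.
  rewrite ler_nat; case: (ltP (t * x) T) => // h.
  by rewrite (le_lt_trans _ h)// ler_wpM2r// ltW// (lt_trans ltr01).
have k_bounded y : 0 < y -> exists M, forall s, M < s -> k s <= y.
  move=> y0; exists T => s Ts; rewrite /k /Rintegral integral0_eq ?mulr0 ?ltW// => x _.
  rewrite /g; have [x1|x1] := leP x 1.
    by rewrite (pw_le0 _ (_ : x - 1 <= 0)) ?subr_le0// !mul0r.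
  rewrite ltNge (le_trans (ltW Ts)) ?mulr0// ler_peMr// ltW//.
  exact: lt_trans Ts.
pose eta s := pw (- b) s * (s < T)%R%:R.
have eta0 s : 0 <= eta s by rewrite mulr_ge0 ?pw_ge0.
have ieta : mu.-integrable setT (EFin \o (fun s => pw (- b) s * eta s)).
  have := L2p_mul (L2p_pw_lt T b2) (L2p_pw_lt T b2); congr (is_true (mu.-integrable _ _)).
  apply/funext => s /=; rewrite /eta; case: ltP => _; rewrite ?mulr1// !mulr0//.
have lay : {ae mu, forall s, 0 < s ->
    (\int[mu]_y ((0 < y)%R%:R * KNneg b (level k y) s)%:E = (eta s)%:E)%E}.
  apply: layer_KNneg => //; apply: aeT => u u0.
  rewrite -(@ge0_integral_scale _ _ u)//; last 2 first.
  - by rewrite /eta; meas.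
  - by move=> s; rewrite lee_fin !mulr_ge0 ?pw_ge0.
  transitivity (u%:E * \int[mu]_x ((u `^ (b - 1) * (u `^ (- b) * u `^ (- b)))%:E * (g u x)%:E))%E.
    congr (_ * _)%E; apply: eq_integral => x _; rewrite -EFinM; congr EFin.
    have -> : u * x - u = u * (x - 1) by rewrite mulrBr mulr1.
    rewrite /eta /g !pw_scale//; ring.
  rewrite ge0_integralZl_EFin//; last 3 first.
  - by move=> x _; rewrite lee_fin.
  - by apply/measurable_EFinP; refine (mg u).
  - by rewrite !mulr_ge0 ?powR_ge0.
  rewrite /k /Rintegral.
  have -> : (\int[mu]_x (g u x)%:E)%E = (fine (\int[mu]_x (g u x)%:E))%:E.
    rewrite fineK// ge0_fin_numE ?ig//.
    by apply: integral_ge0 => x _; rewrite lee_fin.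
  rewrite -!EFinM; congr EFin; rewrite (pwE _ u0).
  have -> : u `^ (b - 1) = u `^ b / u.
    by rewrite powRB ?(gt_eqF u0) ?implybT// powRr1 ?ltW.
  have pq : u `^ (- b) * u `^ b = 1 by rewrite -!(pwE _ u0) pwV.
  move: (fine _) (lt0r_neq0 Gb) (lt0r_neq0 u0) pq.
  move: (Gamma b) (u `^ b) (u `^ (- b)) => h x y w h0 u00 pq /=.
  transitivity (y * x * (y * w)); first by field.
  by rewrite pq; field.
have iche : mu.-integrable setT (EFin \o (fun s => chi s * eta s)).
  have := iq T; congr (is_true (mu.-integrable _ _)); apply/funext => s /=.
  by rewrite /q /eta; congr EFin; ring.
have := @layer_pairing _ k k_bounded (KNneg b) chi eta (@measurable_KNneg R b) _
  mchi chi_le0 iche lay.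
have -> : \int[mu]_s (chi s * eta s) = \int[mu]_x (q x * (x < T)%R%:R).
  by apply: eq_Rintegral => s _; rewrite /q /eta; ring.
move=> ->; last by move=> t s; exact: KNneg_ge0.
rewrite /Rintegral integral0_eq// => y _; rewrite -/(Rintegral _ _ _).
by rewrite chi0 mulr0.
Qed.

End layer_neg.

(** * Uniqueness of the representing function, and pairings with [ht'] *)

Section kernel_pairing.
Context {R : realType}.
Notation mu := (@lebesgue_measure R).
Local Opaque Gamma pw KNneg KNpos.

Lemma Rintegral_lt_ge0 (q : R -> R) : mu.-integrable setT (EFin \o q) ->
  (forall T, 0 < T -> 0 <= \int[mu]_s (q s * (s < T)%R%:R)) -> 0 <= \int[mu]_s q s.
Proof.
move=> iq h.
have mq := Rintegrable_measurable iq.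
have iqT T : mu.-integrable setT (EFin \o (fun s => q s * (s < T)%R%:R)).
  apply: le_Rintegrable (integrable_norm iq) => //; first by meas.
  by move=> s _ /=; case: ltP => _; rewrite ?mulr1 ?mulr0 ?normr0.
pose f_ (n : nat) (s : R) : \bar R := (q s * (s < n.+1%:R)%R%:R)%:E.
have [_ _] : [/\ mu.-integrable setT (EFin \o q),
  [sequence \int[mu]_(x in setT) `|f_ n x - (q x)%:E|]_n @ \oo --> 0%E &
  [sequence \int[mu]_(x in setT) (f_ n x)]_n @ \oo --> (\int[mu]_(x in setT) (q x)%:E)]%E.
  apply: (@dominated_convergence _ _ _ mu setT _ f_ _ (EFin \o (fun s => `|q s|))).
  - exact: measurableT.
  - by move=> n; exact (measurable_int _ (iqT n.+1%:R)).
  - exact (measurable_int _ iq).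
  - apply: aeT => s _; apply: cvg_near_cst.
    have [N _ HN] := nbhs_infty_ger (s + 1); exists N => // n /= Nn.
    rewrite /f_ (_ : s < n.+1%:R) ?mulr1//.
    have := HN n Nn; rewrite /= -natr1; lra.
  - exact (integrable_norm iq).
  - apply: aeT => s n _; rewrite /f_/= lee_fin.
    by case: ltP => _; rewrite ?mulr1 ?mulr0 ?normr0.
move=> cvgf; rewrite /Rintegral fine_ge0//.
rewrite -(cvg_lim _ cvgf)//; apply: lime_ge; first by apply/cvg_ex; exists (\int[mu]_x (q x)%:E)%E.
apply: nearW => n /=.
have := h n.+1%:R (ltr0Sn _ _).
rewrite -lee_fin /Rintegral fineK//.
by apply: integrable_fin_num => //; exact (iqT n.+1%:R).
Qed.

Lemma ae_dense (P : R -> Prop) x y : {ae mu, forall u, P u} -> x < y ->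
  exists2 u, x < u < y & P u.
Proof.
move=> [N [mN N0 PN]] xy; apply: contrapT => h.
have sub : `]x, y[ `<=` N.
  move=> u /=; rewrite in_itv/= => xuy; apply: PN => /= Pu; apply: h; by exists u.
have : (mu `]x, y[ <= mu N)%E.
  by apply: le_measure => //; rewrite inE//; exact: measurable_itv.
by rewrite [leRHS]N0 lebesgue_measure_itv/= lte_fin xy -EFinD lee_fin subr_le0 leNgt xy.
Qed.

Lemma Rintegral_gt (f : R -> R) t :
  \int[mu]_(x in `]t, +oo[) f x = \int[mu]_x (f x * (t < x)%R%:R).
Proof.
rewrite [LHS]Rintegral_mkcond; apply: eq_Rintegral => x _; rewrite patchE.
case: ifPn => [|/negP]; rewrite inE/= in_itv/= andbT; first by move=> ->; rewrite mulr1.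
by move/negP/negbTE => ->; rewrite mulr0.
Qed.

Lemma integrable_gt (f : R -> R) t : mu.-integrable `]t, +oo[ (EFin \o f) ->
  mu.-integrable setT (EFin \o (fun x => f x * (t < x)%R%:R)).
Proof.
move=> iff; have := (integrable_restrict mu (measurable_itv `]t, +oo[%R) _ (EFin \o f)).1.
move=> /(_ setT measurableT); rewrite setTI => /(_ iff).
congr (is_true (mu.-integrable _ _)); apply/funext => x; rewrite patchE/=.
case: ifPn => [|/negP]; rewrite inE/= in_itv/= andbT; first by move=> ->; rewrite mulr1.
by move/negP/negbTE => ->; rewrite mulr0.
Qed.

Variable H : R.
Hypotheses (H0 : 0 < H) (H1 : H < 1) (Hh : H != 2^-1).

Lemma KN_complete (chi : R -> R) : L2p chi ->
  (forall t, 0 <= t -> \int[mu]_s (KN H t s * chi s) = 0) -> {ae mu, forall s, chi s = 0}.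
Proof.
move=> Lchi chi0.
have chi0' t : \int[mu]_s (KN H t s * chi s) = 0.
  have [t0|t0] := leP 0 t; first exact: chi0.
  rewrite /Rintegral integral0_eq// => s _.
  have [s0|s0] := leP s 0; first by rewrite KN_le0// mul0r.
  by rewrite KN_supp ?mul0r// ltW// (lt_trans t0).
move: chi0'; rewrite /KN.
have [[-> /andP[b0 b1]]|[-> /andP[b0 b1]]] := hurst_cases H0 H1 Hh.
- exact: KNneg_complete.
- exact: KNpos_complete.
Qed.

(** The choice made by [xget] drops out: two representing functions differ by a function orthogonal
    to every [KN H t], which is null. *)
Lemma rkhs_norm_repr g psi : rkhs_repr H g psi -> rkhs_norm H g = L2_norm psi.
Proof.
move=> rpsi; rewrite /rkhs_norm.
have := xgetPex (cst 0) (ex_intro _ psi rpsi : exists phi, [set phi | rkhs_repr H g phi] phi).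
move: (xget _ _) => psi' /=; move: rpsi.
move=> /(rkhs_reprE H0 H1 Hh)[Lpsi gpsi] /(rkhs_reprE H0 H1 Hh)[Lpsi' gpsi'].
have L1 := in_L2_L2p Lpsi; have L2 := in_L2_L2p Lpsi'.
have C0 := lt0r_neq0 (C1_gt0 H0 H1).
have chi0 : {ae mu, forall s, cut psi s - cut psi' s = 0}.
  apply: KN_complete; first exact: L2pB.
  move=> t t0; have := gpsi t t0; rewrite (gpsi' t t0) => /(mulfI C0) E.
  have LK := KN_L2p H0 H1 Hh t.
  under eq_Rintegral do rewrite mulrBr.
  by rewrite RintegralB ?E ?subrr//; apply: L2p_mul.
case: Lpsi Lpsi' => mpsi _ [mpsi' _].
rewrite /L2_norm !Lp_norm_sqr//; congr (_ `^ _)%E; apply: ae_eq_integral => //.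
- by apply/measurable_EFinP; apply: measurable_funX; exact: measurable_cut.
- by apply/measurable_EFinP; apply: measurable_funX; exact: measurable_cut.
- by apply: ae_eqI; apply: aeW chi0 _ => s /eqP; rewrite subr_eq0 => /eqP ->.
Qed.

(** A nonincreasing function that tends to 0 is nonnegative. Together with its eventual smallness
    this supplies the hypotheses of the layer-cake formula. *)
Lemma littleo_ge0 (K : R -> R) :
  (forall s t : R, 0 < s -> s <= t -> K t <= K s) ->
  (forall eps : R, 0 < eps -> \forall t \near +oo, `|K t| <= eps * t `^ (- H)) ->
  (forall s, 0 < s -> 0 <= K s) /\
  (forall y, 0 < y -> exists M, forall s, M < s -> K s <= y).
Proof.
move=> Kanti Ko.
have Kb y : 0 < y -> exists M, forall s, M < s -> `|K s| <= y.
  move=> y0; have [M [_ HM]] := Ko y y0; exists (Num.max M 1) => s.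
  rewrite gt_max => /andP[Ms s1]; apply: le_trans (HM s Ms) _.
  rewrite -[leRHS]mulr1; apply: ler_wpM2l; first exact: ltW.
  have := @pw_anti R (- H) 1 s.
  rewrite (pwE _ ltr01) powR1 oppr_le0 (pwE _ (lt_trans ltr01 s1)).
  by apply; [exact: ltW|exact: ltr01|exact: ltW].
split=> [s s0|y y0].
  rewrite leNgt; apply/negP => Ks.
  have [M HM] : exists M, forall t, M < t -> `|K t| <= - K s / 2 by apply: Kb; lra.
  pose t := Num.max M s + 1.
  have tM : M < t by rewrite /t ltr_pwDr// le_max lexx.
  have ts : s <= t by rewrite /t ler_wpDr// le_max lexx orbT.
  have := HM t tM; have := Kanti s t s0 ts; have := ler_norm (- K t); rewrite normrN; lra.
have [M HM] := Kb y y0; exists M => s Ms; exact: le_trans (ler_norm _) (HM s Ms).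
Qed.

(** For [H > 2^-1] the relation between [ht'] and [K] is a fractional derivative, so [ht'] is a
    weighted Abel integral of [K] and [layer_KNpos] applies. The factor [(C1 H)^-1] in [eta]
    compensates for the normalization of [KN]. *)
Lemma Kright_star_pairing_pos (K ht' chi : R -> R) : 2^-1 < H -> L2p (cut ht') -> L2p chi ->
  Kright_star H ht' K -> (forall s, 0 < s -> 0 <= K s) ->
  (forall s t : R, 0 < s -> s <= t -> K t <= K s) ->
  (forall y, 0 < y -> exists M, forall s, M < s -> K s <= y) ->
  (forall t, 0 <= t -> 0 <= \int[mu]_s (KN H t s * chi s)) ->
  0 <= \int[mu]_s (chi s * cut ht' s).
Proof.
move=> Hgt Lht Lchi [k Ik Kk] K0 Kanti Kb chi0.
have C10 := C1_gt0 H0 H1.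
have mht : measurable_fun setT (cut ht') by case: Lht.
have mchi : measurable_fun setT chi by case: Lchi.
move: Ik Kk chi0; rewrite /I_right /KN (ltNge H) (ltW Hgt)/=.
pose a := H - 2^-1; rewrite -/a.
have a0 : 0 < a by rewrite subr_gt0.
have a1 : a < 2^-1 by rewrite /a; move: H1; lra.
have -> : 2^-1 - H = - a by rewrite /a; field.
have -> : (0 < - a) = false by apply/negbTE; rewrite -leNgt oppr_le0 ltW.
rewrite opprK => -[_ Ik] Kk chi0.
have Ga : 0 < Gamma a by apply: Gamma_gt0; apply/andP; split => //; move: a1; lra.
pose eta s := (C1 H)^-1 * cut ht' s.
have lay : {ae mu, forall s, 0 < s ->
    (\int[mu]_y ((0 < y)%R%:R * KNpos a (level K y) s)%:E = (eta s)%:E)%E}.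
  apply: layer_KNpos => //; apply: aeW Ik _ => s Iks s0.
  have [iks Es] := Iks s0.
  have igt := integrable_gt iks.
  have -> : Gamma a * (pw a s * eta s) =
      \int[mu]_u ((C1 H)^-1 * ((u - s) `^ (a - 1) * k u * (s < u)%R%:R)).
    rewrite RintegralZlT; last exact: Rintegrable_measurable igt.
    rewrite -Rintegral_gt /eta cutE// (pwE _ s0).
    have := Es; have := lt0r_neq0 Ga.
    move: (Rintegral _ _ _) (Gamma a) (s `^ a) (C1 H)^-1 => w g x c g0 xE.
    transitivity (g * c * (x * ht' s)); first by ring.
    by rewrite xE; field.
  rewrite /Rintegral fineK; last first.
    apply: integrable_fin_num => //.
    exact (RintegrableZ measurableT (C1 H)^-1 igt).
  have mcK := measurable_nonincreasing_cut Kanti.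
  transitivity (\int[mu]_v (pw (a - 1) (v - s) * (pw a v * cut K v))%:E)%E.
    apply: eq_integral => v _; congr EFin.
    by have [v0|v0] := leP v 0; [rewrite (pw_le0 _ v0) !mul0r|rewrite cutE].
  apply: ae_eq_integral => //.
  - by meas.
  - exact (measurable_int _ (RintegrableZ measurableT (C1 H)^-1 igt)).
  - apply: ae_eqI; apply: aeW Kk _ => v Kv; congr EFin.
    have [vs|sv] := leP v s; first by rewrite (pw_le0 _ (_ : v - s <= 0)) ?subr_le0// mul0r !mulr0.
    have v0 := lt_trans s0 sv.
    rewrite cutE// Kv// -(pwE (- a) v0) (pwE (a - 1)) ?subr_gt0//.
    have := pwV a v0; move: (pw a v) (pw (- a) v) (k v) (_ `^ _) (C1 H)^-1 => x y z w c yx.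
    transitivity (w * c * z * (y * x)); first by ring.
    by rewrite yx /= !mulr1; ring.
have iche : mu.-integrable setT (EFin \o (fun s => chi s * eta s)).
  by apply: L2p_mul => //; exact: L2pZ.
have chi_le0 s : s <= 0 -> chi s = 0 by case: Lchi => _ + _; exact.
have E := @layer_pairing _ K Kb (KNpos a) chi eta (@measurable_KNpos R a)
  (KNpos_ge0 a0 a1) mchi chi_le0 iche lay.
have -> : \int[mu]_s (chi s * cut ht' s) = C1 H * \int[mu]_s (chi s * eta s).
  rewrite -RintegralZlT; last exact: Rintegrable_measurable iche.
  apply: eq_Rintegral => s _; rewrite /eta; have := lt0r_neq0 C10.
  by move: (C1 H) => c c0; field.
rewrite E; apply: mulr_ge0; first exact: ltW.
apply: Rintegral_ge0 => y _; apply: mulr_ge0 => //; apply: chi0.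
exact: level_ge0.
Qed.

End kernel_pairing.

Section pairing_neg.
Context {R : realType}.
Notation mu := (@lebesgue_measure R).
Local Opaque Gamma pw KNneg KNpos.
Variable H : R.
Hypotheses (H0 : 0 < H) (H1 : H < 1) (Hh : H != 2^-1).

(* Abel transforms are inverted on integrable functions only, hence the truncation of
   ht' at T, which subtracts from K the nondecreasing function E on (0, T). *)
Lemma Kright_star_pairing_neg (K ht' chi : R -> R) : H < 2^-1 -> L2p (cut ht') -> L2p chi ->
  (forall s, 0 < s -> 0 <= ht' s) -> Kright_star H ht' K ->
  (forall s t : R, 0 < s -> s <= t -> K t <= K s) ->
  (forall t, 0 <= t -> 0 <= \int[mu]_s (KN H t s * chi s)) ->
  0 <= \int[mu]_s (chi s * cut ht' s).
Proof.
move=> Hlt Lht Lchi ht0 [kk Ik Kk] Kanti chi0.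
have C10 := C1_gt0 H0 H1.
have mht : measurable_fun setT (cut ht') by case: Lht.
have mchi : measurable_fun setT chi by case: Lchi.
have chi_le0 s : s <= 0 -> chi s = 0 by case: Lchi => _ + _; exact.
have cht0 s : 0 <= cut ht' s.
  by have [s0|s0] := leP s 0; [rewrite cut_le0|rewrite cutE// ht0].
apply: Rintegral_lt_ge0; first exact: L2p_mul.
move=> T T0.
move: Ik Kk chi0; rewrite /I_right /KN Hlt.
pose b := 2^-1 - H; rewrite -/b.
have b0 : 0 < b by rewrite subr_gt0.
have b12 : b < 2^-1 by rewrite /b; move: H0; lra.
have -> : H - 2^-1 = - b by rewrite /b; field.
rewrite b0 => Ik Kk chi0.
have Gb : 0 < Gamma b by apply: Gamma_gt0; apply/andP; split => //; move: b12; lra.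
pose c := (C1 H)^-1 * (Gamma b)^-1.
have c0 : 0 < c by rewrite mulr_gt0 ?invr_gt0.
pose G u s := pw (b - 1) (s - u) * (pw (- b) s * cut ht' s).
have G0 u s : 0 <= G u s.
  exact: mulr_ge0 (pw_ge0 _ _) (mulr_ge0 (pw_ge0 _ _) (cht0 s)).
have mG (u : R) : measurable_fun setT (G u) by rewrite /G; meas.
have GE u : 0 < u -> forall s, (s - u) `^ (b - 1) * (s `^ (- b) * ht' s) * (u < s)%R%:R = G u s.
  move=> u0 s; have [us|su] := ltP u s; last first.
    by rewrite /G (pw_le0 _ (_ : s - u <= 0)) ?subr_le0// mul0r mulr0.
  have s0 := lt_trans u0 us.
  by rewrite mulr1 /G cutE// !pwE// subr_gt0.
have good : {ae mu, forall u, 0 < u -> mu.-integrable setT (EFin \o G u) /\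
    K u = c * pw b u * \int[mu]_s G u s}.
  apply: aeW (aeI Ik Kk) _ => u [Iu Ku] u0; have [iu Eu] := Iu u0; split.
    have := integrable_gt iu; congr (is_true (mu.-integrable _ _)).
    by apply/funext => s /=; rewrite GE.
  rewrite Ku// Eu Rintegral_gt (pwE _ u0) /c.
  under eq_Rintegral do rewrite GE//.
  by move: (C1 H)^-1 (Gamma b)^-1 (Rintegral _ _ _) => x y z; ring.
(* For [s >= T] both [pw b u] and [pw (b - 1) (s - u)] increase with [u < T]. The part of [K] due to
   [s >= T] is thus nondecreasing, and removing it preserves the monotonicity of [K]. *)
have tail_le u1 u2 s : 0 < u1 -> u1 <= u2 -> u2 < T ->
    pw b u1 * (G u1 s * (T <= s)%R%:R) <= pw b u2 * (G u2 s * (T <= s)%R%:R).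
  move=> u10 u12 u2T; have [Ts|sT] := leP T s; last by rewrite !mulr0.
  have su2 : 0 < s - u2 by rewrite subr_gt0 (lt_le_trans u2T).
  rewrite !mulr1; apply: ler_pM; rewrite ?pw_ge0 ?G0//.
    by apply: pw_mono => //; exact: ltW.
  apply: ler_wpM2r; first exact: mulr_ge0 (pw_ge0 _ _) (cht0 s).
  by apply: pw_anti => //; [move: b12; lra|rewrite lerD2l lerN2].
(* Integrability of [G u] is known for almost every [u] only; a good [v] in [(u, T)] dominates the
   tail at an arbitrary [u]. *)
have tail_int u : 0 < u -> u < T ->
    mu.-integrable setT (EFin \o (fun s => pw b u * (G u s * (T <= s)%R%:R))).
  move=> u0 uT; have [v /andP[uv vT] gv] := ae_dense good uT.
  have [iv _] := gv (lt_trans u0 uv).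
  apply: (@le_Rintegrable _ _ _ (fun s => pw b v * G v s)).
  - exact: measurableT.
  - apply: measurable_funM; [meas|apply: measurable_funM; first exact: mG].
    have -> : (fun s => (T <= s)%R%:R : R) = (fun s => 1 - (s < T)%R%:R).
      by apply/funext => s; case: leP => _; rewrite ?subr0 ?subrr.
    by meas.
  - move=> s _; rewrite ger0_norm; last by apply: mulr_ge0 (pw_ge0 _ _) (mulr_ge0 (G0 _ _) _).
    apply: le_trans (tail_le u v s u0 (ltW uv) vT) _.
    apply: ler_wpM2l; first exact: pw_ge0.
    by case: (leP T s) => _; rewrite ?mulr1 ?mulr0.
  - exact: RintegrableZ.
pose E u := c * \int[mu]_s (pw b u * (G u s * (T <= s)%R%:R)).
have E_mono u1 u2 : 0 < u1 -> u1 <= u2 -> u2 < T -> E u1 <= E u2.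
  move=> u10 u12 u2T; apply: ler_wpM2l; first exact: ltW.
  apply: le_Rintegral.
  - exact: measurableT.
  - exact (tail_int u1 u10 (le_lt_trans u12 u2T)).
  - exact (tail_int u2 (lt_le_trans u10 u12) u2T).
  - by move=> s _; exact: tail_le.
(* On [(0, T)], [k] agrees almost everywhere with the transform of [ht'] cut at [T], in a version
   that is nonincreasing at every point, as the layer-cake formula requires. *)
pose k u := (u < T)%R%:R * (K u - E u).
have goodk : {ae mu, forall u, 0 < u -> u < T ->
    mu.-integrable setT (EFin \o (fun s => G u s * (s < T)%R%:R)) /\
    k u = c * pw b u * \int[mu]_s (G u s * (s < T)%R%:R)}.
  apply: aeW good _ => u gu u0 uT; have [iu Ku] := gu u0.
  have ih : mu.-integrable setT (EFin \o (fun s => G u s * (s < T)%R%:R)).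
    apply: le_Rintegrable iu => //; first by have := mG u; move: (G u) => g mg; meas.
    move=> s _; rewrite ger0_norm; last exact: mulr_ge0.
    by case: (ltP s T) => _; rewrite ?mulr1 ?mulr0.
  split => //; rewrite /k uT mul1r Ku /E -!(mulrA c (pw b u)) -mulrBr; congr (_ * _).
  rewrite -!RintegralZlT; last 2 first.
  - by have := mG u; move: (G u) => g mg; meas.
  - exact: mG.
  rewrite -RintegralB//.
  - apply: eq_Rintegral => s _; rewrite -mulrBr; congr (_ * _).
    by case: ltP => _; rewrite ?mulr0 ?mulr1 ?subr0 ?subrr.
  - exact (RintegrableZ measurableT (pw b u) iu).
  - exact: tail_int.
have k_anti' s t : 0 < s -> s <= t -> t < T -> k t <= k s.
  move=> s0 st tT; have sT := le_lt_trans st tT.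
  have kE u : u < T -> k u = K u - E u by move=> uT; rewrite /k uT mul1r.
  rewrite (kE s sT) (kE t tT).
  by apply: lerB; [exact: Kanti|exact: E_mono].
(* At good points [k] is a multiple of the integral of a nonnegative function; monotonicity carries
   the sign to every point on their left. *)
have k_ge0 s : 0 < s -> 0 <= k s.
  move=> s0; have [Ts|sT] := leP T s; first by rewrite /k ltNge Ts mul0r.
  have [v /andP[sv vT] gv] := ae_dense goodk sT.
  have v0 := lt_trans s0 sv; have [_ kv] := gv v0 vT.
  apply: le_trans (k_anti' s v s0 (ltW sv) vT); rewrite kv.
  apply: mulr_ge0; first by rewrite mulr_ge0 ?pw_ge0 ?(ltW c0).
  by apply: Rintegral_ge0 => x _; apply: mulr_ge0.
have k_anti s t : 0 < s -> s <= t -> k t <= k s.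
  move=> s0 st; have [Tt|tT] := leP T t; last exact: k_anti'.
  by rewrite {1}/k ltNge Tt mul0r k_ge0.
have k_bounded y : 0 < y -> exists M, forall s, M < s -> k s <= y.
  by move=> y0; exists T => s Ts; rewrite /k ltNge (ltW Ts) mul0r ltW.
pose eta s := (C1 H)^-1 * (cut ht' s * (s < T)%R%:R).
have eta0 s : 0 <= eta s.
  by apply: mulr_ge0; [rewrite invr_ge0 ltW|exact: mulr_ge0].
have b2 : 0 <= b < 2^-1 by rewrite (ltW b0).
have lay : {ae mu, forall s, 0 < s ->
    (\int[mu]_y ((0 < y)%R%:R * KNneg b (level k y) s)%:E = (eta s)%:E)%E}.
  apply: layer_KNneg => //.
    have := RintegrableZ measurableT (C1 H)^-1 (L2p_mul (L2p_pw_lt T b2) Lht).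
    congr (is_true (mu.-integrable _ _)); apply/funext => s /=; congr EFin.
    by rewrite /eta; move: (C1 H)^-1 => x; ring.
  apply: aeW goodk _ => u gu u0.
  have GEeta s : pw (b - 1) (s - u) * (pw (- b) s * eta s) = (C1 H)^-1 * (G u s * (s < T)%R%:R).
    by rewrite /eta /G; move: (C1 H)^-1 => x; ring.
  have [Tu|uT] := leP T u.
    rewrite /k ltNge Tu mul0r !mulr0 integral0_eq// => s _.
    rewrite GEeta; have [sT|] := ltP s T; last by rewrite !mulr0.
    by rewrite /G (pw_le0 _ (_ : s - u <= 0)) ?mul0r ?mulr0// subr_le0 ltW// (lt_le_trans sT).
  have [ih ->] := gu u0 uT.
  transitivity ((\int[mu]_s ((C1 H)^-1 * (G u s * (s < T)%R%:R)))%:E).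
    rewrite /Rintegral fineK; last first.
      by apply: integrable_fin_num => //; exact (RintegrableZ measurableT (C1 H)^-1 ih).
    by apply: eq_integral => s _; rewrite GEeta.
  rewrite RintegralZlT; last exact: Rintegrable_measurable ih.
  congr EFin; rewrite /c; have := pwV b u0; have := lt0r_neq0 Gb.
  move: (pw b u) (pw (- b) u) (Gamma b) (C1 H)^-1 (Rintegral _ _ _) => x y g d w g0 yx.
  transitivity (y * x * (d * w)); last by field.
  by rewrite yx mul1r.
have iche : mu.-integrable setT (EFin \o (fun s => chi s * eta s)).
  have iq := L2p_mul Lchi Lht.
  have iqT : mu.-integrable setT (EFin \o (fun s => chi s * cut ht' s * (s < T)%R%:R)).
    apply: le_Rintegrable (integrable_norm iq) => //; first by meas.
    by move=> s _ /=; case: ltP => _; rewrite ?mulr1 ?mulr0 ?normr0.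
  have := RintegrableZ measurableT (C1 H)^-1 iqT.
  congr (is_true (mu.-integrable _ _)); apply/funext => s /=; congr EFin.
  by rewrite /eta; move: (C1 H)^-1 => x; ring.
have EE := @layer_pairing _ k k_bounded (KNneg b) chi eta (@measurable_KNneg R b)
  (KNneg_ge0 b0 b12) mchi chi_le0 iche lay.
have -> : \int[mu]_s (chi s * cut ht' s * (s < T)%R%:R) = C1 H * \int[mu]_s (chi s * eta s).
  rewrite -RintegralZlT; last exact: Rintegrable_measurable iche.
  apply: eq_Rintegral => s _; rewrite /eta; have := lt0r_neq0 C10.
  by move: (C1 H) (cut ht' s) (_%:R) => d x y d0; field.
rewrite EE; apply: mulr_ge0; first exact: ltW.
apply: Rintegral_ge0 => y _; apply: mulr_ge0 => //; apply: chi0.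
exact: level_ge0.
Qed.

End pairing_neg.

(** * Least concave majorants *)

Section concave_majorant.
Context {R : realType}.
Notation mu := (@lebesgue_measure R).

Lemma RplusE (x : R) : (x \in Rplus) = (0 <= x).
Proof. by rewrite /Rplus; apply/idP/idP; rewrite inE/= in_itv/= andbT. Qed.

Lemma concaveP (m : R -> R) : convex_function Rplus (fun t => - m t : R^o) <->
  forall t x y, 0 <= t -> t <= 1 -> 0 <= x -> 0 <= y ->
    t * m x + (1 - t) * m y <= m (t * x + (1 - t) * y).
Proof.
split=> [cm t x y t0 t1 x0 y0|cm t x y].
  have := cm (Itv01 t0 t1) x y; rewrite !RplusE => /(_ x0 y0).
  by rewrite !convRE/= !mulrN -opprD lerN2.
rewrite !RplusE => x0 y0.
rewrite !convRE/= !mulrN -opprD lerN2.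
exact: cm.
Qed.

Lemma concave_majorant_affine (h : R -> R) (p c : R) : 0 <= p ->
  (forall t, 0 <= t -> h t <= p * t + c) ->
  concave_nondecreasing_majorant h (fun t => p * t + c).
Proof.
move=> p0 hle; split=> //.
- by apply/concaveP => t x y *; rewrite le_eqVlt; apply/orP; left; apply/eqP; ring.
- by move=> x y _ _ xy; rewrite lerD2r ler_wpM2l.
Qed.

Lemma concave_majorant_min (h m1 : R -> R) (p c : R) :
  convex_function Rplus (fun t => - m1 t : R^o) ->
  {in Rplus &, {homo m1 : s t / s <= t}} -> 0 <= p ->
  (forall t, 0 <= t -> h t <= m1 t) -> (forall t, 0 <= t -> h t <= p * t + c) ->
  concave_nondecreasing_majorant h (fun t => Num.min (m1 t) (p * t + c)).
Proof.
move=> /concaveP c1 n1 p0 h1 h2; split.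
- apply/concaveP => t x y t0 t1 x0 y0.
  have t1' : 0 <= 1 - t by rewrite subr_ge0.
  rewrite le_min; apply/andP; split.
    apply: le_trans (c1 t x y t0 t1 x0 y0).
    by apply: lerD; apply: ler_wpM2l => //; rewrite ge_min lexx.
  have -> : p * (t * x + (1 - t) * y) + c = t * (p * x + c) + (1 - t) * (p * y + c) by ring.
  by apply: lerD; apply: ler_wpM2l => //; rewrite ge_min lexx orbT.
- move=> x y xR yR xy; rewrite le_min !ge_min n1//=; apply/orP; right.
  by rewrite lerD2r ler_wpM2l.
- by move=> t t0; rewrite le_min h1//= h2.
Qed.

Section slopes.
Variables (m m' : R -> R).
Hypotheses (cm : convex_function Rplus (fun t => - m t : R^o))
  (nm : {in Rplus &, {homo m : s t / s <= t}}) (dm : right_derivative m m').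

Lemma concave_slopes x y z : 0 <= x -> x < y -> y < z ->
  (m z - m x) * (y - x) <= (m y - m x) * (z - x) /\
  (m z - m y) * (z - x) <= (m z - m x) * (z - y).
Proof.
move=> x0 xy yz.
have zx : 0 < z - x by rewrite subr_gt0 (lt_trans xy).
have yx0 : 0 < y - x by rewrite subr_gt0.
have zy0 : 0 < z - y by rewrite subr_gt0.
pose t := (z - y) / (z - x).
have t0 : 0 <= t by rewrite divr_ge0 ?(ltW zy0) ?(ltW zx).
have t1 : t <= 1 by rewrite ler_pdivrMr// mul1r; lra.
have z0 : 0 <= z by rewrite (le_trans x0)// ltW// (lt_trans xy).
have := (concaveP m).1 cm t x z t0 t1 x0 z0.
have -> : t * x + (1 - t) * z = y.
  by rewrite /t; field; apply: lt0r_neq0.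
move=> h; have := ler_wpM2r (ltW zx) h.
have -> : (t * m x + (1 - t) * m z) * (z - x) = (z - y) * m x + (y - x) * m z.
  by rewrite /t; field; apply: lt0r_neq0.
by move=> {}h; split; nra.
Qed.

Lemma le_right_derivative s t : 0 < s -> s < t -> m t - m s <= m' s * (t - s).
Proof.
move=> s0 st; have ts : 0 < t - s by rewrite subr_gt0.
rewrite -ler_pdivrMr//; have cv := dm s0.
rewrite -(cvg_lim (@Rhausdorff R) cv); apply: limr_ge; first by apply/cvg_ex; exists (m' s).
near=> e; rewrite ler_pdivrMr// -mulrA ler_pdivlMl.
  have [] := @concave_slopes s (s + e) t (ltW s0) _ _.
  - by rewrite ltrDl; near: e; exact: nbhs_right_gt.
  - by rewrite -ltrBrDl; near: e; exact: nbhs_right_lt.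
  by rewrite addrAC subrr add0r (mulrC e).
by near: e; exact: nbhs_right_gt.
Unshelve. all: by end_near.
Qed.

Lemma ge_right_derivative s t : 0 <= s -> s < t -> m' t * (t - s) <= m t - m s.
Proof.
move=> s0 st; have ts : 0 < t - s by rewrite subr_gt0.
rewrite -ler_pdivlMr//; have cv := dm (le_lt_trans s0 st).
rewrite -(cvg_lim (@Rhausdorff R) cv); apply: limr_le; first by apply/cvg_ex; exists (m' t).
near=> e; have e0 : 0 < e by near: e; exact: nbhs_right_gt.
rewrite ler_pdivlMr// -mulrA ler_pdivrMl//.
have te : t < t + e by rewrite ltrDl.
have [h1 h2] := concave_slopes s0 st te.
have : m (t + e) - m s = (m (t + e) - m t) + (m t - m s) by ring.
have : t + e - t = e by ring.
have : t + e - s = e + (t - s) by ring.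
move: h1 h2 => + + E1 E2 E3; rewrite E1 E2 E3.
move: (m (t + e) - m t) (m t - m s) (t - s) => p q r; nra.
Unshelve. all: by end_near.
Qed.

Lemma right_derivative_ge0 s : 0 < s -> 0 <= m' s.
Proof.
move=> s0; have h : s < s + 1 by rewrite ltrDl.
have := le_right_derivative s0 h; rewrite addrAC subrr add0r mulr1; apply: le_trans.
rewrite subr_ge0; apply: nm; rewrite ?RplusE; lra.
Qed.

Lemma right_derivative_anti s t : 0 < s -> s <= t -> m' t <= m' s.
Proof.
move=> s0; rewrite le_eqVlt => /orP[/eqP -> //|st].
have ts : 0 < t - s by rewrite subr_gt0.
rewrite -(ler_pM2r ts).
exact: le_trans (ge_right_derivative (ltW s0) st) (le_right_derivative s0 st).
Qed.

Lemma concave_lipschitz c x y : 0 < c -> c <= x -> x <= y -> `|m y - m x| <= m' c * (y - x).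
Proof.
move=> c0 cx; have x0 := lt_le_trans c0 cx.
rewrite le_eqVlt => /orP[/eqP ->|xy]; first by rewrite !subrr normr0 mulr0.
rewrite ger0_norm.
  apply: le_trans (le_right_derivative x0 xy) _.
  by apply: ler_wpM2r; [rewrite subr_ge0 ltW|exact: right_derivative_anti].
by rewrite subr_ge0; apply: nm; rewrite ?RplusE; lra.
Qed.

Lemma concave_continuous x : 0 < x -> {for x, continuous m}.
Proof.
move=> x0; apply/cvgrPdist_lt => e e0.
have c0 : 0 < x / 2 by rewrite divr_gt0.
have L0 := right_derivative_ge0 c0.
have d0 : 0 < Num.min (x / 2) (e / (m' (x / 2) + 1)).
  by rewrite lt_min c0 divr_gt0// ltr_wpDl.
near=> y; have yx : `|x - y| < Num.min (x / 2) (e / (m' (x / 2) + 1)).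
  near: y; exact: (@cvgr_dist_lt _ _ _ _ _ _ _ cvg_id _ d0).
move: yx; rewrite lt_min => /andP[y1]; rewrite ltr_pdivlMr ?ltr_wpDl// => y2.
have h : `|m x - m y| <= m' (x / 2) * `|x - y|.
  have [xy|yx] := leP x y.
    rewrite distrC (distrC x y) (ger0_norm (_ : 0 <= y - x)) ?subr_ge0//.
    by apply: concave_lipschitz => //; lra.
  rewrite (ger0_norm (_ : 0 <= x - y)) ?subr_ge0 ?(ltW yx)//.
  apply: concave_lipschitz => //; last exact: ltW.
  by move: y1; rewrite ger0_norm ?subr_ge0 ?(ltW yx)//; lra.
by apply: le_lt_trans h _; have := normr_ge0 (x - y); nra.
Unshelve. all: by end_near.
Qed.

End slopes.
End concave_majorant.

Section least_majorant.
Context {R : realType}.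
Notation mu := (@lebesgue_measure R).
Local Opaque pw.

Lemma layer_indicator (k chi : R -> R) :
  (forall s, 0 < s -> 0 <= k s) -> (forall s t, 0 < s -> s <= t -> k t <= k s) ->
  (forall y, 0 < y -> exists M, forall s, M < s -> k s <= y) ->
  measurable_fun setT chi -> (forall s, s <= 0 -> chi s = 0) ->
  mu.-integrable setT (EFin \o (fun s => chi s * cut k s)) ->
  \int[mu]_s (chi s * cut k s) =
  \int[mu]_y ((0 < y)%R%:R * \int[mu]_s (chi s * (s < level k y)%R%:R)).
Proof.
move=> k0 kanti kb mchi chi0 ichi.
have mN : measurable_fun [set: R * R] (fun z => (z.2 < z.1)%R%:R : R) by meas.
have lay : {ae mu, forall s, 0 < s ->
    (\int[mu]_y ((0 < y)%R%:R * (s < level k y)%R%:R)%:E = (cut k s)%:E)%E}.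
  apply: aeW (integral_level k0 kanti kb) _ => s ks s0.
  by rewrite ks// cutE.
have N0 (t s : R) : 0 <= (s < t)%R%:R :> R by [].
have -> := @layer_pairing _ k kb (fun t s => (s < t)%R%:R) chi (cut k) mN N0 mchi chi0 ichi lay.
apply: eq_Rintegral => y _; congr (_ * _); apply: eq_Rintegral => s _; exact: mulrC.
Qed.

(** The pointwise bound [|q| <= e + q ^+ 2 / e] stands in for the Cauchy-Schwarz inequality. Being
    affine in [t - s], the resulting estimate also provides affine majorants of the primitive. *)
Lemma primitive_modulus (q : R -> R) e s t : L2p q -> 0 < e -> 0 <= s -> s <= t ->
  `|\int[mu]_x (q x * (x < t)%R%:R) - \int[mu]_x (q x * (x < s)%R%:R)| <=
  e * (t - s) + (\int[mu]_x (q x ^+ 2)) / e.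
Proof.
move=> Lq e0 s0 st; have t0 := le_trans s0 st.
have it := L2p_integrable_lt t Lq; have is_ := L2p_integrable_lt s Lq.
case: (Lq) => mq q_le0 iq2.
have i01 r : 0 <= r -> mu.-integrable setT (EFin \o (fun x : R => (0 < x)%R%:R * (x < r)%R%:R)) /\
    \int[mu]_x ((0 < x)%R%:R * (x < r)%R%:R) = r.
  move=> r0; have E := integral_lt_natr r0; split; last by rewrite /Rintegral E.
  apply/integrableP; split; first by apply/measurable_EFinP; meas.
  by under eq_integral do rewrite gee0_abs ?lee_fin//; rewrite E ltry.
have [i1t E1t] := i01 t t0; have [i1s E1s] := i01 s s0.
rewrite -RintegralB//.
have ib := RintegrableD measurableT (RintegrableZ measurableT e (RintegrableB measurableT i1t i1s))
  (RintegrableZ measurableT e^-1 iq2).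
apply: le_trans (le_normr_Rintegral _ _) _.
- exact: measurableT.
- exact (RintegrableB measurableT it is_).
apply: (@le_trans _ _ (\int[mu]_x (e * ((0 < x)%R%:R * (x < t)%R%:R - (0 < x)%R%:R * (x < s)%R%:R) +
  e^-1 * q x ^+ 2))); last first.
  rewrite RintegralD//; last 2 first.
  - exact (RintegrableZ measurableT e (RintegrableB measurableT i1t i1s)).
  - exact (RintegrableZ measurableT e^-1 iq2).
  rewrite RintegralZl//; last exact (RintegrableB measurableT i1t i1s).
  by rewrite RintegralB// E1t E1s RintegralZl// (mulrC e^-1).
apply: le_Rintegral.
- exact: measurableT.
- exact (integrable_norm (RintegrableB measurableT it is_)).
- exact ib.
move=> x _; rewrite -mulrBr.
have [x0|x0] := leP x 0.
  by rewrite q_le0// mul0r normr0 !mul0r subrr mulr0 add0r expr0n mulr0.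
have ei : 0 <= e^-1 * q x ^+ 2 by rewrite mulr_ge0 ?sqr_ge0// invr_ge0 ltW.
rewrite !mul1r; have [xs|sx] := ltP x s.
  by rewrite (lt_le_trans xs st) subrr !mulr0 normr0 add0r.
rewrite subr0; have [xt|tx] := ltP x t; last by rewrite !mulr0 normr0 add0r.
rewrite !mulr1; have : e * (e^-1 * q x ^+ 2) = q x ^+ 2.
  by rewrite mulrA mulfV ?mul1r// gt_eqF.
rewrite -(real_normK (num_real (q x))); move: `|q x| => w E.
rewrite -subr_ge0 -(pmulr_rge0 _ e0).
have -> : e * (e + e^-1 * w ^+ 2 - w) = e * e + e * (e^-1 * w ^+ 2) - e * w by ring.
by rewrite E; have := sqr_ge0 (e - w); have := sqr_ge0 (e + w); nra.
Qed.

Variables (q m m' : R -> R).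
Hypotheses (Lq : L2p q) (Lm' : L2p (cut m')).

Let h (t : R) : R := \int[mu]_x (q x * (x < t)%R%:R).
Let B := \int[mu]_x (q x ^+ 2).

Hypotheses (mh : least_concave_nondecreasing_majorant h m)
  (dm : right_derivative m m').

Let B0 : 0 <= B. Proof. by apply: Rintegral_ge0 => x _; exact: sqr_ge0. Qed.

Let h0 : h 0 = 0.
Proof.
rewrite /h /Rintegral integral0_eq// => x _.
case: ltP => x0; last by rewrite mulr0.
by case: Lq => _ -> //; [rewrite mul0r|exact: ltW].
Qed.

Let cm : convex_function Rplus (fun t => - m t : R^o). Proof. by case: mh => -[]. Qed.

Let nm : {in Rplus &, {homo m : s t / s <= t}}. Proof. by case: mh => -[]. Qed.

Let hm t : 0 <= t -> h t <= m t. Proof. by case: mh => -[_ _ + _]; exact. Qed.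

(** The affine bounds on [h] are admissible majorants and hence lie above [m]. Steep ones give
    [m 0 = 0] and continuity at 0; flat ones show that [m'] tends to 0 at infinity. *)
Let m_le e t : 0 < e -> 0 <= t -> m t <= e * t + B / e.
Proof.
move=> e0 t0; refine (mh.2 (fun t => e * t + B / e) _ t t0).
apply: concave_majorant_affine; first exact: ltW.
move=> {t0}t t0; have := primitive_modulus Lq e0 (lexx 0) t0.
rewrite -/(h t) -/(h 0) h0 !subr0 -/B; exact: le_trans (ler_norm _).
Qed.

Let m0 : m 0 = 0.
Proof.
apply/eqP; rewrite eq_le -{3}h0 hm// andbT; apply/ler_addgt0Pr => e e0.
(* With slope [(B + 1) / e] the constant term is at most [e]; [B + 1] keeps the slope positive when
   [B = 0]. *)
have := @m_le ((B + 1) / e) 0; rewrite mulr0 !add0r divr_gt0 ?ltr_wpDl// => /(_ isT (lexx _)).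
move=> /le_trans; apply; rewrite invf_div mulrCA ler_piMr ?(ltW e0)//.
by rewrite ler_pdivrMr ?ltr_wpDl// mul1r lerDl.
Qed.

Let m'_ge0 s : 0 < s -> 0 <= m' s. Proof. exact: (right_derivative_ge0 cm nm dm). Qed.

Let m'_anti s t : 0 < s -> s <= t -> m' t <= m' s.
Proof. exact: (right_derivative_anti cm dm). Qed.

Let m'_bounded y : 0 < y -> exists M, forall s, M < s -> m' s <= y.
Proof.
move=> y0; pose e := y / 2; have e0 : 0 < e by rewrite divr_gt0.
exists (B / e / e) => s Ms.
have s0 : 0 < s by exact: le_lt_trans (divr_ge0 (divr_ge0 B0 (ltW e0)) (ltW e0)) Ms.
have := ge_right_derivative cm dm (lexx 0) s0; rewrite m0 !subr0 => h1.
have h2 := m_le e0 (ltW s0).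
have h3 : B / e < s * e by rewrite -ltr_pdivrMr.
have ey : y = e + e by rewrite /e; field.
rewrite -(ler_pM2r s0) ey; apply: le_trans h1 (le_trans h2 _); lra.
Qed.

Let m_continuous x : 0 < x -> {for x, continuous m}.
Proof. exact: (concave_continuous cm nm dm). Qed.

(** The slope of [m] may be infinite at 0, so the Lipschitz bound for concave functions fails there
    and [m_le] with a steep slope replaces it. *)
Let m_within t : 0 < t -> {within `[0, t], continuous m}.
Proof.
move=> t0; apply/continuous_within_itvP => //; split.
- by move=> x; rewrite in_itv/= => /andP[x0 _]; exact: m_continuous.
- rewrite m0; apply/cvgrPdist_le => e e0.
  pose p := (B + 1) / (e / 2).
  have p0 : 0 < p by rewrite divr_gt0 ?divr_gt0// ltr_wpDl.
  have Bp : B / p <= e / 2.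
    rewrite /p invf_div mulrCA ler_piMr ?(ltW (divr_gt0 e0 _))//.
    by rewrite ler_pdivrMr ?ltr_wpDl// mul1r lerDl.
  have ep : 0 < e / 2 / p by apply: divr_gt0 p0; exact: divr_gt0.
  near=> x; have x0 : 0 < x by near: x; exact: nbhs_right_gt.
  have xe : x < e / 2 / p by near: x; apply: nbhs_right_lt; exact: ep.
  have mx0 : 0 <= m x by rewrite -m0 nm ?RplusE// ltW.
  rewrite sub0r normrN ger0_norm//; apply: le_trans (m_le p0 (ltW x0)) _.
  by move: xe; rewrite ltr_pdivlMr// mulrC; lra.
- by apply: cvg_at_left_filter; exact: m_continuous.
Unshelve. all: by end_near.
Qed.

Lemma primitive_right_derivative t : 0 <= t ->
  \int[mu]_x (cut m' x * (x < t)%R%:R) = m t.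
Proof. by apply: ftc_cut => //; exact: m_within. Qed.

(* At a point where the slope of m crosses y, a gap between m and h would allow cutting
   the corner of m along a chord. *)
Lemma least_majorant_touch y : 0 < y -> m (level m' y) = h (level m' y).
Proof.
move=> y0; set tau := level m' y.
have : 0 <= tau by exact: (level_ge0 m'_bounded).
rewrite le_eqVlt => /orP[/eqP <-|tau0]; first by rewrite m0 h0.
apply/eqP; rewrite eq_le hm ?(ltW tau0)// andbT leNgt; apply/negP => gap.
pose g := m tau - h tau; have g0 : 0 < g by rewrite subr_gt0.
have mtau := m_continuous tau0.
(* Half of the gap [g] is allotted to the variation of [m] and half to that of [h], so on the window
   [[tau - d, tau + d]] the function [h] stays below [m (tau - d)], the lower end of the chord. *)
have [d [d0 dtau dm_ dh]] : exists d, [/\ 0 < d, d < tau, m tau - g / 2 <= m (tau - d) &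
    forall x, tau - d <= x -> x <= tau + d -> h x <= h tau + g / 2].
  (* In [primitive_modulus] each of the two terms [e * d] and [B / e] is to be at most [g / 4]. *)
  pose e := 4 * (B + 1) / g.
  have B1 : 0 < B + 1 by rewrite ltr_wpDl.
  have e0 : 0 < e by apply: divr_gt0 => //; exact: mulr_gt0.
  have Be : B / e <= g / 4.
    rewrite ler_pdivrMr//; have -> : g / 4 * e = B + 1; last by rewrite lerDl.
    by rewrite /e; field; exact: lt0r_neq0.
  have /cvgrPdist_le/(_ _ (divr_gt0 g0 (ltr0n R 2)))/nbhs_ballP[d1 /= d10 hd1] := mtau.
  pose d := Num.min (d1 / 2) (Num.min (tau / 2) (g / 4 / e)).
  have d0 : 0 < d.
    by rewrite /d !lt_min; apply/and3P; split; [exact: divr_gt0|exact: divr_gt0|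
      apply: divr_gt0 e0; exact: divr_gt0].
  have dd1 : d <= d1 / 2 by rewrite /d ge_min lexx.
  have dt : d <= tau / 2 by rewrite /d !ge_min lexx orbT.
  have de : d * e <= g / 4 by rewrite -ler_pdivlMr// /d !ge_min lexx !orbT.
  exists d; split => //; first by lra.
    have := hd1 (tau - d); rewrite /ball/= => hh.
    have := hh _; rewrite opprB addrC subrK (ger0_norm (ltW d0)) => /(_ _) hh2.
    have : `|m tau - m (tau - d)| <= g / 2 by apply: hh2; lra.
    by have := ler_norm (m tau - m (tau - d)); lra.
  move=> x dx xd.
  have : `|h x - h tau| <= e * d + B / e.
    have [xt|tx] := leP x tau.
      rewrite distrC; apply: le_trans (primitive_modulus Lq e0 _ xt) _; first by lra.
      by rewrite lerD2r ler_wpM2l ?(ltW e0)//; lra.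
    apply: le_trans (primitive_modulus Lq e0 (ltW tau0) (ltW tx)) _.
    by rewrite lerD2r ler_wpM2l ?(ltW e0)//; lra.
  by have := ler_norm (h x - h tau); lra.
pose a := m (tau - d); pose b := m (tau + d).
have td0 : 0 < tau - d by rewrite subr_gt0.
have ab : a <= b by apply: nm; rewrite ?RplusE; lra.
(* The affine function through the graph of [m] over [tau - d] and [tau + d]. Outside the window
   concavity places it above [m], hence above [h]. *)
pose p := (b - a) / (2 * d); pose c := a - p * (tau - d).
have p0 : 0 <= p by rewrite divr_ge0 ?subr_ge0 ?mulr_ge0// ltW.
have pd : p * (2 * d) = b - a by rewrite /p divfK// mulf_neq0// gt_eqF.
have la : p * (tau - d) + c = a by rewrite /c; ring.
have lb : p * (tau + d) + c = b.
  have -> : p * (tau + d) = p * (tau - d) + p * (2 * d) by ring.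
  by rewrite pd /c; ring.
have minmaj : concave_nondecreasing_majorant h (fun t => Num.min (m t) (p * t + c)).
  apply: concave_majorant_min => // x x0.
  have [xl|lx] := ltP x (tau - d).
    have lr : tau - d < tau + d by lra.
    have [sl _] := concave_slopes cm x0 xl lr.
    apply: le_trans (hm x0) _; rewrite -subr_ge0 -(pmulr_lge0 _ (_ : 0 < 2 * d)) ?mulr_gt0//.
    have E : (p * x + c - m x) * (2 * d) = (a - m x) * (2 * d) - p * (2 * d) * (tau - d - x).
      by rewrite /c; ring.
    rewrite E pd; move: sl; rewrite -/a -/b.
    lra.
  have [rx|xr] := ltP (tau + d) x.
    have lr : tau - d < tau + d by lra.
    have [sl _] := concave_slopes cm (ltW td0) lr rx.
    apply: le_trans (hm x0) _; rewrite -subr_ge0 -(pmulr_lge0 _ (_ : 0 < 2 * d)) ?mulr_gt0//.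
    have E : (p * x + c - m x) * (2 * d) = (a - m x) * (2 * d) + p * (2 * d) * (x - (tau - d)).
      by rewrite /c; ring.
    rewrite E pd; move: sl; rewrite -/a -/b.
    lra.
  apply: le_trans (dh x lx xr) _.
  have : p * (tau - d) <= p * x by rewrite ler_wpM2l.
  by move: dm_; rewrite -/a -la /g; lra.
(* Leastness puts [m tau] below the midpoint of the chord, that is [m tau - a <= b - m tau]. This
   contradicts slopes above [y] to the left of [tau] and at most [y] to the right. *)
have ge_mid : m tau <= Num.min (m tau) (p * tau + c).
  by refine (mh.2 (fun t => Num.min (m t) (p * t + c)) minmaj tau _); exact: ltW.
have mid : p * tau + c = (a + b) / 2 by rewrite -la -lb; field.
have above r : 0 < r -> r < tau -> y < m' r.
  by move=> r0; exact: (lt_level m'_anti m'_bounded).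
have below r : tau < r -> m' r <= y.
  move=> taur; rewrite leNgt; apply/negP => yr.
  have := le_level m'_bounded y0 (lt_trans tau0 taur) yr.
  by rewrite leNgt taur.
have left_slope : y * d < m tau - a.
  (* Slopes may decrease to [y] at [tau], so strictness is drawn from the left half of
     [[tau - d, tau]], where they are at least [m' s > y]. On the right half the weak inequality
     suffices. *)
  pose s := tau - d / 2.
  have s0 : 0 < s by rewrite /s; lra.
  have h1 : y * (d / 2) < m s - a.
    have st : tau - d < s by rewrite /s; lra.
    have sd : s - (tau - d) = d / 2 by rewrite /s; field.
    have := ge_right_derivative cm dm (ltW td0) st; rewrite sd; apply: lt_le_trans.
    by rewrite ltr_pM2r ?divr_gt0// above// /s; lra.
  have h2 : y * (d / 2) <= m tau - m s.
    rewrite leNgt; apply/negP => hlt.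
    pose e := y * (d / 2) - (m tau - m s); have e0 : 0 < e by rewrite subr_gt0.
    pose r := tau - Num.min (e / 2 / y) (d / 4).
    have [r1 r2 r3] : [/\ tau - d / 4 <= r, r < tau & y * (tau - r) <= e / 2].
      rewrite /r subKr; split.
      - by rewrite lerD2l lerN2 ge_min lexx orbT.
      - by rewrite ltrBlDr ltrDl lt_min !divr_gt0.
      - by rewrite mulrC -ler_pdivlMr// ge_min lexx.
    have sr : s < r by rewrite /s; lra.
    have g1 := ge_right_derivative cm dm (ltW s0) sr.
    have g2 : m r <= m tau by apply: nm; rewrite ?RplusE; lra.
    have g3 : y * (r - s) <= m' r * (r - s).
      by rewrite ler_wpM2r ?subr_ge0 ?(ltW sr)// ltW// above//; lra.
    have g4 : y * (r - s) = y * (d / 2) - y * (tau - r) by rewrite /s; field.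
    by move: e0 r3; rewrite /e; lra.
  have : y * d = y * (d / 2) + y * (d / 2) by field.
  lra.
have right_slope : b - m tau <= y * d.
  rewrite lerBlDr; apply/ler_addgt0Pr => e e0.
  have /cvgrPdist_le/(_ _ e0)/nbhs_ballP[d1 /= d10 hd1] := mtau.
  pose r := tau + Num.min (d1 / 2) (d / 2).
  have [r1 r2 r3] : [/\ tau < r, r <= tau + d / 2 & r <= tau + d1 / 2].
    by rewrite /r ltrDl !lerD2l !ge_min !lexx orbT lt_min !divr_gt0.
  have r0 := lt_trans tau0 r1.
  have rd : r < tau + d by lra.
  have k1 := le_right_derivative cm dm r0 rd.
  have k2 : m' r * (tau + d - r) <= y * d.
    apply: ler_pM => //; [exact: m'_ge0|lra|exact: below|lra].
  have : `|m tau - m r| <= e.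
    by apply: hd1; rewrite /ball/= distrC ger0_norm; lra.
  have := ler_norm (m r - m tau); rewrite distrC -/b in k1 *; lra.
move: ge_mid; rewrite le_min => /andP[_]; rewrite mid; lra.
Qed.

(** Each layer of [k] contributes the value of [m - h] at its end point. The lemma is meant for
    [k = KN H t] with [H > 2^-1]. *)
Lemma least_majorant_pairing_ge0 (k : R -> R) :
  (forall s, 0 < s -> 0 <= k s) -> (forall s t, 0 < s -> s <= t -> k t <= k s) ->
  (forall y, 0 < y -> exists M, forall s, M < s -> k s <= y) -> L2p (cut k) ->
  0 <= \int[mu]_s ((cut m' s - q s) * cut k s).
Proof.
move=> k0 kanti kb Lk; have Lchi := L2pB Lm' Lq.
rewrite layer_indicator//; last 3 first.
- by case: Lchi.
- by case: Lchi => _ + _; exact.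
- exact: L2p_mul.
apply: Rintegral_ge0 => y _; apply: mulr_ge0 => //.
have l0 := level_ge0 kb y.
under eq_Rintegral do rewrite mulrBl.
rewrite RintegralB//; [|exact: L2p_integrable_lt..].
by rewrite (primitive_right_derivative l0) subr_ge0; exact: hm.
Qed.

Lemma least_majorant_orthogonal : \int[mu]_s ((cut m' s - q s) * cut m' s) = 0.
Proof.
have Lchi := L2pB Lm' Lq.
rewrite layer_indicator//; last 3 first.
- by case: Lchi.
- by case: Lchi => _ + _; exact.
- exact: L2p_mul.
rewrite /Rintegral integral0_eq// => y _; rewrite -/(Rintegral _ _ _).
have [y0|y0] := ltP 0 y; last by rewrite mul0r.
have l0 := level_ge0 m'_bounded y.
under eq_Rintegral do rewrite mulrBl.
rewrite RintegralB//; [|exact: L2p_integrable_lt..].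
by rewrite (primitive_right_derivative l0) least_majorant_touch// subrr mulr0.
Qed.

End least_majorant.

(** * Differentiable functions on the closed half-line *)

Section derivative.
Context {R : realType}.
Notation mu := (@lebesgue_measure R).
Variables f f' : R -> R.
Hypothesis df : derivative_on_Rplus f f'.

Lemma derivative_on_RplusP x e : 0 <= x -> 0 < e -> exists2 d, 0 < d &
  forall s, 0 <= s -> s != x -> `|x - s| < d -> `|f' x - (s - x)^-1 * (f s - f x)| < e.
Proof.
move=> x0 e0; have /cvgrPdist_lt/(_ _ e0)/nbhs_ballP[d /= d0 hd] := df x0.
exists d => // s s0 sx xs; apply: hd => //=.
by rewrite /Rplus /= in_itv/= s0.
Qed.

Lemma derivative_on_Rplus_lipschitz x : 0 <= x -> exists2 d, 0 < d &
  exists2 L, 0 < L & forall s, 0 <= s -> `|x - s| < d -> `|f x - f s| <= L * `|x - s|.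
Proof.
move=> x0; have [d d0 hd] := derivative_on_RplusP x0 ltr01.
exists d => //; exists (`|f' x| + 1); first by rewrite ltr_wpDl.
move=> s s0 xs; have [->|sx] := eqVneq s x; first by rewrite !subrr normr0 mulr0.
have sx0 : s - x != 0 by rewrite subr_eq0.
have h := hd s s0 sx xs.
rewrite distrC (distrC x) -(mulKf sx0 (f s - f x)).
rewrite mulrCA normrM mulrC; apply: ler_wpM2r => //.
rewrite -[X in `|X|](subrK (f' x)); apply: le_trans (ler_normD _ _) _.
by rewrite addrC lerD2l distrC ltW.
Qed.

Lemma derivative_on_Rplus_within t : 0 < t -> {within `[0, t], continuous f}.
Proof.
have cv x e : 0 <= x -> 0 < e -> exists2 d, 0 < d &
    forall s, 0 <= s -> `|x - s| < d -> `|f x - f s| <= e.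
  move=> x0 e0; have [d d0 [L L0 hL]] := derivative_on_Rplus_lipschitz x0.
  exists (Num.min d (e / L)); first by rewrite lt_min d0 divr_gt0.
  move=> s s0; rewrite lt_min => /andP[xd]; rewrite ltr_pdivlMr// mulrC => xe.
  by apply: le_trans (hL s s0 xd) _; exact: ltW.
move=> t0; apply/continuous_within_itvP => //; split.
- move=> x; rewrite in_itv/= => /andP[x0 _]; apply/cvgrPdist_le => e e0.
  have [d d0 hd] := cv x e (ltW x0) e0.
  near=> s; apply: hd.
    by apply: ltW; near: s; exact: lt_nbhsr.
  by near: s; exact: (@cvgr_dist_lt _ _ _ _ _ _ _ cvg_id _ d0).
- apply/cvgrPdist_le => e e0; have [d d0 hd] := cv 0 e (lexx 0) e0.
  near=> s; have s0 : 0 < s by near: s; exact: nbhs_right_gt.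
  apply: hd; first exact: ltW.
  by rewrite sub0r normrN ger0_norm ?(ltW s0)//; near: s; exact: nbhs_right_lt.
- apply/cvgrPdist_le => e e0; have [d d0 hd] := cv t e (ltW t0) e0.
  near=> s; have st : s < t by near: s; exact: nbhs_left_lt.
  apply: hd; first by apply: ltW; near: s; exact: nbhs_left_gt.
  rewrite ger0_norm ?subr_ge0 ?(ltW st)// ltrBlDr -ltrBlDl.
  by near: s; apply: nbhs_left_gt; rewrite ltrBlDr ltrDl.
Unshelve. all: by end_near.
Qed.

Lemma derivative_on_Rplus_right x : 0 <= x ->
  e^-1 * (f (x + e) - f x) @[e --> 0^'+] --> f' x.
Proof.
move=> x0; apply/cvgrPdist_lt => e e0; have [d d0 hd] := derivative_on_RplusP x0 e0.
near=> r; have r0 : 0 < r by near: r; exact: nbhs_right_gt.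
have xr : x + r - x = r by rewrite addrAC subrr add0r.
rewrite -{1}xr; apply: hd.
- by rewrite addr_ge0// ltW.
- by rewrite -subr_eq0 xr gt_eqF.
- by rewrite distrC xr ger0_norm ?(ltW r0)//; near: r; exact: nbhs_right_lt.
Unshelve. all: by end_near.
Qed.

(** The derivative exists everywhere but is only square integrable, possibly discontinuous, so the
    recovery of [f] rests on the fundamental theorem for right derivatives. *)
Lemma primitive_derivative_on_Rplus : in_L2 f' -> f 0 = 0 ->
  forall t, 0 <= t -> f t = primitive f' t.
Proof.
move=> /in_L2_L2p Lf' f0 t t0; rewrite (primitive_cut (L2p_integrable_lt t Lf')).
apply/esym/ftc_cut => //; last exact: derivative_on_Rplus_within.
by move=> x x0; apply: derivative_on_Rplus_right; exact: ltW.
Qed.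

End derivative.

(** * Comparison of norms and the value of the infimum *)

Lemma L2_norm_le {R : realType} (p q : R -> R) : in_L2 p -> in_L2 q ->
  0 <= \int[@lebesgue_measure R]_s ((cut q s - cut p s) * cut p s) ->
  (L2_norm p <= L2_norm q)%E.
Proof.
move=> Lp Lq; have mp := Lp.1; have mq := Lq.1.
have Lcp := in_L2_L2p Lp; have Lcq := in_L2_L2p Lq.
set P := cut p in Lcp *; set Q := cut q in Lcq *.
move=> h; rewrite /L2_norm !Lp_norm_sqr//.
have i1 := L2p_mul (L2pB Lcq Lcp) Lcp.
have i2 := L2p_mul (L2pB Lcq Lcp) (L2pB Lcq Lcp).
have i3 := L2p_mul Lcp Lcp.
have i4 := L2p_mul Lcq Lcq.
have E : \int[@lebesgue_measure R]_s (Q s * Q s) =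
    \int[@lebesgue_measure R]_s (P s * P s) +
    (\int[@lebesgue_measure R]_s ((Q s - P s) * (Q s - P s)) +
     2 * \int[@lebesgue_measure R]_s ((Q s - P s) * P s)).
  rewrite -RintegralZl// -RintegralD//; last exact (RintegrableZ measurableT 2 i1).
  rewrite -RintegralD//; last first.
    exact (RintegrableD measurableT i2 (RintegrableZ measurableT 2 i1)).
  by apply: eq_Rintegral => s _; ring.
have sqrE (g : R -> R) : L2p g -> (\int[@lebesgue_measure R]_s (g s ^+ 2)%:E =
    (\int[@lebesgue_measure R]_s (g s * g s))%:E)%E.
  move=> Lg; rewrite /Rintegral fineK; first by apply: eq_integral => s _.
  by apply: integrable_fin_num => //; exact (L2p_mul Lg Lg).
rewrite -/P -/Q (sqrE P Lcp) (sqrE Q Lcq).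
have P0 : 0 <= \int[@lebesgue_measure R]_s (P s * P s).
  by apply: Rintegral_ge0 => s _; rewrite -expr2 sqr_ge0.
have PQ : \int[@lebesgue_measure R]_s (P s * P s) <= \int[@lebesgue_measure R]_s (Q s * Q s).
  rewrite E lerDl addr_ge0//; last exact: mulr_ge0.
  by apply: Rintegral_ge0 => s _; rewrite -expr2 sqr_ge0.
apply: gt0_ler_poweR.
- by rewrite invr_ge0.
- by rewrite in_itv/= leey andbT lee_fin.
- by rewrite in_itv/= leey andbT lee_fin (le_trans P0).
- by rewrite lee_fin.
Qed.

Theorem corollary3p3 (R : realType) (d : measure_display)
    (T : measurableType d) (P : probability T R) (H : R) (B : R -> T -> R)
    (u f f' phi ht ht' K fhat' : R -> R)
    (H_gt0 : 0 < H) (H_lt1 : H < 1) (H_neq : H != 2^-1)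
    (B_fBm : fractional_Brownian_motion P H B)
    (u_meas : measurable_fun Rplus u) (u0 : 0 <= u 0)
    (Pu : (0 < prob_below P B u < 1)%E)
    (f_diff : derivative_on_Rplus f f') (f'_L2 : in_L2 f')
    (* phi = K_{0+}^{H,*} f' *)
    (phi_def : Kleft_star H f' phi) (phi_L2 : in_L2 phi) (f_rkhs : rkhs H f)
    (* h = primitive phi, K = K_{oo-}^{H,*} ht' *)
    (ht_def : least_concave_nondecreasing_majorant (primitive phi) ht)
    (ht'_def : right_derivative ht ht') (ht'_L2 : in_L2 ht')
    (K_def : Kright_star H ht' K)
    (K_noninc : forall s t : R, 0 < s -> s <= t -> K t <= K s)
    (K_L2H : 2^-1 < H -> in_L2H H K)
    (K_L2Ht : H < 2^-1 -> in_L2H_tilde H K)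
    (K_littleo : forall eps : R, 0 < eps ->
       \forall t \near +oo, `|K t| <= eps * t `^ (- H))
    (* ht' = K_{0+}^{H,*} fhat' *)
    (fhat'_L2 : in_L2 fhat') (fhat'_def : Kleft_star H fhat' ht')
    (fhat_ge : H < 2^-1 -> forall t : R, 0 <= t -> f t <= primitive fhat' t) :
  let fhat := primitive fhat' in
  [/\ rkhs H fhat,
      ereal_inf [set rkhs_norm H g |
                 g in [set g | rkhs H g /\ forall t : R, 0 <= t -> f t <= g t]]
        = rkhs_norm H fhat &
      rkhs_norm H fhat = L2_norm ht'].
Proof.
move=> fhat.
have Lphi := in_L2_L2p phi_L2; have Lht := in_L2_L2p ht'_L2.
have C0 : 0 < C1 H := C1_gt0 H_gt0 H_lt1.
pose q := cut phi.
have mh : least_concave_nondecreasing_majorant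
    (fun t => \int[@lebesgue_measure R]_x (q x * (x < t)%R%:R)) ht.
  move: ht_def; congr least_concave_nondecreasing_majorant; apply/funext => t.
  exact: primitive_cut (L2p_integrable_lt t Lphi).
have cm : convex_function Rplus (fun t => - ht t : R^o) by case: mh => -[].
have nm : {in Rplus &, {homo ht : s t / s <= t}} by case: mh => -[].
have ht'_ge0 s : 0 < s -> 0 <= ht' s by exact: right_derivative_ge0 cm nm ht'_def s.
(* The derivative leaves the constant of integration open; membership in the space fixes it, because
   the representing integral at 0 runs over an empty interval. *)
have f0 : f 0 = 0.
  case: f_rkhs => psi [_ ->//].
  by rewrite set_itvoo0 ?Rintegral_set0.
have fE t : 0 <= t -> f t = C1 H * \int[@lebesgue_measure R]_s (KN H t s * q s).
  move=> t0; rewrite (primitive_derivative_on_Rplus f_diff f'_L2 f0 t0).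
  exact: (primitive_Kleft_star H_gt0 H_lt1 H_neq f'_L2 phi_L2 phi_def).
have fhatE t : 0 <= t -> fhat t = C1 H * \int[@lebesgue_measure R]_s (KN H t s * cut ht' s).
  exact: (primitive_Kleft_star H_gt0 H_lt1 H_neq fhat'_L2 ht'_L2 fhat'_def).
have iKN t (chi : R -> R) : L2p chi ->
    (@lebesgue_measure R).-integrable setT (EFin \o (fun s => KN H t s * chi s)).
  by move=> Lchi; apply: L2p_mul => //; exact: KN_L2p.
have fhat_repr : rkhs_repr H fhat ht' by apply/(rkhs_reprE H_gt0 H_lt1 H_neq).
have fhat_rkhs : rkhs H fhat by exists ht'.
have fhat_norm := rkhs_norm_repr H_gt0 H_lt1 H_neq fhat_repr.
have f_le t : 0 <= t -> f t <= fhat t.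
  move=> t0; have [Hlt|Hgt] := ltP H 2^-1; first exact: fhat_ge.
  have LK := KN_L2p H_gt0 H_lt1 H_neq t.
  have cK : cut (KN H t) = KN H t.
    apply/funext => s; have [s0|s0] := leP s 0; last by rewrite cutE.
    by rewrite cut_le0// KN_le0.
  rewrite fE// fhatE// ler_pM2l// -subr_ge0 -RintegralB//; [|exact: iKN..].
  have := @least_majorant_pairing_ge0 R q ht ht' Lphi Lht mh ht'_def (KN H t).
  rewrite cK => h; have := h _ _ _ LK.
  have -> : \int[@lebesgue_measure R]_s ((cut ht' s - q s) * KN H t s) =
      \int[@lebesgue_measure R]_x (KN H t x * cut ht' x - KN H t x * q x).
    by apply: eq_Rintegral => s _; ring.
  apply.
  - by move=> s _; exact: KN_ge0.
  - move=> s r s0 sr; rewrite /KN ltNge Hgt/=; apply: KNpos_anti => //.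
      by rewrite subr_gt0 lt_neqAle eq_sym H_neq.
    by move: H_lt1; lra.
  - by move=> y y0; exists t => s ts; rewrite KN_supp ?ltW.
have orth := least_majorant_orthogonal Lphi Lht mh ht'_def.
split => //; apply/eqP; rewrite eq_le; apply/andP; split.
  by apply: ereal_inf_lbound; exists fhat.
rewrite fhat_norm; apply: le_ereal_inf_tmp => _ [g [[psi g_repr] fg] <-].
rewrite (rkhs_norm_repr H_gt0 H_lt1 H_neq g_repr).
have [psi_L2 gE] := (rkhs_reprE H_gt0 H_lt1 H_neq g psi).1 g_repr.
have Lpsi := in_L2_L2p psi_L2.
apply: L2_norm_le => //.
have Lchi : L2p (fun s => cut psi s - q s) by exact: L2pB.
have chi_ge0 t : 0 <= t -> 0 <= \int[@lebesgue_measure R]_s (KN H t s * (cut psi s - q s)).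
  move=> t0; under eq_Rintegral do rewrite mulrBr.
  rewrite RintegralB//; [|exact: iKN..].
  by rewrite subr_ge0 -(ler_pM2l C0) -fE// -gE// fg.
have [K_ge0 K_bounded] := littleo_ge0 H_gt0 K_noninc K_littleo.
have pair_ge0 : 0 <= \int[@lebesgue_measure R]_s ((cut psi s - q s) * cut ht' s).
  have [Hlt|Hgt] := ltP H 2^-1.
    exact: (Kright_star_pairing_neg H_gt0 H_lt1 Hlt Lht Lchi ht'_ge0 K_def K_noninc).
  have Hgt' : 2^-1 < H by rewrite lt_neqAle eq_sym H_neq.
  exact: (Kright_star_pairing_pos H_gt0 H_lt1 Hgt' Lht Lchi K_def K_ge0 K_noninc).
have E : \int[@lebesgue_measure R]_s ((cut psi s - cut ht' s) * cut ht' s) =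
    \int[@lebesgue_measure R]_s ((cut psi s - q s) * cut ht' s) -
    \int[@lebesgue_measure R]_s ((cut ht' s - q s) * cut ht' s).
  rewrite -RintegralB//.
  - by apply: eq_Rintegral => s _; ring.
  - exact: L2p_mul.
  - by apply: L2p_mul => //; exact: L2pB.
by rewrite E orth subr0.
Qed.
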